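(* Let $X$ and $Y$ be reflexive Banach spaces, let $F_i\colon X\rightrightarrows Y$, $i=1,2$, be set-valued mappings with closed graphs, and let $(\bar x,\bar y)\in\operatorname{gph}(F_1+F_2)$. Define $S\colon X\times Y\rightrightarrows Y\times Y$ by $$S(x,y):=\{(y_1,y_2)\in Y\times Y\mid y_1\in F_1(x),\ y_2\in F_2(x),\ y_1+y_2=y\}.$$ Fix $(\bar y_1,\bar y_2)\in S(\bar x,\bar y)$ such that $S$ is inner semicontinuous at $(\bar x,\bar y,\bar y_1,\bar y_2)$. Assume that either $F_1$ is PSCNC at $(\bar x,\bar y_1)$ or $F_2$ is PSCNC at $(\bar x,\bar y_2)$, and that $$D^*_CF_1(\bar x,\bar y_1)(0)\cap\big(-D^*_CF_2(\bar x,\bar y_2)(0)\big)=\{0\}.$$ Then for every $y^*\in Y^*$, $$D^*_C(F_1+F_2)(\bar x,\bar y)(y^* )\subseteq D^*_CF_1(\bar x,\bar y_1)(y^* )+D^*_CF_2(\bar x,\bar y_2)(y^* ).$$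
   Context: $\operatorname{gph}F=\{(x,y)\mid y\in F(x)\}$ and $(F_1+F_2)(x)=F_1(x)+F_2(x)$ (Minkowski sum). Clarke normal cone: for a function $\psi\colon Z\to\mathbb R$ on a Banach space $Z$ that is Lipschitz around $\bar z$, put $\psi^\circ(\bar z;v)=\limsup_{z\to\bar z,\,t\downarrow0}\frac{\psi(z+tv)-\psi(z)}{t}$ and $\partial_C\psi(\bar z)=\{z^*\in Z^*\mid\langle z^*,v\rangle\le\psi^\circ(\bar z;v)\ \forall v\in Z\}$. For a nonempty set $\Omega\subseteq Z$ and $\bar z\in\Omega$, $N_C(\bar z;\Omega)$ is the weak$^*$ closure of $\bigcup_{\lambda>0}\lambda\,\partial_C\operatorname{dist}(\cdot;\Omega)(\bar z)$, where $\operatorname{dist}(z;\Omega)=\inf_{w\in\Omega}\|z-w\|$. The Clarke coderivative of $F\colon X\rightrightarrows Y$ at $(\bar x,\bar y)\in\operatorname{gph}F$ is $D^*_CF(\bar x,\bar y)(y^* )=\{x^*\in X^*\mid(x^*,-y^* )\in N_C((\bar x,\bar y);\operatorname{gph}F)\}$. Mordukhovich normal cone: for $\bar z\in\Omega$, $\widehat N(\bar z;\Omega)=\{z^*\in Z^*\mid\limsup_{z\to\bar z,\,z\in\Omega}\frac{\langle z^*,z-\bar z\rangle}{\|z-\bar z\|}\le0\}$, and $\widehat N(\bar z;\Omega)=\emptyset$ if $\bar z\notin\Omega$. $N(\bar z;\Omega)$ is the set of all $z^*\in Z^*$ for which there are sequences $z_k\to\bar z$ and $z_k^*\in\widehat N(z_k;\Omega)$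 with $z_k^*\to z^*$ weak$^*$. PSCNC: a set $\Omega\subseteq X\times Y$ is partially sequentially convexifically normally compact (PSCNC) at $(\bar x,\bar y)\in\Omega$ (with respect to $X$) if for any sequences $(x_k,y_k)\to(\bar x,\bar y)$ with $(x_k,y_k)\in\Omega$ and $(x_k^*,y_k^* )\in\operatorname{co}N((x_k,y_k);\Omega)$ such that $x_k^*\to0$ weakly and $\|y_k^*\|\to0$, one has $\|x_k^*\|\to0$. A mapping $F\colon X\rightrightarrows Y$ is PSCNC at $(\bar x,\bar y)\in\operatorname{gph}F$ if its graph is PSCNC at this point. Inner semicontinuity: $S$ is inner semicontinuous at $(\bar x,\bar y,\bar y_1,\bar y_2)\in\operatorname{gph}S$ if for any sequence $(x_k,y_k)\to(\bar x,\bar y)$ with $S(x_k,y_k)\ne\emptyset$ for each $k$, there exist $(y_{1k},y_{2k})\in S(x_k,y_k)$ such that $\{(y_{1k},y_{2k})\}$ contains a subsequence converging to $(\bar y_1,\bar y_2)$. *)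

(* Defs.v *)
From HB Require Import structures.
From mathcomp Require Import all_boot all_order all_algebra.
From mathcomp Require Import all_classical all_reals all_analysis.

Set Implicit Arguments.
Unset Strict Implicit.
Unset Printing Implicit Defensive.

Import Order.TTheory GRing.Theory Num.Theory.
Import numFieldNormedType.Exports.

Local Open Scope classical_set_scope.
Local Open Scope ring_scope.

Section TopologicalDual.
Context (R : realType) (X : normedModType R).

Definition continuous_functional : {pred (X -> R^o)} :=
  fun f => `[< linear f /\ continuous f >].

Lemma continuous_functionalP (f : X -> R^o) :
  reflect (linear f /\ continuous f) (f \in continuous_functional).
Proof. exact: asboolP. Qed.

Lemma continuous_functional_submod : submod_closed continuous_functional.
Proof.
split=> [|a f g /continuous_functionalP [lf cf] /continuous_functionalP [lg cg]].
  apply/continuous_functionalP; split=> [k x y|]; last exact: cst_continuous.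
  by rewrite /GRing.zero/= scaler0 addr0.
apply/continuous_functionalP; split=> [k x y|x].
  rewrite !fctE/= lf lg !scalerDr !scalerA [k * a]mulrC.
  by rewrite addrACA.
by apply: cvgD; [apply: cvgZl_tmp; exact: cf|exact: cg].
Qed.

HB.instance Definition _ := GRing.isSubmodClosed.Build R (X -> R^o)
  continuous_functional continuous_functional_submod.

Record topdual : Type := TopDual {
  topdual_fun :> X -> R^o ;
  _ : topdual_fun \in continuous_functional }.

HB.instance Definition _ := [isSub for topdual_fun].
HB.instance Definition _ := [Choice of topdual by <:].
HB.instance Definition _ := [SubChoice_isSubLmodule of topdual by <:].

Lemma topdual_linear (f : topdual) : linear f.
Proof. by case/continuous_functionalP: (valP f). Qed.

Lemma topdual_continuous (f : topdual) : continuous f.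
Proof. by case/continuous_functionalP: (valP f). Qed.

HB.instance Definition _ (f : topdual) :=
  GRing.isLinear.Build R X R^o *:%R f (topdual_linear f).

Lemma topdualP (f g : topdual) : f =1 g -> f = g.
Proof. by move=> fg; apply/val_inj/funext. Qed.

Definition topdual_norm (f : topdual) : R :=
  sup [set `|f x| | x in [set x : X | `|x| <= 1]].

Lemma topdual_has_sup (f : topdual) :
  has_sup [set `|f x| | x in [set x : X | `|x| <= 1]].
Proof.
split; first by exists `|f 0|, 0 => //=; rewrite normr0.
have /linear_boundedP/pinfty_ex_gt0 [M M0 fM] : bounded_near f (nbhs (0 : X)).
  by apply/linear_bounded_continuous; exact: topdual_continuous.
exists M => _ [x /= x1 <-]; apply: le_trans (fM x) _.
by rewrite ler_piMr// ltW.
Qed.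

Lemma topdual_norm_ub (f : topdual) (x : X) : `|x| <= 1 -> `|f x| <= topdual_norm f.
Proof.
by move=> x1; apply: ub_le_sup; [case: (topdual_has_sup f)|exists x].
Qed.

Lemma topdual_norm_lub (f : topdual) (c : R) :
  (forall x : X, `|x| <= 1 -> `|f x| <= c) -> topdual_norm f <= c.
Proof.
move=> fc; apply: ge_sup; first by case: (topdual_has_sup f).
by move=> _ [x /= x1 <-]; exact: fc.
Qed.

Lemma topdual_norm_ge0 (f : topdual) : 0 <= topdual_norm f.
Proof.
have := @topdual_norm_ub f 0; rewrite normr0 => /(_ ler01).
exact: le_trans.
Qed.

Lemma topdual_norm_le (f : topdual) (x : X) : `|f x| <= topdual_norm f * `|x|.
Proof.
have [->|x0] := eqVneq x 0; first by rewrite linear0 !normr0 mulr0.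
have xp : 0 < `|x| by rewrite normr_gt0.
have := @topdual_norm_ub f (`|x|^-1 *: x).
rewrite normrZ normfV normr_id mulVf ?gt_eqF// => /(_ (lexx _)).
by rewrite linearZ/= normrZ normfV normr_id mulrC ler_pdivrMr.
Qed.

Lemma topdual_normD (f g : topdual) :
  topdual_norm (f + g) <= topdual_norm f + topdual_norm g.
Proof.
apply: topdual_norm_lub => x x1; apply: le_trans (ler_normD _ _) _.
by apply: lerD; exact: topdual_norm_ub.
Qed.

Lemma topdual_normZ (l : R) (f : topdual) :
  topdual_norm (l *: f) = `|l| * topdual_norm f.
Proof.
have le k g : topdual_norm (k *: g) <= `|k| * topdual_norm g.
  apply: topdual_norm_lub => x x1; rewrite [X in `|X|](_ : _ = k *: g x)// normrZ.
  by rewrite ler_wpM2l// topdual_norm_ub.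
have [->|l0] := eqVneq l 0.
  apply/eqP; rewrite normr0 mul0r eq_le topdual_norm_ge0 andbT.
  by apply: le_trans (le _ _) _; rewrite normr0 mul0r.
apply/eqP; rewrite eq_le le/= -ler_pdivlMl ?normr_gt0// -normfV.
by apply: le_trans (le _ _); rewrite scalerA mulVf// scale1r.
Qed.

Lemma topdual_norm0_eq0 (f : topdual) : topdual_norm f = 0 -> f = 0.
Proof.
move=> f0; apply: topdualP => x; apply/eqP; rewrite -normr_le0.
by have := topdual_norm_le f x; rewrite f0 mul0r.
Qed.

HB.instance Definition _ := @Lmodule_isNormed.Build R topdual topdual_norm
  topdual_normD topdual_normZ topdual_norm0_eq0.

End TopologicalDual.

Section BidualAndProduct.
Context (R : realType).

Lemma topdual_eval_subproof (X : normedModType R) (x : X) :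
  (fun f : topdual X => f x) \in @continuous_functional R (topdual X).
Proof.
apply/continuous_functionalP.
have lin : linear (fun f : topdual X => f x : R^o) by [].
split=> //.
pose L := GRing.isLinear.Build R (topdual X) R^o *:%R _ lin.
pose h : {linear topdual X -> R^o} := HB.pack (fun f : topdual X => f x : R^o) L.
apply: (@bounded_linear_continuous _ _ _ h).
apply/linear_boundedP; near=> r => f; apply: le_trans (topdual_norm_le f x) _.
by rewrite mulrC ler_wpM2r ?topdual_norm_ge0.
Unshelve. all: by end_near. Qed.

Definition topdual_eval (X : normedModType R) (x : X) : topdual (topdual X) :=
  TopDual (topdual_eval_subproof x).

Definition reflexive_space (X : normedModType R) : Prop :=
  set_surj [set: X] [set: topdual (topdual X)] (@topdual_eval X).

Lemma pair_topdual_subproof (X Y : normedModType R)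
    (f : topdual X) (g : topdual Y) :
  (fun z : X * Y => f z.1 + g z.2) \in @continuous_functional R (X * Y)%type.
Proof.
apply/continuous_functionalP; split=> [k x y|z].
  by rewrite !linearP/= !scalerDr addrACA.
apply: cvgD; apply: continuous_comp.
- exact: cvg_fst.
- exact: topdual_continuous.
- exact: cvg_snd.
- exact: topdual_continuous.
Qed.

(* X * Y carries the maximum norm.  The dual of X * Y is identified with the product of the duals by
   <(f, g), (x, y)> = <f, x> + <g, y>. *)
Definition pair_topdual (X Y : normedModType R)
    (f : topdual X) (g : topdual Y) : topdual (X * Y)%type :=
  TopDual (pair_topdual_subproof f g).

End BidualAndProduct.

(* X with its weak topology, induced by the functionals of its dual. *)
Definition weak_space (R : realType) (X : normedModType R) : Type :=
  initial_topology (fun x : X => (fun f => f x) : {ptws topdual X -> R^o}).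

HB.instance Definition _ (R : realType) (X : normedModType R) :=
  Topological.copy (weak_space X)
    (initial_topology (fun x : X => (fun f => f x) : {ptws topdual X -> R^o})).

(* The dual of X with its weak* topology. *)
Definition weak_star_dual (R : realType) (X : normedModType R) : Type :=
  initial_topology (fun f : topdual X => (f : {ptws X -> R^o})).

HB.instance Definition _ (R : realType) (X : normedModType R) :=
  Topological.copy (weak_star_dual X)
    (initial_topology (fun f : topdual X => (f : {ptws X -> R^o}))).

Lemma cvg_initial (S : choiceType) (T : topologicalType) (f : S -> T)
    (F : set_system S) (s : S) : Filter F ->
  F --> (s : initial_topology f) <-> f @ F --> f s.
Proof.
move=> FF; split=> [H|H].
  exact: (@cvg_comp _ _ _ (fun x : initial_topology f => x) _ _ _ _ H
    (@initial_continuous _ _ f s)).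
move=> A /= [_ [[B Bop <-] Bs BA]].
have nB : nbhs (f s) B by apply: open_nbhs_nbhs.
by apply: filterS BA _; exact: (H B nB).
Qed.

Lemma cvg_ptws (I : eqType) (T : topologicalType) (F : set_system (I -> T))
    (g : I -> T) : Filter F ->
  F --> (g : {ptws I -> T}) <-> forall i, (fun h => h i) @ F --> g i.
Proof.
move=> FF; rewrite cvg_sup; split=> H i; have := H i; first by rewrite cvg_initial.
by move=> Hi; apply/(@cvg_initial _ _ (fun h : prod_topology (fun=> T) => h i)).
Qed.

Lemma weak_cvgP (R : realType) (X : normedModType R) (u : nat -> X) (l : X) :
  (u : nat -> weak_space X) @ \oo --> (l : weak_space X) <->
  forall f : topdual X, f (u n) @[n --> \oo] --> f l.
Proof. by split=> [/cvg_initial/cvg_ptws//|H]; apply/cvg_initial/cvg_ptws. Qed.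

Lemma weak_star_cvgP (R : realType) (X : normedModType R)
    (u : nat -> topdual X) (l : topdual X) :
  (u : nat -> weak_star_dual X) @ \oo --> (l : weak_star_dual X) <->
  forall x, u n x @[n --> \oo] --> l x.
Proof. by split=> [/cvg_initial/cvg_ptws//|H]; apply/cvg_initial/cvg_ptws. Qed.

Section GeneralizedNormals.
Context (R : realType) (Z : normedModType R).
Implicit Types (psi : Z -> R) (Omega : set Z) (z v : Z) (f : topdual Z).

Definition clarke_dderiv psi z v : \bar R :=
  limf_esup (fun p : Z * R => ((psi (p.1 + p.2 *: v) - psi p.1) / p.2)%:E)
    (filter_prod (nbhs z) (0 : R)^'+).

Definition clarke_subdiff psi z : set (topdual Z) :=
  [set f | forall v, ((f v)%:E <= clarke_dderiv psi z v)%E].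

Definition set_dist Omega z : R := inf [set `|z - w| | w in Omega].

(* Only meaningful for z in Omega. *)
Definition clarke_normal z Omega : set (topdual Z) :=
  closure (\bigcup_(l in [set l : R | 0 < l])
    [set l *: f | f in clarke_subdiff (set_dist Omega) z] : set (weak_star_dual Z)).

(* The punctured filter discards the meaningless quotient at z' = z; at an
   isolated point of Omega the limsup is over an empty set, hence -oo. *)
Definition prenormal z Omega : set (topdual Z) :=
  [set f | Omega z /\
    (limf_esup (fun z' => (f (z' - z) / `|z' - z|)%:E) (within Omega z^') <= 0)%E].

Definition limiting_normal z Omega : set (topdual Z) :=
  [set f | exists (z_ : nat -> Z) (f_ : nat -> topdual Z),
    [/\ z_ @ \oo --> z,
        forall k, prenormal (z_ k) Omega (f_ k) &
        (f_ : nat -> weak_star_dual Z) @ \oo --> (f : weak_star_dual Z)]].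

End GeneralizedNormals.

Definition convex_hull (R : realType) (V : lmodType R) (A : set V) : set V :=
  smallest (@convex_set R V) A.

Definition minkowski_sum (V : zmodType) (A B : set V) : set V :=
  [set a + b | a in A & b in B].

Section SetValuedMappings.
Context (R : realType) (X Y : normedModType R).
Implicit Types (F : X -> set Y) (x : X) (y : Y).

Definition gph F : set (X * Y) := [set p | F p.1 p.2].

Definition sum_mapping F1 F2 : X -> set Y :=
  fun x => minkowski_sum (F1 x) (F2 x).

(* Only meaningful for (x, y) in gph F. *)
Definition clarke_coderivative F x y (g : topdual Y) : set (topdual X) :=
  [set f | clarke_normal (x, y) (gph F) (pair_topdual f (- g))].

Definition pscnc_set (Omega : set (X * Y)) x y : Prop :=
  forall (x_ : nat -> X) (y_ : nat -> Y)
    (f_ : nat -> topdual X) (g_ : nat -> topdual Y),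
  (x_ k, y_ k) @[k --> \oo] --> (x, y) ->
  (forall k, Omega (x_ k, y_ k)) ->
  (forall k, convex_hull (limiting_normal (x_ k, y_ k) Omega)
               (pair_topdual (f_ k) (g_ k))) ->
  (f_ : nat -> weak_space (topdual X)) @ \oo --> (0 : weak_space (topdual X)) ->
  `|g_ k| @[k --> \oo] --> (0 : R) ->
  `|f_ k| @[k --> \oo] --> (0 : R).

Definition pscnc F x y : Prop := pscnc_set (gph F) x y.

End SetValuedMappings.

Definition sum_decomposition (R : realType) (X Y : normedModType R)
    (F1 F2 : X -> set Y) : X * Y -> set (Y * Y) :=
  fun p => [set q | [/\ F1 p.1 q.1, F2 p.1 q.2 & q.1 + q.2 = p.2]].

Definition inner_semicontinuous (U V : topologicalType)
    (S : U -> set V) (u : U) (v : V) : Prop :=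
  forall u_ : nat -> U, u_ @ \oo --> u -> (forall k, S (u_ k) !=set0) ->
  exists v_ : nat -> V, (forall k, S (u_ k) (v_ k)) /\
    exists phi : nat -> nat, increasing_seq phi /\ (v_ \o phi) @ \oo --> v.

(* Main.v *)
(* Under the qualification condition and PSCNC the graphs of F1 and F2, as subsets
   of X * Y, are metrically regular near the reference points with respect to the
   coincidence of the first coordinates: Ekeland's principle would otherwise give
   minimizers whose multipliers, normalized in X^*, converge weakly to zero by the
   qualification and strongly to zero by PSCNC.  Hence, along the decompositions
   given by inner semicontinuity, the Clarke derivative of the distance to the
   graph of F1 + F2 in a direction (u, v1 + v2) is at most C times the sum of those
   of the distances to gph F1 in the direction (u, v1) and to gph F2 in the
   direction (u, v2), and the Hahn-Banach theorem splits its Clarke subgradients.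
   The same qualification argument bounds the two parts, so that the splitting
   passes to the weak^* closure.

   PSCNC concerns convex combinations of limiting normals, while the argument uses
   Clarke subgradients of distance functions: in a reflexive space these are
   norm limits of such combinations.  This follows from a mean value inequality for
   the distance function, deduced from a smooth variational principle that needs no
   renorming: slopes far from the rational combinations of the slopes met so far are
   penalized, and Mazur's theorem shows that the limit slope is not. *)

From HB Require Import structures.
Require Import Defs.
From mathcomp Require Import all_boot all_order all_algebra.
From mathcomp Require Import all_classical all_reals all_analysis.
From mathcomp Require Import ring lra.

Import Order.TTheory GRing.Theory Num.Theory.
Import numFieldNormedType.Exports.

Set Implicit Arguments.
Unset Strict Implicit.
Unset Printing Implicit Defensive.

Local Open Scope classical_set_scope.
Local Open Scope ring_scope.

(** * The Hahn-Banach theorem *)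

(** Some reasons behind the steps. The dual norm need not be rotund, so penalizing slopes by the
    square of a norm need not single out one active slope. What remains is the strict convexity of
    the real square: two almost active slopes lie at almost equal distances from the centre of the
    penalty. This locates a slope only if the centre is itself close to the limit slope, which is
    unknown beforehand; hence every rational combination must serve as a centre at arbitrarily late
    stages. Limits are taken along ultrafilters, where bounded functionals converge pointwise
    without separability; sequences are extracted only where limiting normals demand them. Finally,
    the Clarke normal cone is a closure over unbounded multipliers, while a splitting acts on one
    subgradient at a time and gives no control of the size of its parts; the qualification is
    therefore met in two regimes, with moving base points and constant multiplier, and at the fixed
    base point with arbitrary multipliers. *)

Section Sublinear.
Context (R : realType) (V : lmodType R).
Implicit Types (p q : V -> R) (Q : set (V * R)).

Definition sublinear p :=
  (forall x y, p (x + y) <= p x + p y) /\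
  (forall t x, 0 <= t -> p (t *: x) = t * p x).

Definition convex_cone Q :=
  [/\ Q (0, 0),
      forall c d, Q c -> Q d -> Q (c.1 + d.1, c.2 + d.2) &
      forall t c, 0 < t -> Q c -> Q (t *: c.1, t * c.2)].

Lemma sublinear0 p : sublinear p -> p 0 = 0.
Proof. by case=> _ /(_ 0 0 (lexx _)); rewrite scale0r mul0r. Qed.

Lemma sublinearN p x : sublinear p -> - p (- x) <= p x.
Proof.
move=> sp; rewrite lerNl -subr_ge0 opprK -(sublinear0 sp) -(addNr x).
exact: sp.1.
Qed.

(** The infimal convolution of [p] with a cone of displacements and costs. Both lowering a
    functional along a ray and separating it from a cone are instances. *)
Definition inf_shift p Q (a : V) : R :=
  inf [set p (a + c.1) + c.2 | c in Q].

Section InfShift.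
Context (p : V -> R) (Q : set (V * R)).
Hypotheses (sp : sublinear p) (cQ : convex_cone Q).
Hypothesis pQ : forall c, Q c -> 0 <= p c.1 + c.2.

Let lb a : has_lbound [set p (a + c.1) + c.2 | c in Q].
Proof.
exists (- p (- a)) => _ [c Qc <-].
have := sp.1 (- a) (a + c.1); rewrite addKr => h; have := pQ Qc; lra.
Qed.

Let Q00 : Q (0, 0). Proof. by case: cQ. Qed.

Let ne a : [set p (a + c.1) + c.2 | c in Q] !=set0.
Proof. by exists (p (a + 0) + 0), (0, 0). Qed.

Lemma inf_shift_le a c : Q c -> inf_shift p Q a <= p (a + c.1) + c.2.
Proof. by move=> Qc; apply: ge_inf => //; exists c. Qed.

Lemma le_inf_shift a y :
  (forall c, Q c -> y <= p (a + c.1) + c.2) -> y <= inf_shift p Q a.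
Proof. by move=> h; apply: lb_le_inf => // _ [c Qc <-]; exact: h. Qed.

Lemma inf_shift_sublinear : sublinear (inf_shift p Q).
Proof.
have sc t a : 0 < t -> inf_shift p Q (t *: a) <= t * inf_shift p Q a.
  move=> t0; rewrite -ler_pdivrMl//; apply: le_inf_shift => c Qc.
  rewrite ler_pdivrMl// mulrDr -sp.2 ?(ltW t0)// scalerDr.
  have := @inf_shift_le (t *: a) (t *: c.1, t * c.2); apply.
  by case: cQ => _ _ h; exact: h.
have I0 : inf_shift p Q 0 = 0.
  apply/eqP; rewrite eq_le; apply/andP; split.
    by have := inf_shift_le 0 Q00; rewrite /= !addr0 (sublinear0 sp).
  by apply: le_inf_shift => c Qc; rewrite add0r pQ.
split=> [x y|t a].
  rewrite -lerBlDr; apply: le_inf_shift => c Qc.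
  rewrite lerBlDr -lerBlDl; apply: le_inf_shift => d Qd.
  have : Q (c.1 + d.1, c.2 + d.2) by case: cQ => _ h _; exact: h.
  move=> /(inf_shift_le (x + y)); rewrite lerBlDl => /le_trans; apply.
  by rewrite /= addrACA; have := sp.1 (x + c.1) (y + d.1); lra.
rewrite le_eqVlt => /predU1P[<-|t0]; first by rewrite scale0r mul0r.
apply/eqP; rewrite eq_le sc//= -ler_pdivlMl//.
by apply: le_trans (sc _ _ _); rewrite ?invr_gt0// scalerA mulVf ?gt_eqF// scale1r.
Qed.

End InfShift.

(** Shifting along the ray of [x] at the price [- p x] per unit cannot lower a minimal [p];
    evaluated at [- x], this says [p (- x) <= p 0 - p x]. *)
Lemma minimal_sublinear_odd p : sublinear p ->
  (forall q, sublinear q -> (forall x, q x <= p x) -> q = p) ->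
  forall x, p (- x) = - p x.
Proof.
move=> sp pmin x.
pose Q : set (V * R) := [set (t *: x, - (t * p x)) | t in [set t : R | 0 <= t]].
have cQ : convex_cone Q.
  split=> [|c d|t c t0].
  - by exists 0; rewrite //= scale0r mul0r oppr0.
  - move=> [s /= s0 <-] [t /= t0 <-]; exists (s + t); first exact: addr_ge0.
    by rewrite scalerDl mulrDl opprD.
  - move=> [s /= s0 <-]; exists (t * s); first by apply: mulr_ge0 => //; exact: ltW.
    by rewrite scalerA /= mulrN mulrA.
have pQ c : Q c -> 0 <= p c.1 + c.2.
  by move=> [t /= t0 <-]/=; rewrite sp.2// subrr.
have E : inf_shift p Q = p.
  apply: pmin (inf_shift_sublinear sp cQ pQ) _ => a.
  have := @inf_shift_le p Q sp pQ a (0, 0).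
  by rewrite /= !addr0; case: cQ => h _ _; apply.
apply/eqP; rewrite eq_le; apply/andP; split; last by rewrite lerNl sublinearN.
have := @inf_shift_le p Q sp pQ (- x) (x, - p x).
rewrite /= addNr (sublinear0 sp) add0r E; apply.
by exists 1 => /=; rewrite ?scale1r ?mul1r.
Qed.

(* Zorn's lemma on sublinear functionals: a minimal one is linear. *)
Lemma hahn_banach p : sublinear p ->
  exists f : V -> R, [/\ forall x y, f (x + y) = f x + f y,
    forall t x, f (t *: x) = t * f x & forall x, f x <= p x].
Proof.
move=> sp; pose T := {q : V -> R | sublinear q /\ forall x, q x <= p x}.
pose rT (q r : T) := `[< forall x, sval r x <= sval q x >].
have [|||F Ftot|[q [sq qp]] qmax] := @Zorn T rT.
- by move=> t; apply/asboolP.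
- move=> r s t /asboolP rs /asboolP st; apply/asboolP => x.
  exact: le_trans (st x) (rs x).
- move=> [s Ps] [t Pt] /asboolP/= st /asboolP/= ts; apply: eq_exist => /=.
  by apply/funext => x; apply/eqP; rewrite eq_le st ts.
- have [->|/set0P[t0 Ft0]] := eqVneq F set0.
    by exists (exist _ p (conj sp (fun=> lexx _))).
  pose m x := inf [set sval t x | t in F].
  have lb x : has_lbound [set sval t x | t in F].
    exists (- p (- x)) => _ [[t [st tp]] Ft <-] /=.
    by apply: le_trans (sublinearN x st); rewrite lerN2.
  have ne x : [set sval t x | t in F] !=set0 by exists (sval t0 x), t0.
  have mle x t : F t -> m x <= sval t x by move=> Ft; apply: ge_inf => //; exists t.
  have lem x y : (forall t, F t -> y <= sval t x) -> y <= m x.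
    by move=> h; apply: lb_le_inf => // _ [t Ft <-]; exact: h.
  have sm : sublinear m.
    have sc t a : 0 < t -> m (t *: a) <= t * m a.
      move=> t_gt0; rewrite -ler_pdivrMl//; apply: (lem) => c Fc.
      by rewrite ler_pdivrMl// -(svalP c).1.2 ?(ltW t_gt0)//; exact: mle.
    split=> [x y|t a].
      rewrite -lerBlDr; apply: (lem) => c Fc.
      rewrite lerBlDr -lerBlDl; apply: (lem) => d Fd; rewrite lerBlDl.
      (* Subadditivity of the pointwise infimum: both arguments are evaluated with the smaller of
         the two members of the chain. *)
      have [/asboolP cd|/asboolP dc] := Ftot _ _ Fc Fd.
        apply: le_trans (mle _ _ Fd) _; apply: le_trans ((svalP d).1.1 _ _) _.
        by rewrite lerD2r.
      apply: le_trans (mle _ _ Fc) _; apply: le_trans ((svalP c).1.1 _ _) _.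
      by rewrite lerD2l.
    rewrite le_eqVlt => /predU1P[<-|t_gt0].
      rewrite scale0r mul0r; apply/eqP; rewrite eq_le; apply/andP; split.
        by apply: le_trans (mle _ _ Ft0) _; rewrite (sublinear0 (svalP t0).1).
      by apply: (lem) => s Fs; rewrite (sublinear0 (svalP s).1).
    apply/eqP; rewrite eq_le sc//= -ler_pdivlMl//.
    by apply: le_trans (sc _ _ _); rewrite ?invr_gt0// scalerA mulVf ?gt_eqF// scale1r.
  have mp x : m x <= p x by apply: le_trans (mle _ _ Ft0) _; exact: (svalP t0).2.
  exists (exist _ m (conj sm mp)) => t Ft; apply/asboolP => x; exact: mle.
have qmin r : sublinear r -> (forall x, r x <= q x) -> r = q.
  move=> sr rq.
  have := qmax (exist _ r (conj sr (fun x => le_trans (rq x) (qp x)))).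
  by move=> /(_ (introT (asboolP _) rq)) /(congr1 sval).
have odd := minimal_sublinear_odd sq qmin.
exists q; split=> // [x y|t x].
  apply/eqP; rewrite eq_le sq.1/= -[leRHS]opprK -odd opprD.
  rewrite lerNr; apply: le_trans (sq.1 _ _) _; by rewrite !odd -opprD.
have [t0|t0] := leP 0 t; first exact: sq.2.
by rewrite -[t]opprK scaleNr odd sq.2 ?mulNr// oppr_ge0; exact: ltW.
Qed.

(* The functional -f is dominated on Q by the second coordinate. *)
Lemma sandwich p Q : sublinear p -> convex_cone Q ->
  (forall c, Q c -> 0 <= p c.1 + c.2) ->
  exists f : V -> R, [/\ forall x y, f (x + y) = f x + f y,
    forall t x, f (t *: x) = t * f x, forall x, f x <= p x &
    forall c, Q c -> - c.2 <= f c.1].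
Proof.
move=> sp cQ pQ; have [f [fD fZ fle]] := hahn_banach (inf_shift_sublinear sp cQ pQ).
have fN x : f (- x) = - f x by rewrite -scaleN1r fZ mulN1r.
exists f; split=> // [x|c Qc].
  apply: le_trans (fle x) _; case: cQ => Q0 _ _.
  by have := inf_shift_le sp pQ x Q0; rewrite /= !addr0.
rewrite lerNl -fN; apply: le_trans (fle _) _.
by have := inf_shift_le sp pQ (- c.1) Qc; rewrite addNr (sublinear0 sp) add0r.
Qed.

End Sublinear.

(** * Duality in reflexive spaces *)

Section ConvexSets.
Context (R : realType) (V : lmodType R).
Implicit Types A S : set V.

Lemma convex_setP A : convex_set A <->
  forall x y (t : R), A x -> A y -> 0 <= t -> t <= 1 -> A (t *: x + (1 - t) *: y).
Proof.
split=> [cA x y t Ax Ay t0 t1|cA x y l /set_mem Ax /set_mem Ay].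
  by have /set_mem := cA x y (Itv01 t0 t1) (mem_set Ax) (mem_set Ay).
by apply/mem_set; apply: cA.
Qed.

Lemma sub_convex_hull S : S `<=` convex_hull S.
Proof. by move=> x Sx A [_]; exact. Qed.

Lemma convex_hull_convex S : convex_set (convex_hull S).
Proof.
apply/convex_setP => x y t hx hy t0 t1 A [cA SA].
by move/convex_setP: (cA); apply=> //; [exact: hx|exact: hy].
Qed.

Lemma convex_hull_min S A : convex_set A -> S `<=` A -> convex_hull S `<=` A.
Proof. by move=> cA SA x; apply. Qed.

End ConvexSets.

Section Functionals.
Context (R : realType).
Implicit Types V : normedModType R.

Lemma topdual_extend V (f : V -> R) (C : R) :
  (forall x y, f (x + y) = f x + f y) -> (forall t x, f (t *: x) = t * f x) ->
  0 <= C -> (forall x, `|f x| <= C * `|x|) ->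
  exists2 F : topdual V, F =1 f & `|F| <= C.
Proof.
move=> fD fZ C0 fC.
have lin : linear (f : V -> R^o) by move=> k x y; rewrite fD fZ.
pose L := GRing.isLinear.Build R V R^o *:%R (f : V -> R^o) lin.
pose h : {linear V -> R^o} := HB.pack (f : V -> R^o) L.
have cf : continuous (h : V -> R^o).
  apply: (@bounded_linear_continuous _ _ _ h).
  apply/linear_boundedP; near=> r => x; apply: le_trans (fC x) _.
  by rewrite ler_wpM2r.
have hP : (f : V -> R^o) \in @continuous_functional R V.
  by apply/continuous_functionalP; split.
exists (TopDual hP) => //; apply: topdual_norm_lub => x x1.
by apply: le_trans (fC x) _; rewrite ler_piMr.
Unshelve. all: by end_near. Qed.

Lemma topdual_le V (f : topdual V) x : `|f x| <= `|f| * `|x|.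
Proof. exact: topdual_norm_le. Qed.

Lemma topdual_lub V (f : topdual V) (C : R) : 0 <= C ->
  (forall x, f x <= C * `|x|) -> `|f| <= C.
Proof.
move=> C0 fC; apply: topdual_norm_lub => x x1; rewrite ler_norml.
have h y : `|y| <= 1 -> f y <= C by move=> y1; apply: le_trans (fC y) _; rewrite ler_piMr.
by rewrite h// andbT lerNl -linearN h// normrN.
Qed.

Lemma topdualD V (f : topdual V) x y : f (x + y) = f x + f y.
Proof. exact: linearD. Qed.

Lemma topdualN V (f : topdual V) x : f (- x) = - f x.
Proof. exact: linearN. Qed.

Lemma topdualZ V (f : topdual V) t x : f (t *: x) = t * f x.
Proof. exact: linearZ. Qed.

Definition topdualE := (topdualD, topdualN, topdualZ).

Lemma topdual_addE V (f g : topdual V) x : (f + g) x = f x + g x.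
Proof. by []. Qed.

Lemma topdual_oppE V (f : topdual V) x : (- f) x = - f x.
Proof. by []. Qed.

Lemma topdual_scaleE V (f : topdual V) t x : (t *: f) x = t * f x.
Proof. by []. Qed.

Lemma topdual_zeroE V x : (0 : topdual V) x = 0.
Proof. by []. Qed.

Definition topdual_evalE :=
  (topdual_addE, topdual_oppE, topdual_scaleE, topdual_zeroE).

Lemma norm_sublinear V : sublinear (fun x : V => `|x|).
Proof.
split=> [x y|t x t0]; first exact: ler_normD.
by rewrite normrZ ger0_norm.
Qed.

(** [sandwich] for the norm and the cone spanned by the pairs [(f - c, - d)]: the distance
    hypothesis is exactly the nonnegativity required there. *)
Lemma convex_separation V (C : set V) (f : V) (d : R) :
  convex_set C -> C !=set0 -> (forall c, C c -> d <= `|f - c|) ->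
  exists2 phi : topdual V, `|phi| <= 1 & forall c, C c -> phi c + d <= phi f.
Proof.
move=> /convex_setP cC [c0 Cc0] dC.
pose Q : set (V * R) := [set q | exists l c,
  [/\ 0 <= l, C c, q.1 = l *: (f - c) & q.2 = - (l * d)]].
have cQ : convex_cone Q.
  split=> [|q r [l [c [l0 Cc q1 q2]]] [m [e [m0 Ce r1 r2]]]|
            t q t0 [l [c [l0 Cc q1 q2]]]].
  - by exists 0, c0; rewrite scale0r mul0r oppr0.
  - rewrite q1 q2 r1 r2.
    have [lm0|lm0] := eqVneq (l + m) 0.
      have l00 : l = 0 by lra.
      have m00 : m = 0 by lra.
      by exists 0, c0; rewrite /= l00 m00 !scale0r !mul0r oppr0 !addr0.
    have lmp : 0 < l + m by lra.
    pose a := l / (l + m).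
    have la : (l + m) * a = l by rewrite mulrCA mulfV// mulr1.
    have ma : (l + m) * (1 - a) = m by rewrite mulrBr mulr1 la addrAC subrr add0r.
    exists (l + m), (a *: c + (1 - a) *: e); split => /=.
    - lra.
    - apply: cC => //; first by rewrite divr_ge0// ltW.
      by rewrite ler_pdivrMr// mul1r lerDl.
    - rewrite [RHS]scalerBr [in RHS]scalerDr !scalerA la ma scalerDl !scalerBr.
      by rewrite opprD addrACA.
    - rewrite /=; ring.
  - exists (t * l), c; rewrite q1 q2 scalerA /=; split => //; last by ring.
    by apply: mulr_ge0 => //; exact: ltW.
have pQ q : Q q -> 0 <= `|q.1| + q.2.
  move=> [l [c [l0 Cc -> ->]]]; rewrite normrZ ger0_norm// -mulrBr.
  by rewrite mulr_ge0// subr_ge0 dC.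
have [phi [phiD phiZ phile phiQ]] := sandwich (norm_sublinear V) cQ pQ.
have phiN x : phi (- x) = - phi x by rewrite -scaleN1r phiZ mulN1r.
have [|F Fphi F1] := topdual_extend phiD phiZ ler01.
  move=> x; rewrite mul1r ler_norml phile andbT lerNl -phiN.
  by rewrite -[leRHS]normrN phile.
exists F => // c Cc; rewrite !Fphi.
have := phiQ (f - c, - d); rewrite /= opprK phiD phiN => h.
suff : d <= phi f - phi c by lra.
by apply: h; exists 1, c; rewrite scale1r mul1r.
Qed.

Lemma norming_functional V (x : V) :
  exists2 phi : topdual V, `|phi| <= 1 & phi x = `|x|.
Proof.
have c0 : convex_set [set (0 : V)].
  by apply/convex_setP => a b t -> -> _ _; rewrite /= !scaler0 addr0.
have [|c ->|phi phi1 /(_ 0)] := @convex_separation V [set 0] x `|x| c0.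
- by exists 0.
- by rewrite subr0.
rewrite linear0 add0r => /(_ erefl) le; exists phi => //.
apply/eqP; rewrite eq_le le andbT; apply: le_trans (ler_norm _) _.
by apply: le_trans (topdual_le _ _) _; rewrite ler_piMl.
Qed.

(* Reduces identities in a normed module to identities between reals. *)
Lemma eq_topdual V (x y : V) : (forall phi : topdual V, phi x = phi y) -> x = y.
Proof.
move=> xy; apply/eqP; rewrite -subr_eq0 -normr_eq0.
have [phi _ <-] := norming_functional (x - y).
by rewrite topdualD topdualN xy subrr.
Qed.

End Functionals.

(** * Limits of bounded functionals along ultrafilters *)

Section UltraLimits.
Context (R : realType).

Lemma ultra_bounded_cvg (U : set_system nat) (a : nat -> R) (C : R) :
  UltraFilter U -> (forall k, `|a k| <= C) -> exists l : R, a k @[k --> U] --> l.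
Proof.
move=> UU aC.
have [l [_ cl]] : (`[- C, C] `&` cluster (a @ U)) !=set0.
  apply: (@segment_compact R (- C) C).
  apply: (@filterS _ U _ setT) => [k _ /=|]; last exact: filterT.
  by rewrite in_itv /= -ler_norml.
exists l => A lA; rewrite /nbhs /=.
have [//|nA] := in_ultra_setVsetC (a @^-1` A) UU.
have [y [/= nAy Ay]] := cl (~` A) A nA lA.
by [].
Qed.

(** If convergence fails, the indices with error above [e] meet every tail; an ultrafilter
    containing them and all tails refutes the hypothesis. *)
Lemma cvg_ultra (a : nat -> R) (l : R) :
  (forall U : set_system nat, UltraFilter U -> \oo `<=` U -> a k @[k --> U] --> l) ->
  a k @[k --> \oo] --> l.
Proof.
move=> aU; apply/cvgrPdist_le => e e0; apply: contrapT => nF.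
pose A := [set k | `|l - a k| <= e].
have PF : ProperFilter (within (~` A) \oo).
  apply: Build_ProperFilter; rewrite /within /= => w; apply: nF.
  by apply: filterS w => k wk; apply: contrapT => nk; exact: (wk nk).
have [U [UU sU]] := ultraFilterLemma PF.
have ooU : \oo `<=` U.
  by move=> B ooB; apply: sU; rewrite /within /=; apply: filterS ooB.
have /cvgrPdist_le/(_ e e0) UA := aU _ UU ooU.
have UnA : U (~` A) by apply: sU; rewrite /within /=; exact: nearW.
by have [k [Ak /(_ Ak)]] := filter_ex (filterI UA UnA).
Qed.

Lemma ultra_oo_extension : exists2 U : set_system nat, UltraFilter U & \oo `<=` U.
Proof. by have [U [UU sU]] := ultraFilterLemma eventually_filter; exists U. Qed.

(** Banach-Alaoglu for sequences: along an ultrafilter all bounded sequences of values converge, and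
    linearity and the norm bound pass to the pointwise limit. *)
Lemma dual_ultralimit (V : normedModType R) (U : set_system nat)
    (f : nat -> topdual V) (C : R) : UltraFilter U -> (forall k, `|f k| <= C) ->
  exists2 g : topdual V, `|g| <= C & forall x, f k x @[k --> U] --> g x.
Proof.
move=> UU fC.
have C0 : 0 <= C by apply: le_trans (fC 0%N); exact: normr_ge0.
have fxC k x : `|f k x| <= C * `|x|.
  by apply: le_trans (topdual_le _ _) _; rewrite ler_wpM2r.
have /choice[g gP] x : exists l : R, f k x @[k --> U] --> l.
  by apply: (@ultra_bounded_cvg U _ (C * `|x|)) => // k.
have uniq (a : nat -> R) (l m : R) : a k @[k --> U] --> l -> a k @[k --> U] --> m -> l = m.
  by move=> al am; apply: (cvg_unique _ al am); exact: Rhausdorff.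
have [||x|F Fg FC] := @topdual_extend _ V g C _ _ C0 _.
- move=> x y; apply: uniq (gP _) _.
  have -> : (fun k => f k (x + y)) = (fun k => f k x + f k y).
    by apply/funext => k; rewrite linearD.
  exact: cvgD.
- move=> t x; apply: uniq (gP _) _.
  have -> : (fun k => f k (t *: x)) = (fun k => t * f k x).
    by apply/funext => k; rewrite linearZ.
  by apply: cvgM => //; exact: cvg_cst.
- have h : `|f k x| @[k --> U] --> `|g x| by apply: cvg_norm; exact: gP.
  rewrite -(cvg_lim (@Rhausdorff R) h).
  by apply: limr_le; [apply/cvg_ex; exists (`|g x|) | exact: nearW].
by exists F => // x; rewrite Fg.
Qed.

End UltraLimits.

Section WeakClosure.
Context (R : realType).

(** By reflexivity a functional separating [g] from the hull is evaluation at a point, and the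
    convergence of the values there contradicts the gap [e]. *)
Lemma mazur (Z : normedModType R) (rZ : reflexive_space Z) (S : set (topdual Z))
    (T : Type) (F : set_system T) (f : T -> topdual Z) (g : topdual Z) (e : R) :
  ProperFilter F -> (forall x, f k x @[k --> F] --> g x) ->
  F [set k | S (f k)] -> 0 < e ->
  exists2 c, convex_hull S c & `|g - c| <= e.
Proof.
move=> PF fg FS e0; apply: contrapT => nc.
have [k0 Sk0] := filter_ex FS.
have [||phi _ phiC] := @convex_separation R _ (convex_hull S) g e
    (@convex_hull_convex _ _ S).
- by exists (f k0); exact: sub_convex_hull.
- move=> c Sc; rewrite leNgt; apply/negP => lt; apply: nc; exists c => //.
  exact: ltW.
have [z _ zphi] := rZ phi I.
have e20 : 0 < e / 2 by rewrite divr_gt0.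
have /cvgrPdist_le/(_ _ e20) near_z := fg z.
have [k [Sk /= lek]] := filter_ex (filterI FS near_z).
have := phiC _ (sub_convex_hull Sk); rewrite -zphi /=.
by move: lek; rewrite ler_norml => /andP[_ ?] ?; lra.
Qed.

End WeakClosure.

(** * Rational combinations and weak sequential compactness *)

Section RationalCombinations.
Context (R : realType) (V : normedModType R) (f : nat -> V).
Implicit Types l : seq rat.

(** Lists of rationals form a countable type, so the combinations can be enumerated by [pickle]; the
    default value [0] of the coefficients permits padding to a common length. *)
Definition rat_comb l : V := \sum_(i < size l) ratr l`_i *: f i.

Lemma rat_comb_widen l n : (size l <= n)%N ->
  rat_comb l = \sum_(i < n) ratr l`_i *: f i.
Proof.
move=> ln; rewrite /rat_comb -(big_mkord xpredT (fun i => ratr l`_i *: f i)).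
rewrite -(big_mkord xpredT (fun i => ratr l`_i *: f i)).
rewrite [RHS](big_cat_nat (n := size l))//=.
rewrite [X in _ = _ + X]big_nat_cond [X in _ = _ + X]big1 ?addr0// => i.
by move=> /andP[/andP[li _] _]; rewrite nth_default// rmorph0 scale0r.
Qed.

Lemma rat_comb_lin (r s : rat) l m :
  exists k, rat_comb k = ratr r *: rat_comb l + ratr s *: rat_comb m.
Proof.
pose n := maxn (size l) (size m).
exists (mkseq (fun i => r * l`_i + s * m`_i) n).
rewrite (@rat_comb_widen l n) ?leq_maxl// (@rat_comb_widen m n) ?leq_maxr//.
rewrite (@rat_comb_widen _ n) ?size_mkseq// !scaler_sumr -big_split /=.
apply: eq_bigr => i _; rewrite nth_mkseq// rmorphD !rmorphM scalerDl.
by rewrite !scalerA.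
Qed.

Lemma rat_comb1 i : exists l, rat_comb l = f i.
Proof.
exists (mkseq (fun j => (j == i)%:R) i.+1).
rewrite (@rat_comb_widen _ i.+1) ?size_mkseq// (bigD1 (@Ordinal i.+1 i (ltnSn i)))//=.
rewrite nth_mkseq// eqxx rmorph1 scale1r big1 ?addr0// => j ji.
rewrite nth_mkseq// (_ : (j == i :> nat) = false) ?rmorph0 ?scale0r//.
by apply/negbTE; move: ji; rewrite -val_eqE.
Qed.

Lemma rat_near (t e : R) : 0 < e -> exists r : rat, `|t - ratr r| <= e.
Proof.
move=> e0; have [r] : exists r : rat, ratr r \in `](t - e), t[.
  by apply: rat_in_itvoo; lra.
by rewrite in_itv /= => /andP[lt gt]; exists r; rewrite ger0_norm; lra.
Qed.

(** The vectors approximable by rational combinations form a convex set containing the range, hence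
    its hull. *)
Lemma hull_rat_comb c (e : R) : convex_hull (range f) c -> 0 < e ->
  exists l, `|c - rat_comb l| <= e.
Proof.
move=> hc; move: e; pose E c := forall e : R, 0 < e -> exists l, `|c - rat_comb l| <= e.
suff : E c by [].
apply: hc; split=> [|_ [i _ <-] e e0]; last first.
  by have [l <-] := rat_comb1 i; exists l; rewrite subrr normr0 ltW.
apply/convex_setP => x y t Ex Ey t0 t1 e e0.
have e20 : 0 < e / 2 by rewrite divr_gt0.
have [l lx] := Ex _ e20; have [m my] := Ey _ e20.
set a := rat_comb l in lx *; set b := rat_comb m in my *.
pose M := `|a| + `|b| + 1.
have M0 : 0 < M by rewrite ltr_wpDl// addr_ge0.
(* Only [t] has to be made rational: replacing it by [r] moves the combination of [a] and [b] by
   [|t - r| * |a - b|], and [M] bounds the second factor. *)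
have [r rt] := @rat_near t (e / 2 / M) (divr_gt0 e20 M0).
have [k kE] := rat_comb_lin r (1 - r) l m; exists k; rewrite kE -/a -/b.
rewrite rmorphB rmorph1.
have -> : t *: x + (1 - t) *: y - (ratr r *: a + (1 - ratr r) *: b) =
    (t *: (x - a) + (1 - t) *: (y - b)) + (t - ratr r) *: (a - b).
  by apply: eq_topdual => phi; rewrite !topdualE; ring.
apply: le_trans (ler_normD _ _) _; rewrite [e]splitr; apply: lerD.
  apply: le_trans (ler_normD _ _) _; rewrite !normrZ (ger0_norm t0) ger0_norm ?subr_ge0//.
  have t1' : 0 <= 1 - t by rewrite subr_ge0.
  have := ler_wpM2l t0 lx; have := ler_wpM2l t1' my; lra.
have abM : `|a - b| <= M by apply: le_trans (ler_normB _ _) _; rewrite lerDl.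
rewrite normrZ; apply: le_trans (ler_pM (normr_ge0 _) (normr_ge0 _) rt abM) _.
by rewrite divfK// gt_eqF.
Qed.

End RationalCombinations.

(** The supremum in the dual norm need not be attained; the factor [2] leaves room for that, and the
    weak inequality covers [f = 0]. *)
Lemma half_norming (R : realType) (V : normedModType R) (f : topdual V) :
  exists2 x : V, `|x| <= 1 & `|f| <= 2 * `|f x|.
Proof.
apply: contrapT => nx; have lt x : `|x| <= 1 -> 2 * `|f x| < `|f|.
  by move=> x1; rewrite ltNge; apply/negP => le; apply: nx; exists x.
have : `|f| <= `|f| / 2.
  apply: topdual_norm_lub => x x1.
  by rewrite ler_pdivlMr// mulrC; apply: ltW; exact: lt.
by have := lt 0; rewrite normr0 linear0 normr0 mulr0 => /(_ ler01); lra.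
Qed.

(* A sequence converging on a countable set that norms the span of its terms
   has at most one weak cluster point. *)
Lemma weakly_convergent_subsequence (R : realType) (Z : normedModType R)
    (f : nat -> topdual Z) (C : R) : reflexive_space Z -> (forall k, `|f k| <= C) ->
  exists (h : nat -> nat) (g : topdual Z),
    (forall k, k <= h k)%N /\ forall x, f (h k) x @[k --> \oo] --> g x.
Proof.
move=> rZ fC; have [U UU ooU] := ultra_oo_extension.
have [g gC fg] := dual_ultralimit UU fC.
have /choice[xl xlP] l : exists x : Z,
    `|x| <= 1 /\ `|rat_comb f l| <= 2 * `|rat_comb f l x|.
  by have [x ? ?] := half_norming (rat_comb f l); exists x.
(* At a finite stage only the test points with code below [n] count, so the good indices belong to
   [U]; the stages are diagonalized afterwards. *)
have Un n (e : R) : 0 < e -> U [set m | forall l, (pickle l < n)%N ->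
    `|g (xl l) - f m (xl l)| <= e].
  move=> e0; elim: n => [|n IH]; first by apply: filterS filterT.
  have [[l ln]|nl] := pselect (exists l : seq rat, pickle l = n).
    have /cvgrPdist_le/(_ _ e0) Ul := fg (xl l).
    apply: filterS (filterI IH Ul) => m /= [IHm le] l'.
    rewrite ltnS leq_eqVlt => /predU1P[l'n|]; last exact: IHm.
    by rewrite (pcan_inj pickleK (etrans l'n (esym ln))).
  apply: filterS IH => m IHm l; rewrite ltnS leq_eqVlt => /predU1P[l'n|].
    by exfalso; apply: nl; exists l.
  exact: IHm.
have /choice[h hP] k : exists m, (k <= m)%N /\ forall l, (pickle l < k)%N ->
    `|g (xl l) - f m (xl l)| <= k.+1%:R^-1.
  have Uk : U [set m | (k <= m)%N] by apply: ooU; exists k.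
  have [|m [? ?]] := filter_ex (filterI Uk (Un k k.+1%:R^-1 _)).
    by rewrite invr_gt0.
  by exists m.
exists h, g; split=> [k|x]; first by case: (hP k).
(* All ultralimits of the diagonal sequence agree with [g] at the test points; it remains to see
   that these values determine the limit. *)
apply: cvg_ultra => W UW ooW.
have [g' g'C fg'] := @dual_ultralimit R Z W (f \o h) C UW (fun k => fC (h k)).
suff -> : g = g' by exact: fg'.
have gg' l : g' (xl l) = g (xl l).
  apply: (@cvg_unique _ (@Rhausdorff R) (f (h k) (xl l) @[k --> W])) => //.
    exact: fg'.
  apply: (@cvg_trans _ (f (h k) (xl l) @[k --> \oo])).
    by move=> A; exact: ooW.
  apply/cvgrPdist_le => e e0; near=> k.
  have [_ le] := hP k; apply: le_trans (le l _) _; first by near: k; exists (pickle l).+1.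
  apply: ltW; near: k; exact: (near_infty_natSinv_lt (PosNum e0)).
have range_g (F : set_system nat) (u : nat -> nat) (v : topdual Z) (e : R) :
    ProperFilter F -> (forall x, f (u k) x @[k --> F] --> v x) -> 0 < e ->
    exists l, `|v - rat_comb f l| <= e.
  move=> PF uv e0; have e20 : 0 < e / 2 by rewrite divr_gt0.
  have [|c hc vc] := @mazur R Z rZ (range f) nat F (f \o u) v (e / 2) PF uv _ e20.
    by apply: filterS filterT => k _; exists (u k).
  have [l cl] := hull_rat_comb hc e20; exists l.
  by rewrite -(subrKA c); apply: le_trans (ler_normD _ _) _; rewrite [e]splitr lerD.
apply/eqP; rewrite -subr_eq0 -normr_le0; apply/ler_addgt0Pl => e e0; rewrite addr0.
(* Two approximations within [e / 6] put [g - g'] within [e / 3] of one combination. At its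
   half-norming point, where [g] and [g'] agree, this combination is at most [e / 3], so its norm is
   at most [2 * e / 3]. *)
have e60 : 0 < e / 6 by rewrite divr_gt0.
have [l gl] := range_g U id g _ _ fg e60.
have [m g'm] := range_g W h g' _ _ fg' e60.
have [k kE] := rat_comb_lin f 1 (- 1) l m.
have le : `|g - g' - rat_comb f k| <= e / 3.
  have -> : g - g' - rat_comb f k =
      (g - rat_comb f l) - (g' - rat_comb f m).
    rewrite kE rmorphN rmorph1; apply: topdualP => z.
    by rewrite !topdual_evalE; ring.
  by apply: le_trans (ler_normB _ _) _; lra.
have [xk1 norming] := xlP k.
have kx : `|rat_comb f k (xl k)| <= e / 3.
  have -> : rat_comb f k (xl k) = - (g - g' - rat_comb f k) (xl k).
    by rewrite !topdual_evalE gg' subrr add0r opprK.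
  rewrite normrN; apply: le_trans (topdual_le _ _) _.
  by apply: le_trans le; rewrite ler_piMr.
have := ler_normD (g - g' - rat_comb f k) (rat_comb f k); rewrite subrK.
lra.
Unshelve. all: by end_near. Qed.

Section ReflexiveProduct.
Context (R : realType) (X Y : normedModType R).

Lemma pair_norm (z : X * Y) : `|z| = Num.max `|z.1| `|z.2|.
Proof. by []. Qed.

Lemma pair_norm_fst (z : X * Y) : `|z.1| <= `|z|.
Proof. by rewrite pair_norm le_max lexx. Qed.

Lemma pair_norm_snd (z : X * Y) : `|z.2| <= `|z|.
Proof. by rewrite pair_norm le_max lexx orbT. Qed.

Lemma pair_topdualE (f : topdual X) (g : topdual Y) z :
  pair_topdual f g z = f z.1 + g z.2.
Proof. by []. Qed.

Lemma pair_topdual_norm (f : topdual X) (g : topdual Y) :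
  `|pair_topdual f g| <= `|f| + `|g|.
Proof.
apply: topdual_lub => [|z]; first exact: addr_ge0.
rewrite mulrDl; apply: lerD; apply: le_trans (ler_norm _) _;
  apply: le_trans (topdual_le _ _) _; rewrite ler_wpM2l//.
- exact: pair_norm_fst.
- exact: pair_norm_snd.
Qed.

Lemma pair_topdualP (F : topdual (X * Y)%type) : exists f g,
  [/\ F = pair_topdual f g, `|f| <= `|F| & `|g| <= `|F| ].
Proof.
have [x y|t x||x|f fE fF] := @topdual_extend R X (fun x => F (x, 0)) `|F|.
- by rewrite -topdualD; congr (F _); rewrite /GRing.add /= /add_pair /= addr0.
- by rewrite -topdualZ; congr (F _); rewrite /GRing.scale /= /scale_pair /= scaler0.
- exact: normr_ge0.
- apply: le_trans (topdual_le _ _) _; rewrite ler_wpM2l// pair_norm /=.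
  by rewrite normr0 ge_max lexx /=.
have [x y|t x||x|g gE gF] := @topdual_extend R Y (fun y => F (0, y)) `|F|.
- by rewrite -topdualD; congr (F _); rewrite /GRing.add /= /add_pair /= addr0.
- by rewrite -topdualZ; congr (F _); rewrite /GRing.scale /= /scale_pair /= scaler0.
- exact: normr_ge0.
- apply: le_trans (topdual_le _ _) _; rewrite ler_wpM2l// pair_norm /=.
  by rewrite normr0 ge_max lexx andbT.
exists f, g; split=> //; apply: topdualP => -[x y] /=; rewrite fE gE -topdualD.
by congr (F _); rewrite /GRing.add /= /add_pair /= addr0 add0r.
Qed.

End ReflexiveProduct.

(** A functional on the dual of the product is the sum of its restrictions to the two dual factors,
    and each restriction is represented by a point. *)
Lemma reflexive_prod (R : realType) (X Y : normedModType R) :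
  reflexive_space X -> reflexive_space Y -> reflexive_space (X * Y)%type.
Proof.
move=> rX rY Phi _.
have [f f'|t f||f|PX PXE _] := @topdual_extend R (topdual X)
    (fun f => Phi (pair_topdual f 0)) `|Phi|.
- rewrite -topdualD; congr (Phi _); apply: topdualP => z.
  by rewrite !(topdual_evalE, pair_topdualE); ring.
- rewrite -topdualZ; congr (Phi _); apply: topdualP => z.
  by rewrite !(topdual_evalE, pair_topdualE); ring.
- exact: normr_ge0.
- apply: le_trans (topdual_le _ _) _; rewrite ler_wpM2l//.
  by apply: le_trans (pair_topdual_norm _ _) _; rewrite normr0 addr0.
have [f f'|t f||f|PY PYE _] := @topdual_extend R (topdual Y)
    (fun f => Phi (pair_topdual 0 f)) `|Phi|.
- rewrite -topdualD; congr (Phi _); apply: topdualP => z.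
  by rewrite !(topdual_evalE, pair_topdualE); ring.
- rewrite -topdualZ; congr (Phi _); apply: topdualP => z.
  by rewrite !(topdual_evalE, pair_topdualE); ring.
- exact: normr_ge0.
- apply: le_trans (topdual_le _ _) _; rewrite ler_wpM2l//.
  by apply: le_trans (pair_topdual_norm _ _) _; rewrite normr0 add0r.
have [x _ xE] := rX PX I; have [y _ yE] := rY PY I.
exists (x, y) => //; apply: topdualP => F /=.
have [f [g [-> _ _]]] := pair_topdualP F.
have -> : pair_topdual f g = pair_topdual f 0 + pair_topdual 0 g.
  by apply: topdualP => z; rewrite !(topdual_evalE, pair_topdualE) addr0 add0r.
by rewrite topdualD -PXE -PYE -xE -yE !(topdual_evalE, pair_topdualE) addr0 add0r.
Qed.

(** * A smooth variational principle *)

(* Conversion tests between norms of functionals are costly: they are turned into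
   variables before calling [lra]. *)
Ltac lra_atoms :=
  repeat match goal with
  | |- context [@Num.norm ?A ?B ?x] => move: (@Num.norm A B x) => ?
  | |- context [topdual_fun ?f ?x] => move: (topdual_fun f x) => ?
  | |- context [@snd ?A ?B ?p] => move: (@snd A B p) => ?
  end;
  repeat match goal with H : is_true _ |- _ => clear H end; intros; lra.

(** * Convex functions as suprema of affine functions *)

Section AffineFamilies.
Context (R : realType) (Z : normedModType R).
Implicit Types (D : set (topdual Z * R)) (p : topdual Z * R) (z w : Z).

Definition affine_eval p z : R := p.1 z + p.2.

(** A convex function is given by affine minorants, each a slope with a constant; the constant plays
    the role of minus the Fenchel conjugate at the slope. Adding a multiple of the norm then means
    adding slopes, and smoothing means lowering constants. *)
Definition affine_sup D z : R := sup [set affine_eval p z | p in D].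

Definition affine_convex D := forall p p' t, D p -> D p' -> 0 <= t -> t <= 1 ->
  D (t *: p.1 + (1 - t) *: p'.1, t * p.2 + (1 - t) * p'.2).

Definition affine_bounded D (K B : R) :=
  D !=set0 /\ forall p, D p -> `|p.1| <= K /\ p.2 <= B.

Section Bounded.
Context (D : set (topdual Z * R)) (K B : R).
Hypothesis bD : affine_bounded D K B.

Lemma affine_sup_ub p z : D p -> affine_eval p z <= affine_sup D z.
Proof.
move=> Dp; apply: ub_le_sup; last by exists p.
exists (K * `|z| + B) => _ [r Dr <-]; apply: lerD; last by case: (bD.2 _ Dr).
apply: le_trans (ler_norm _) _; apply: le_trans (topdual_le _ _) _.
by rewrite ler_wpM2r//; case: (bD.2 _ Dr).
Qed.

Lemma affine_sup_lub z y : (forall p, D p -> affine_eval p z <= y) ->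
  affine_sup D z <= y.
Proof.
move=> h; apply: ge_sup; first by have [p Dp] := bD.1; exists (affine_eval p z), p.
by move=> _ [p Dp <-]; exact: h.
Qed.

Lemma affine_sup_near z e : 0 < e ->
  exists2 p, D p & affine_sup D z <= affine_eval p z + e.
Proof.
move=> e0; apply: contrapT => np.
suff : affine_sup D z <= affine_sup D z - e by lra.
apply: affine_sup_lub => p Dp; rewrite leNgt; apply/negP => lt.
by apply: np; exists p => //; lra.
Qed.

Lemma affine_eval_lip p z w : D p ->
  affine_eval p z <= affine_eval p w + K * `|z - w|.
Proof.
move=> Dp; rewrite /affine_eval -[X in p.1 X](subrK w) topdualD.
have := topdual_le p.1 (z - w); have := ler_norm (p.1 (z - w)).
have [pK _] := bD.2 _ Dp; have := ler_wpM2r (normr_ge0 (z - w)) pK; lra.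
Qed.

Lemma affine_sup_lip z w :
  affine_sup D z <= affine_sup D w + K * `|z - w|.
Proof.
apply: affine_sup_lub => p Dp; apply: le_trans (affine_eval_lip z w Dp) _.
by rewrite lerD2r affine_sup_ub.
Qed.

End Bounded.

Section Refine.
Context (D : set (topdual Z * R)) (K B : R).
Hypotheses (bD : affine_bounded D K B) (cD : affine_convex D).
Context (a k t : R) (w : Z) (q : topdual Z).
(** The number [t] bounds the whole penalty, since refined slopes have norm at most [K + a]. *)
Hypothesis akt : [/\ 0 <= a, 0 <= k & k * (K + a + `|q|) ^+ 2 <= t].

Lemma refine_a0 : 0 <= a. Proof. by case: akt. Qed.
Lemma refine_k0 : 0 <= k. Proof. by case: akt. Qed.
Lemma refine_kt : k * (K + a + `|q|) ^+ 2 <= t. Proof. by case: akt. Qed.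
Local Notation k0 := refine_k0.
Local Notation kt := refine_kt.
Local Hint Resolve refine_a0 refine_k0 : core.

(* Adds the localizing term [a * `|z - w|] to the supremum and penalizes slopes
   far from [q]; the penalty smooths the supremum without raising it. *)
Definition refine : set (topdual Z * R) := [set r | exists p g,
  [/\ D p, `|g| <= 1, r.1 = p.1 + a *: g &
      r.2 <= p.2 - a * g w - k * `|r.1 - q| ^+ 2]].

Lemma refine_norm r : refine r -> `|r.1| <= K + a.
Proof.
move=> [p [g [Dp g1 -> _]]]; apply: le_trans (ler_normD _ _) _.
apply: lerD; first by case: (bD.2 _ Dp).
by rewrite normrZ ger0_norm// ler_piMr.
Qed.

Let penalty (f : topdual Z) : `|f| <= K + a -> 0 <= k * `|f - q| ^+ 2 <= t.
Proof.
move=> fK; rewrite mulr_ge0 ?exprn_ge0//=; apply: le_trans kt.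
rewrite ler_wpM2l// lerXn2r ?nnegrE//; last first.
  by apply: le_trans (ler_normB _ _) _; rewrite lerD2r.
by rewrite addr_ge0// (le_trans _ fK).
Qed.

Lemma refine_bounded : affine_bounded refine (K + a) (B + a * `|w|).
Proof.
split.
  have [p Dp] := bD.1; exists (p.1, p.2 - k * `|p.1 - q| ^+ 2), p, 0.
  by rewrite /= normr0 scaler0 addr0 ?topdual_zeroE mulr0 subr0; split.
move=> r Dr; split; first exact: refine_norm.
move: Dr => [p [g [Dp g1 r1 r2]]]; apply: le_trans r2 _.
have [_ pB] := bD.2 _ Dp.
have gw : - (a * g w) <= a * `|w|.
  rewrite -mulrN ler_wpM2l//; apply: le_trans (ler_norm _) _; rewrite normrN.
  by apply: le_trans (topdual_le _ _) _; rewrite ler_piMl.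
have : 0 <= k * `|r.1 - q| ^+ 2 by rewrite mulr_ge0// exprn_ge0.
lra.
Qed.

Let ler_sq_conv (x y s : R) : 0 <= s -> s <= 1 ->
  (s * x + (1 - s) * y) ^+ 2 <= s * x ^+ 2 + (1 - s) * y ^+ 2.
Proof.
move=> s0 s1; have : 0 <= s * (1 - s) * (x - y) ^+ 2.
  by rewrite mulr_ge0 ?sqr_ge0// mulr_ge0// subr_ge0.
by rewrite !expr2; lra.
Qed.

Lemma refine_convex : affine_convex refine.
Proof.
move=> r r' s [p [g [Dp g1 r1 r2]]] [p' [g' [Dp' g1' r1' r2']]] s0 s1.
have s1' : 0 <= 1 - s by rewrite subr_ge0.
exists (s *: p.1 + (1 - s) *: p'.1, s * p.2 + (1 - s) * p'.2), (s *: g + (1 - s) *: g').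
split; cbn [fst snd].
- exact: cD.
- apply: le_trans (ler_normD _ _) _; rewrite !normrZ !ger0_norm//.
  move: (ler_wpM2l s0 g1) (ler_wpM2l s1' g1'); lra_atoms.
- by rewrite r1 r1'; apply: topdualP => z; rewrite !topdual_evalE; ring.
have -> : s *: r.1 + (1 - s) *: r'.1 - q = s *: (r.1 - q) + (1 - s) *: (r'.1 - q).
  by apply: topdualP => z; rewrite !topdual_evalE; ring.
have : `|s *: (r.1 - q) + (1 - s) *: (r'.1 - q)| ^+ 2 <=
    s * `|r.1 - q| ^+ 2 + (1 - s) * `|r'.1 - q| ^+ 2.
  apply: le_trans (ler_sq_conv _ _ s0 s1).
  rewrite lerXn2r ?nnegrE ?addr_ge0 ?mulr_ge0//.
  by apply: le_trans (ler_normD _ _) _; rewrite !normrZ !ger0_norm.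
move=> /(ler_wpM2l k0); move: (ler_wpM2l s0 r2) (ler_wpM2l s1' r2').
rewrite !topdual_evalE; lra_atoms.
Qed.

Lemma affine_sup_refine_le z : affine_sup refine z <= affine_sup D z + a * `|z - w|.
Proof.
apply: (affine_sup_lub refine_bounded) => r [p [g [Dp g1 r1 r2]]].
have := affine_sup_ub bD z Dp; rewrite /affine_eval r1 !topdual_evalE.
have : 0 <= k * `|r.1 - q| ^+ 2 by rewrite mulr_ge0// exprn_ge0.
have : a * (g z - g w) <= a * `|z - w|.
  rewrite ler_wpM2l// -topdualN -topdualD; apply: le_trans (ler_norm _) _.
  by apply: le_trans (topdual_le _ _) _; rewrite ler_piMl.
by move: r2; lra_atoms.
Qed.

Lemma affine_sup_refine_ge z :
  affine_sup D z + a * `|z - w| <= affine_sup refine z + t.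
Proof.
have [g g1 gE] := norming_functional (z - w).
suff : affine_sup D z <= affine_sup refine z + t - a * `|z - w| by lra.
apply: (affine_sup_lub bD) => p Dp.
have Dr : refine (p.1 + a *: g, p.2 - a * g w - k * `|p.1 + a *: g - q| ^+ 2).
  by exists p, g.
have := affine_sup_ub refine_bounded z Dr; rewrite /affine_eval; cbn [fst snd].
rewrite !topdual_evalE.
have /andP[_] := penalty (refine_norm Dr); rewrite -gE topdualD topdualN; cbn [fst snd]; lra_atoms.
Qed.

Lemma refine_pad p : D p -> exists b, p.2 - t <= b /\ refine (p.1, b).
Proof.
move=> Dp; exists (p.2 - k * `|p.1 - q| ^+ 2); split.
  have [|_] := andP (@penalty p.1 _); last by lra.
  by have [pK _] := bD.2 _ Dp; apply: le_trans pK _; rewrite lerDl.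
by exists p, 0; rewrite normr0 scaler0 addr0 ?topdual_zeroE mulr0 subr0; split.
Qed.

(** The localizing slope [g] is kept and only the [D]-component exchanged, so that nothing but a
    penalty, at most [t], is lost. *)
Lemma refine_replace p r g h b : D p -> `|g| <= 1 -> r.1 = p.1 + a *: g ->
  r.2 <= p.2 - a * g w - k * `|r.1 - q| ^+ 2 -> D (p.1 + h, b) ->
  exists b', refine (r.1 + h, b') /\ b + (r.2 - p.2) - t <= b'.
Proof.
move=> Dp g1 r1 r2 Dh.
have Dr : refine (r.1 + h, b - a * g w - k * `|r.1 + h - q| ^+ 2).
  exists (p.1 + h, b), g; split; [exact: Dh|exact: g1| |exact: lexx].
  by rewrite r1 addrAC.
exists (b - a * g w - k * `|r.1 + h - q| ^+ 2); split; first exact: Dr.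
have /andP[_] := penalty (refine_norm Dr); cbn [fst snd].
have : 0 <= k * `|r.1 - q| ^+ 2 by rewrite mulr_ge0// exprn_ge0.
by move: r2; lra_atoms.
Qed.

(** The penalty is the square of the distance to [q]: at the midpoint it is below the average by at
    least [k / 4] times the squared difference of the two distances. The term [b - (p.2 + p'.2) / 2]
    carries along a gain already made in [D]. *)
Lemma refine_midpoint r r' p p' g g' b :
  D p -> `|g| <= 1 -> r.1 = p.1 + a *: g ->
  r.2 <= p.2 - a * g w - k * `|r.1 - q| ^+ 2 ->
  D p' -> `|g'| <= 1 -> r'.1 = p'.1 + a *: g' ->
  r'.2 <= p'.2 - a * g' w - k * `|r'.1 - q| ^+ 2 ->
  D (2^-1 *: p.1 + 2^-1 *: p'.1, b) ->
  exists b', refine (2^-1 *: r.1 + 2^-1 *: r'.1, b') /\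
    b - (p.2 + p'.2) / 2 + (r.2 + r'.2) / 2
      + k / 4 * (`|r.1 - q| - `|r'.1 - q|) ^+ 2 <= b'.
Proof.
move=> Dp g1 r1 r2 Dp' g1' r1' r2' Db.
set h := 2^-1 *: r.1 + 2^-1 *: r'.1.
exists (b - a * (2^-1 *: g + 2^-1 *: g') w - k * `|h - q| ^+ 2); split.
  exists (2^-1 *: p.1 + 2^-1 *: p'.1, b), (2^-1 *: g + 2^-1 *: g').
  split; [exact: Db| | |exact: lexx].
    apply: le_trans (ler_normD _ _) _; rewrite !normrZ ger0_norm ?invr_ge0//.
    by move: g1 g1'; lra_atoms.
  by rewrite /h r1 r1'; apply: topdualP => z; rewrite !topdual_evalE; ring.
have hq : `|h - q| <= 2^-1 * (`|r.1 - q| + `|r'.1 - q|).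
  have -> : h - q = 2^-1 *: (r.1 - q) + 2^-1 *: (r'.1 - q).
    by rewrite /h; apply: topdualP => z; rewrite !topdual_evalE; field.
  by apply: le_trans (ler_normD _ _) _; rewrite !normrZ ger0_norm ?invr_ge0//;
    lra_atoms.
have hq2 : `|h - q| ^+ 2 <= (2^-1 * (`|r.1 - q| + `|r'.1 - q|)) ^+ 2.
  by rewrite lerXn2r ?nnegrE ?mulr_ge0 ?invr_ge0 ?addr_ge0.
have := ler_wpM2l k0 hq2; rewrite !topdual_evalE.
move: (`|h - q|) (`|r.1 - q|) (`|r'.1 - q|) (g w) (g' w) r2 r2' => c x y s s'.
have -> : k * (2^-1 * (x + y)) ^+ 2 =
  k * x ^+ 2 / 2 + k * y ^+ 2 / 2 - k / 4 * (x - y) ^+ 2 by field.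
have -> : a * (2^-1 * s + 2^-1 * s') = a * s / 2 + a * s' / 2 by field.
move: (k * x ^+ 2) (k * y ^+ 2) (k / 4 * _) (a * s) (a * s') (k * _).
lra_atoms.
Qed.

End Refine.
End AffineFamilies.

Section HalfPowers.
Context (R : realType).

Definition half_pow (n : nat) : R := 2^-1 ^+ n.

Lemma onem_half : 1 - 2^-1 = 2^-1 :> R. Proof. lra. Qed.

Lemma half_pow_gt0 n : 0 < half_pow n.
Proof. by rewrite exprn_gt0// invr_gt0. Qed.

Lemma half_powS n : half_pow n.+1 = half_pow n / 2.
Proof. by rewrite /half_pow exprS mulrC. Qed.

Lemma half_pow_le1 n : half_pow n <= 1.
Proof. by rewrite exprn_ile1// ?invr_ge0// invf_le1// ler1n. Qed.

Lemma half_pow_small (C x : R) : 0 < x ->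
  exists M, forall m, (M <= m)%N -> C * half_pow m <= x.
Proof.
move=> x0; have [C0|C0] := leP C 0.
  exists 0%N => m _; apply: le_trans (ltW x0).
  by rewrite mulr_le0_ge0// ltW// half_pow_gt0.
have h : half_pow n @[n --> \oo] --> (0 : R).
  by apply: cvg_expr; rewrite ger0_norm ?invr_ge0// invf_lt1// ltr1n.
have /cvgrPdist_le/(_ (x / C)) [|M _ HM] := h; first exact: divr_gt0.
exists M => m Mm; have := HM m Mm; rewrite /= sub0r normrN gtr0_norm ?half_pow_gt0//.
by rewrite ler_pdivlMr// mulrC.
Qed.

End HalfPowers.

(** The counter [k] makes every [x] recur at arbitrarily late codes. *)
Lemma pickle_unbounded (T : countType) (x : T) (N : nat) :
  exists k : nat, (N <= pickle (x, k))%N.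
Proof.
apply: contrapT => nk.
have lt (k : nat) : (pickle (x, k) < N)%N.
  by rewrite ltnNge; apply/negP => le; apply: nk; exists k.
have := @uniq_leq_size _ (map (fun k : nat => pickle (x, k)) (iota 0 N.+1)) (iota 0 N).
have inj : injective (fun k : nat => pickle (x, k)).
  by move=> i j /(pcan_inj pickleK) [].
rewrite (map_inj_uniq inj) iota_uniq.
rewrite size_map !size_iota ltnn => /(_ isT) H.
suff : false by []; apply: H => _ /mapP[k _ ->].
by rewrite mem_iota add0n lt.
Qed.

(** * Iterated perturbation of a convex function *)

Section Tower.
Context (R : realType) (Z : normedModType R) (Omega : set Z).
Context (D0 : set (topdual Z * R)) (K B0 A : R).
Hypotheses (bD0 : affine_bounded D0 K B0) (cD0 : affine_convex D0) (A0 : 0 < A).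

Local Notation u := (@half_pow R).

Let K0 : 0 <= K.
Proof. by have [[p /bD0.2 [pK _]] _] := bD0; apply: le_trans pK. Qed.

(** The slope bound adds up the localizing terms: the sum of [A * u i] over [i < n] is
    [2 * A * (1 - u n)]. *)
Definition tower_level (n : nat) (D : set (topdual Z * R)) :=
  [/\ exists B, affine_bounded D (K + 2 * A * (1 - u n)) B, affine_convex D &
      exists m, forall z, Omega z -> m <= affine_sup D z].

Lemma tower_next n D w q k : tower_level n D -> 0 <= k ->
  k * (K + 2 * A + `|q|) ^+ 2 <= A ^+ 2 * u n ^+ 2 ->
  [/\ 0 <= A * u n, 0 <= k &
    k * (K + 2 * A * (1 - u n) + A * u n + `|q|) ^+ 2 <= A ^+ 2 * u n ^+ 2] /\
  tower_level n.+1 (refine D (A * u n) k w q).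
Proof.
move=> [[B bD] cD [m mD]] k0 kt.
have u0 := half_pow_gt0 R n; have Au0 : 0 <= A * u n by rewrite mulr_ge0// ltW.
have u1 := half_pow_le1 R n.
have akt : [/\ 0 <= A * u n, 0 <= k &
    k * (K + 2 * A * (1 - u n) + A * u n + `|q|) ^+ 2 <= A ^+ 2 * u n ^+ 2].
  split=> //; apply: le_trans kt; rewrite ler_wpM2l// lerXn2r ?nnegrE//.
  - by rewrite !addr_ge0// mulr_ge0 ?subr_ge0// mulr_ge0// ltW.
  - by rewrite !addr_ge0// mulr_ge0// ltW.
  - by rewrite lerD2r mulrBr mulr1 -mulrA; move: Au0; move: (A * u n); lra_atoms.
split=> //; split; last first.
- exists (m - A ^+ 2 * u n ^+ 2) => z Oz.
  move: (affine_sup_refine_ge bD w akt z) (mD _ Oz).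
  have : 0 <= A * u n * `|z - w| by rewrite mulr_ge0.
  by move: (A * u n * _) (A ^+ 2 * _) (affine_sup _ _) (affine_sup _ _); lra_atoms.
- exact: (refine_convex cD akt).
- exists (B + A * u n * `|w|); have := refine_bounded bD w akt.
  by rewrite half_powS; congr (affine_bounded _ _ _); field.
Qed.

Hypotheses (OmegaN0 : Omega !=set0).
Hypothesis lbD0 : exists m, forall z, Omega z -> m <= affine_sup D0 z.

Lemma tower_select n D : tower_level n D -> exists w p,
  [/\ Omega w, D p,
      forall z, Omega z -> affine_sup D w <= affine_sup D z + A ^+ 2 * u n ^+ 2 &
      affine_sup D w <= affine_eval p w + A ^+ 2 * u n ^+ 2].
Proof.
move=> [[B bD] cD [m mD]].
have e0 : 0 < A ^+ 2 * u n ^+ 2 by rewrite mulr_gt0// exprn_gt0// half_pow_gt0.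
have lb : has_inf [set affine_sup D z | z in Omega].
  split; first by have [z Oz] := OmegaN0; exists (affine_sup D z), z.
  by exists m => _ [z Oz <-]; exact: mD.
have [_ [w Ow <-] lt] := inf_adherent e0 lb.
have [p Dp pw] := affine_sup_near bD w e0.
exists w, p; split=> // z Oz; apply: le_trans (ltW lt) _; rewrite lerD2r.
by apply: ge_inf; [case: lb|exists z].
Qed.

(** The clause on [k] keeps each penalty within the tolerance of the minimization, so that all
    errors are summable. The last clause lets a centre come close to the limit slope at an
    arbitrarily late stage, when little localization is still to be added. *)
Definition tower (D : nat -> set (topdual Z * R)) (w : nat -> Z)
    (p : nat -> topdual Z * R) (q : nat -> topdual Z) (k : nat -> R) :=
  [/\ D 0%N = D0 /\
      forall n, D n.+1 = refine (D n) (A * u n) (k n) (w n) (q n),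
      forall n, tower_level n (D n),
      forall n, [/\ Omega (w n), D n (p n), forall z, Omega z ->
          affine_sup (D n) (w n) <= affine_sup (D n) z + A ^+ 2 * u n ^+ 2 &
          affine_sup (D n) (w n) <= affine_eval (p n) (w n) + A ^+ 2 * u n ^+ 2],
      forall n, 0 < k n /\ k n * (K + 2 * A + `|q n|) ^+ 2 <= A ^+ 2 * u n ^+ 2 &
      forall l N, exists2 n, (N <= n)%N & q n = rat_comb (fun i => (p i).1) l].

Lemma tower_exists : exists D w p q k, tower D w p q k.
Proof.
have /choice[sel selP] : forall nD : nat * set (topdual Z * R),
    exists wp : Z * (topdual Z * R), tower_level nD.1 nD.2 ->
  [/\ Omega wp.1, nD.2 wp.2,
      forall z, Omega z ->
        affine_sup nD.2 wp.1 <= affine_sup nD.2 z + A ^+ 2 * u nD.1 ^+ 2 &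
      affine_sup nD.2 wp.1 <= affine_eval wp.2 wp.1 + A ^+ 2 * u nD.1 ^+ 2].
  move=> [n D]; have [lD|nlD] := pselect (tower_level n D).
    by have [w [p ?]] := tower_select lD; exists (w, p).
  by exists (0, (0, 0)) => /nlD.
(* A code is read as a list of coefficients with a counter, the latter serving only to produce
   repetitions. *)
pose comb n (s : seq (topdual Z)) : topdual Z :=
  if unpickle n is Some c then
    \sum_(i < size (c : seq rat * nat).1) ratr c.1`_i *: s`_i else 0.
pose kap n (q : topdual Z) := A ^+ 2 * u n ^+ 2 / (K + 2 * A + `|q|) ^+ 2.
pose st := fix st n := if n is m.+1 then
    let Ds := st m in let wp := sel (m, Ds.1) in
    let s := rcons Ds.2 wp.2.1 in let q := comb m s in
    (refine Ds.1 (A * u m) (kap m q) wp.1 q, s)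
  else (D0, [::]).
pose D n := (st n).1; pose w n := (sel (n, D n)).1; pose p n := (sel (n, D n)).2.
pose q n := comb n (rcons (st n).2 (p n).1).
have stS n : (st n).2 = mkseq (fun i => (p i).1) n.
  by elim: n => // n IH; rewrite /= IH mkseqS.
have pos n : 0 < K + 2 * A + `|q n|.
  by rewrite ltr_pwDl// ltr_wpDl// mulr_gt0.
have kP n : 0 < kap n (q n) /\
    kap n (q n) * (K + 2 * A + `|q n|) ^+ 2 <= A ^+ 2 * u n ^+ 2.
  split; last by rewrite divfK// gt_eqF// exprn_gt0.
  by rewrite divr_gt0 ?mulr_gt0 ?exprn_gt0// half_pow_gt0.
have lev n : tower_level n (D n).
  elim: n => [|n IH].
    split=> //; exists B0; rewrite /half_pow expr0 subrr mulr0 addr0; exact: bD0.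
  have [k0 kt] := kP n.
  by have [] := tower_next (w n) IH (ltW k0) kt.
exists D, w, p, q, (fun n => kap n (q n)); split=> //.
- by move=> n; exact: (selP (n, D n) (lev n)).
(* A code of at least [size l] guarantees that all slopes in the combination are already recorded
   when it is formed. *)
- move=> l N; have [k Nk] := pickle_unbounded l (maxn N (size l)).
  exists (pickle (l, k)); first by apply: leq_trans Nk; exact: leq_maxl.
  rewrite /q /comb pickleK stS -mkseqS /rat_comb; apply: eq_bigr => i _.
  rewrite nth_mkseq// ltnS; apply: leq_trans (ltnW (ltn_ord i)) _.
  by apply: leq_trans Nk; exact: leq_maxr.
Qed.

End Tower.

Section TowerEstimates.
Context (R : realType) (Z : normedModType R) (Omega : set Z).
Context (D0 : set (topdual Z * R)) (K B0 A : R).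
Hypotheses (bD0 : affine_bounded D0 K B0) (KA : 0 <= K /\ 0 < A).
Context (D : nat -> set (topdual Z * R)) (w : nat -> Z)
  (p : nat -> topdual Z * R) (q : nat -> topdual Z) (k : nat -> R).
Hypothesis tD : tower Omega D0 K A D w p q k.

Local Notation u := (@half_pow R).
Local Notation S n := (affine_sup (D n)).

Lemma tower_step n :
  [/\ 0 <= A * u n, 0 <= k n &
    k n * (K + 2 * A * (1 - u n) + A * u n + `|q n|) ^+ 2 <= A ^+ 2 * u n ^+ 2].
Proof.
have [K0 A0] := KA; have [_ lev _ /(_ n)[k0 kq] _] := tD.
by have [] := tower_next bD0 A0 (w n) (lev n) (ltW k0) kq.
Qed.

Lemma tower_refine n : D n.+1 = refine (D n) (A * u n) (k n) (w n) (q n).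
Proof. by have [[_ ->]] := tD. Qed.

Lemma tower_bounded_ex n : exists B, affine_bounded (D n) (K + 2 * A * (1 - u n)) B.
Proof. by have [_ /(_ n)[]] := tD. Qed.

Lemma tower_bounded n : exists B, affine_bounded (D n) (K + 2 * A) B.
Proof.
have [B [D0n bD]] := tower_bounded_ex n; exists B; split=> // r /bD[rK rB].
split=> //; apply: le_trans rK _; rewrite lerD2l mulrBr mulr1 gerBl.
by rewrite mulr_ge0 ?(ltW (half_pow_gt0 _ _))// mulr_ge0// ltW//; case: KA.
Qed.

Lemma tower_norm n r : D n r -> `|r.1| <= K + 2 * A.
Proof. by move=> Dr; have [B [_ /(_ _ Dr)[]]] := tower_bounded n. Qed.

Lemma tower_sup_ub n r z : D n r -> affine_eval r z <= S n z.
Proof. by have [B bD] := tower_bounded n; exact: (affine_sup_ub bD). Qed.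

Lemma tower_eval_lip n r z z' : D n r ->
  affine_eval r z <= affine_eval r z' + (K + 2 * A) * `|z - z'|.
Proof. by have [B bD] := tower_bounded n; exact: (affine_eval_lip bD). Qed.

Lemma tower_sup_near n z e : 0 < e ->
  exists2 r, D n r & S n z <= affine_eval r z + e.
Proof. by have [B bD] := tower_bounded n; exact: (affine_sup_near bD). Qed.

Lemma tower_sup_le n z : S n.+1 z <= S n z + A * u n * `|z - w n|.
Proof.
rewrite tower_refine; have [B bD] := tower_bounded_ex n.
exact: (affine_sup_refine_le bD (w n) (tower_step n)).
Qed.

Lemma tower_sup_ge n z :
  S n z + A * u n * `|z - w n| <= S n.+1 z + A ^+ 2 * u n ^+ 2.
Proof.
rewrite tower_refine; have [B bD] := tower_bounded_ex n.
exact: (affine_sup_refine_ge bD (w n) (tower_step n)).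
Qed.

Lemma tower_minimal n z : Omega z -> S n (w n) <= S n z + A ^+ 2 * u n ^+ 2.
Proof. by have [_ _ /(_ n)[_ _ h _] _ _] := tD; exact: (h z). Qed.

Lemma tower_mem n : Omega (w n).
Proof. by have [_ _ /(_ n)[]] := tD. Qed.

Lemma tower_active n : D n (p n) /\
  S n (w n) <= affine_eval (p n) (w n) + A ^+ 2 * u n ^+ 2.
Proof. by have [_ _ /(_ n)[]] := tD. Qed.

(** Minimality at stage [n.+1] is tested at [w n], where the new localizing term vanishes. *)
Lemma tower_sup_dec n : S n.+1 (w n.+1) <= S n (w n) + A ^+ 2 * u n ^+ 2 / 4.
Proof.
have := tower_minimal n.+1 (tower_mem n); have := tower_sup_le n (w n).
rewrite subrr normr0 mulr0 half_powS.
have -> : A ^+ 2 * (u n / 2) ^+ 2 = A ^+ 2 * u n ^+ 2 / 4 by field.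
by move: (A ^+ 2 * _) (S n.+1 _) (S n _) (S n.+1 _); lra_atoms.
Qed.

(** Bounds [u n ^+ 2] by [u n = 2 * (u n - u n.+1)], so that errors over several stages
    telescope. *)
Lemma sq_le_telescope n : A ^+ 2 * u n ^+ 2 <= 2 * A ^+ 2 * (u n - u n.+1).
Proof.
have -> : 2 * A ^+ 2 * (u n - u n.+1) = A ^+ 2 * u n by rewrite half_powS; field.
rewrite ler_wpM2l ?exprn_ge0 ?(ltW KA.2)// expr2 ler_piMr ?half_pow_le1//.
exact/ltW/half_pow_gt0.
Qed.

(** The localizing term is paid for by the penalty, the increase allowed by [tower_sup_dec] and the
    tolerance: [1 + 1 / 4 + 1] units of [A ^+ 2 * u n ^+ 2], rounded up to [3]. *)
Lemma tower_dist_step n : `|w n.+1 - w n| <= 3 * A * u n.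
Proof.
have [_ A0] := KA; have u0 := half_pow_gt0 R n.
have Au0 : 0 < A * u n by rewrite mulr_gt0.
rewrite -(ler_pM2l Au0).
have -> : A * u n * (3 * A * u n) = 3 * (A ^+ 2 * u n ^+ 2) by ring.
have := tower_minimal n (tower_mem n.+1).
have := tower_sup_ge n (w n.+1); have := tower_sup_dec n.
have : 0 <= A ^+ 2 * u n ^+ 2 by rewrite mulr_ge0 ?exprn_ge0// ltW.
by move: (A ^+ 2 * _) (S n.+1 _) (S n _) (S n _) (A * u n * _); lra_atoms.
Qed.

Lemma tower_dist n m : (n <= m)%N -> `|w m - w n| <= 6 * A * u n.
Proof.
have [_ A0] := KA; move=> /subnKC <-; move: (m - n)%N => i.
have um := half_pow_gt0 R (n + i).
suff : `|w (n + i)%N - w n| <= 6 * A * (u n - u (n + i)).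
  move=> /le_trans; apply; rewrite ler_wpM2l ?mulr_ge0 ?(ltW A0)//.
  by rewrite gerBl; exact: ltW.
elim: i {um} => [|i IH]; first by rewrite addn0 !subrr normr0 mulr0.
rewrite addnS half_powS -(subrKA (w (n + i)%N)).
apply: le_trans (ler_normD _ _) _; move: (tower_dist_step (n + i)) IH.
move: (`|w (n + i)%N - w n|) (`|w (n + i).+1 - _|) (u n) (u (n + i)) => a b c d.
by rewrite !mulrBr mulrA; move: (A * c) (A * d); lra_atoms.
Qed.

Lemma tower_sup_anti n m : (n <= m)%N ->
  S m (w m) <= S n (w n) + 2 * A ^+ 2 * (u n - u m).
Proof.
have [_ A0] := KA; move=> /subnKC <-; move: (m - n)%N => i.
elim: i => [|i IH]; first by rewrite addn0 subrr mulr0 addr0.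
rewrite addnS; have := tower_sup_dec (n + i); have := sq_le_telescope (n + i).
have : 0 <= A ^+ 2 * u (n + i) ^+ 2 by rewrite mulr_ge0 ?exprn_ge0// ltW// half_pow_gt0.
move: IH; rewrite !mulrBr.
by move: (A ^+ 2 * u (n + i) ^+ 2) (2 * A ^+ 2 * _) (2 * A ^+ 2 * _)
  (2 * A ^+ 2 * _) (S n _) (S (n + i) _) (S (n + i).+1 _); lra_atoms.
Qed.

Lemma tower_pad n m r : (n <= m)%N -> D n r ->
  exists b, r.2 - 2 * A ^+ 2 * (u n - u m) <= b /\ D m (r.1, b).
Proof.
have [_ A0] := KA; move=> /subnKC <- Dr; move: (m - n)%N => i.
elim: i => [|i [b [rb Db]]].
  by exists r.2; rewrite addn0 subrr mulr0 subr0 -surjective_pairing.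
have [B bD] := tower_bounded_ex (n + i).
have [b' [bb' Db']] := refine_pad bD (w (n + i)%N) (tower_step (n + i)) Db.
exists b'; rewrite addnS tower_refine; split=> //.
move: bb' (sq_le_telescope (n + i)) rb; cbn [snd]; rewrite !mulrBr.
by move: (A ^+ 2 * u (n + i) ^+ 2) (2 * A ^+ 2 * _) (2 * A ^+ 2 * _)
  (2 * A ^+ 2 * _); lra_atoms.
Qed.

(* Replacing the [D 0]-component of an element of [D m] costs at most the total
   penalty, so this component is almost active where the element is. *)
Lemma tower_ancestor m r : D m r -> exists2 r0, D0 r0 &
  `|r.1 - r0.1| <= 2 * A * (1 - u m) /\ forall s0, D0 s0 -> exists b,
    D m (r.1 - r0.1 + s0.1, b) /\
    r.2 - r0.2 + s0.2 - 2 * A ^+ 2 * (1 - u m) <= b.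
Proof.
have [_ A0] := KA; have [[DE _] _ _ _ _] := tD.
elim: m r => [|m IH] r.
  rewrite DE => Dr; exists r => //; rewrite /half_pow expr0 !subrr normr0 !mulr0.
  by split=> // s0 Ds0; exists s0.2; rewrite !add0r !subr0 -surjective_pairing.
rewrite tower_refine => -[r' [g [Dr' g1 r1 r2]]].
have [r0 Dr0 [rr0 rep]] := IH _ Dr'; exists r0 => //; split.
  have -> : r.1 - r0.1 = r'.1 - r0.1 + (A * u m) *: g by rewrite r1 addrAC.
  apply: le_trans (ler_normD _ _) _; rewrite normrZ.
  have Au : 0 <= A * u m by rewrite mulr_ge0// ltW// half_pow_gt0.
  have := ler_wpM2l Au g1; rewrite half_powS (ger0_norm Au) mulr1.
  have -> : 2 * A * (1 - u m / 2) = 2 * A * (1 - u m) + A * u m by field.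
  by move=> h; apply: lerD.
move=> s0 Ds0; have [b [Db rb]] := rep _ Ds0.
have [B bD] := tower_bounded_ex m.
have [|b' [Db' bb']] := @refine_replace _ _ _ _ _ bD _ _ _ _ _ (tower_step m)
  r' r g (s0.1 - r0.1) b Dr' g1 r1 r2.
  by have -> : r'.1 + (s0.1 - r0.1) = r'.1 - r0.1 + s0.1 by rewrite addrCA addrC.
exists b'; have -> : r.1 - r0.1 + s0.1 = r.1 + (s0.1 - r0.1) by rewrite -addrA [- _ + _]addrC.
split=> //; move: rb bb' (sq_le_telescope m); rewrite !mulrBr.
by move: (A ^+ 2 * u m ^+ 2) (2 * A ^+ 2 * _) (2 * A ^+ 2 * _)
  (2 * A ^+ 2 * _); lra_atoms.
Qed.

(** Each stage [m] after [n] changes both slopes by at most [A * u m], hence the difference of their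
    distances to [q n] by at most [2 * A * u m = 4 * A * (u m - u m.+1)]; the margin in the
    hypothesis absorbs this. The gain made at stage [n] survives since [refine_midpoint] passes it
    on. *)
Lemma tower_gap n i r r' (d : R) : 0 <= d -> D (n.+1 + i)%N r -> D (n.+1 + i)%N r' ->
  `|r.1 - q n| + 4 * A * (u n.+1 - u (n.+1 + i)) + d <= `|r'.1 - q n| ->
  exists b, D (n.+1 + i)%N (2^-1 *: r.1 + 2^-1 *: r'.1, b) /\
    (r.2 + r'.2) / 2 + k n / 4 * d ^+ 2 <= b.
Proof.
have [_ A0] := KA; move=> d0; have [_ lev _ kP _] := tD.
elim: i r r' => [|i IH] r r'.
  rewrite addn0 tower_refine => -[s [g [Ds g1 r1 r2]]] [s' [g' [Ds' g1' r1' r2']]].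
  rewrite subrr mulr0 addr0 => le.
  have Dm : D n (2^-1 *: s.1 + 2^-1 *: s'.1, (s.2 + s'.2) / 2).
    have [_ cD _] := lev n; have := cD _ _ 2^-1 Ds Ds'; rewrite onem_half.
    by rewrite [(_ + _) / 2]mulrC mulrDr; apply; rewrite ?invr_ge0// invf_le1// ler1n.
  have [b [Db bE]] := refine_midpoint (tower_step n) Ds g1 r1 r2 Ds' g1' r1' r2' Dm.
  exists b; split=> //; apply: le_trans bE; rewrite subrr add0r lerD2l.
  rewrite ler_wpM2l//; first by rewrite divr_ge0// ltW//; case: (kP n).
  rewrite -[leRHS]sqrrN opprB; have dle : d <= `|r'.1 - q n| - `|r.1 - q n|.
    by rewrite lerBrDl.
  by rewrite lerXn2r ?nnegrE// (le_trans d0).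
rewrite addnS tower_refine.
move=> -[s [g [Ds g1 r1 r2]]] [s' [g' [Ds' g1' r1' r2']]] le.
set m := (n.+1 + i)%N in Ds Ds' r1 r1' r2 r2' le IH *.
have Au : 0 <= A * u m by rewrite mulr_ge0// ltW// half_pow_gt0.
have Ag f : `|f| <= 1 -> `|(A * u m) *: (f : topdual Z)| <= A * u m.
  by move=> f1; rewrite normrZ (ger0_norm Au) ler_piMr.
have [|b [Db bE]] := IH s s' Ds Ds'.
  have s1 : `|s.1 - q n| <= `|r.1 - q n| + A * u m.
    have -> : s.1 - q n = r.1 - q n - (A * u m) *: g.
      by rewrite r1; apply: topdualP => z; rewrite !topdual_evalE; ring.
    by apply: le_trans (ler_normB _ _) _; rewrite lerD2l Ag.
  have s1' : `|r'.1 - q n| <= `|s'.1 - q n| + A * u m.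
    have -> : r'.1 - q n = s'.1 - q n + (A * u m) *: g' by rewrite r1' addrAC.
    by apply: le_trans (ler_normD _ _) _; rewrite lerD2l Ag.
  move: s1 s1' le; rewrite [u m.+1]half_powS !mulrBr.
  have -> : 4 * A * (u m / 2) = 2 * (A * u m) by field.
  have -> : 4 * A * u m = 4 * (A * u m) by ring.
  by move: (4 * A * _) (A * u m); lra_atoms.
have [b' [Db' bE']] := refine_midpoint (tower_step m) Ds g1 r1 r2 Ds' g1' r1' r2' Db.
exists b'; split=> //; apply: le_trans bE'.
have : 0 <= k m / 4 * (`|r.1 - q m| - `|r'.1 - q m|) ^+ 2.
  by rewrite mulr_ge0 ?sqr_ge0// divr_ge0// ltW//; case: (kP m).
move: bE; move: (k m / 4 * _) (k n / 4 * _); lra_atoms.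
Qed.

End TowerEstimates.

Lemma half_pow_le (R : realType) n m : (n <= m)%N -> half_pow R m <= half_pow R n.
Proof.
by move=> nm; rewrite /half_pow ler_wiXn2l ?invr_ge0// invf_le1// ler1n.
Qed.

(** * The limit point and the limit slope *)

Section TowerLimit.
Context (R : realType) (Z : normedModType R) (rZ : reflexive_space Z) (Omega : set Z).
Context (D0 : set (topdual Z * R)) (K B0 A : R).
Hypotheses (bD0 : affine_bounded D0 K B0) (KA : 0 <= K /\ 0 < A).
Context (D : nat -> set (topdual Z * R)) (w : nat -> Z)
  (p : nat -> topdual Z * R) (q : nat -> topdual Z) (k : nat -> R).
Hypothesis tD : tower Omega D0 K A D w p q k.
Context (U : set_system nat) (f : topdual Z) (wl : Z).
Hypotheses (UU : UltraFilter U) (ooU : \oo `<=` U).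
Hypothesis pf : forall x, (p n).1 x @[n --> U] --> f x.
Hypothesis wlim : forall n, `|wl - w n| <= 6 * A * half_pow R n.

Local Notation u := (@half_pow R).
Local Notation S n := (affine_sup (D n)).
Local Notation L := (K + 2 * A).
Local Notation E := (5 * A ^+ 2 + 6 * A * L).
Local Notation tail N := [set (p i).1 | i in [set i | (N <= i)%N]].

(** A slope chosen at stage [i] stays almost active later on. The [5] in [E] counts one tolerance at
    [w i], two units for padding and two for the possible increase of the almost minimal value;
    [6 * A * L] pays for moving from [w i] to [w m]. The property is convex in the slope, hence
    holds on the hull. *)
Lemma tower_tail_active N c : convex_hull (tail N) c ->
  exists M, forall m, (M <= m)%N ->
    exists b, D m (c, b) /\ S m (w m) <= c (w m) + b + E * u N.
Proof.
have [K0 A0] := KA.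
have L0 : 0 <= L by rewrite addr_ge0// mulr_ge0// ltW.
pose good c := exists M, forall m, (M <= m)%N ->
    exists b, D m (c, b) /\ S m (w m) <= c (w m) + b + E * u N.
move=> hc; suff : good c by [].
apply: (convex_hull_min _ _ hc).
  apply/convex_setP => x y t [M Mx] [M' M'y] t0 t1; exists (maxn M M') => m.
  rewrite geq_max => /andP[/Mx[b [Db xb]] /M'y[b' [Db' yb']]].
  exists (t * b + (1 - t) * b'); split.
    have [_ lev _ _ _] := tD; have [_ cD _] := lev m.
    exact: (cD (x, b) (y, b') t Db Db' t0 t1).
  have t1' : 0 <= 1 - t by rewrite subr_ge0.
  move: (ler_wpM2l t0 xb) (ler_wpM2l t1' yb'); rewrite !topdual_evalE.
  by move: (S m _) (E * _) (x _) (y _) => s v c1 c2; lra_atoms.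
move=> _ [i /= Ni <-]; exists i => m im.
have [Dp act] := tower_active tD i.
have [b [pb Db]] := tower_pad bD0 KA tD im Dp.
exists b; split=> //.
have ui := half_pow_gt0 R i; have um := half_pow_gt0 R m.
have := tower_sup_anti bD0 KA tD im.
have := tower_eval_lip KA tD (w i) (w m) Dp.
have : L * `|w i - w m| <= 6 * A * L * u i.
  have -> : 6 * A * L * u i = L * (6 * A * u i) by ring.
  by rewrite ler_wpM2l// distrC (tower_dist bD0 KA tD im).
have : A ^+ 2 * u i ^+ 2 <= A ^+ 2 * u i.
  by rewrite ler_wpM2l ?exprn_ge0 ?(ltW A0)// expr2 ler_piMr ?half_pow_le1// ltW.
have : E * u i <= E * u N.
  rewrite ler_wpM2l ?half_pow_le//.
  by rewrite addr_ge0 ?mulr_ge0 ?exprn_ge0 ?(ltW A0).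
have : 0 <= 2 * A ^+ 2 * u m by rewrite !mulr_ge0 ?exprn_ge0 ?(ltW A0)// ltW.
move: act pb; rewrite /affine_eval.
have -> : E * u i = 5 * (A ^+ 2 * u i) + 6 * A * L * u i by ring.
have -> : 2 * A ^+ 2 * (u i - u m) = 2 * (A ^+ 2 * u i) - 2 * A ^+ 2 * u m by ring.
move: (A ^+ 2 * u i ^+ 2) (A ^+ 2 * u i) (6 * A * L * u i) (E * u N) (2 * A ^+ 2 * u m).
by move: (L * _) (S i _) (S m _) => s1 s2 s3 s4 s5 s6 s7 s8; lra_atoms.
Qed.

Lemma tower_limit_hull N (e : R) : 0 < e ->
  exists2 c, convex_hull (tail N) c & `|f - c| <= e.
Proof.
apply: (@mazur R Z rZ (tail N) nat U (fun n => (p n).1)) => //.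
by apply: ooU; exists N => // n Nn; exists n.
Qed.

(** The limit is close to the hull of the slopes, hence to a rational combination, and this
    combination is a centre at some stage beyond [N]. *)
Lemma tower_limit_center N (e : R) : 0 < e ->
  exists2 n, (N <= n)%N & `|f - q n| <= e.
Proof.
move=> e0; have e20 : 0 < e / 2 by rewrite divr_gt0.
have [c hc fc] := tower_limit_hull 0 e20.
have hc' : convex_hull (range (fun i => (p i).1)) c.
  by apply: (convex_hull_min (@convex_hull_convex _ _ _) _ hc) => _ [i _ <-];
     apply: sub_convex_hull; exists i.
have [l cl] := hull_rat_comb hc' e20.
have [_ _ _ _ /(_ l N)[n Nn qn]] := tD; exists n => //; rewrite qn.
rewrite -(subrKA c); apply: le_trans (ler_normD _ _) _.
by rewrite [e]splitr lerD.
Qed.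

(** At points of [Omega] near [wl] an almost active slope [r] is close to [f]: otherwise its
    midpoint with [h], an almost active hull element near [f], would exceed the supremum at [w m],
    by the strict convexity around a centre [q n] near [f]. As [w m] almost minimizes, [r] is almost
    nonnegative in the direction [z - wl], and so is [f]. *)
Lemma tower_limit_normal (c : R) : 0 < c -> exists2 d, 0 < d &
  forall z, Omega z -> `|z - wl| < d -> - (c * `|z - wl|) <= f (z - wl).
Proof.
move=> c0; have [K0 A0] := KA.
have L0 : 0 < L by rewrite ltr_wpDl// mulr_gt0.
pose e1 := c / 8; have e10 : 0 < e1 by rewrite divr_gt0.
have [n0 n0P] := half_pow_small (2 * A) e10.
have [n n0n fqn] := tower_limit_center n0 e10.
have [kn0 _] : 0 < k n /\ k n * (K + 2 * A + `|q n|) ^+ 2 <= A ^+ 2 * u n ^+ 2.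
  by have [_ _ _ ] := tD.
(* With margin [e1], [tower_gap] gains [g / 4]. The defects [g / 8] of [h], and [g / 8] and [g / 32]
   of [r] for moving from [z] to [wl] and for the stage, enter the midpoint with weight one half and
   stay below that. *)
pose g := k n * e1 ^+ 2; have g0 : 0 < g by rewrite mulr_gt0// exprn_gt0.
have [|N NP] := @half_pow_small R E (g / 8); first by rewrite divr_gt0.
have [h hh fh] := tower_limit_hull N e10.
have [M MP] := tower_tail_active hh.
exists (g / 8 / L); first by rewrite !divr_gt0.
move=> z Oz zd; have [->|zw] := eqVneq z wl.
  by rewrite subrr normr0 mulr0 oppr0 linear0.
have zw0 : 0 < `|z - wl| by rewrite normr_gt0 subr_eq0.
(* Unlike the radius, the stage [m] may depend on [z]: its errors have to be small against
   [|z - wl|]. *)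
pose y := Num.min (g / 32) (e1 * `|z - wl|).
have y0 : 0 < y by rewrite lt_min divr_gt0//= mulr_gt0.
have [M' M'P] := half_pow_small (2 * A ^+ 2 + 6 * A * L) y0.
pose m := maxn (maxn M M') n.+1.
have [b [Db hb]] := MP m (leq_trans (leq_maxl M M') (leq_maxl _ _)).
have um := half_pow_gt0 R m.
have small : 2 * (A ^+ 2 * u m ^+ 2) + L * (6 * A * u m) <= y.
  apply: le_trans (M'P m _); last by rewrite /m leq_max leq_max leqnn orbT.
  have -> : (2 * A ^+ 2 + 6 * A * L) * u m = 2 * (A ^+ 2 * u m) + L * (6 * A * u m).
    by ring.
  rewrite lerD2r ler_pM2l// ler_wpM2l ?exprn_ge0 ?(ltW A0)//.
  by rewrite expr2 ler_piMr ?half_pow_le1// ltW.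
have eta0 : 0 < A ^+ 2 * u m ^+ 2 by rewrite mulr_gt0 ?exprn_gt0.
have [r Dr rz] := tower_sup_near KA tD m z eta0.
have Smz := tower_minimal tD m Oz.
have wm := ler_wpM2l (ltW L0) (wlim m).
have rl := ler_wpM2r (normr_ge0 (z - wl)) (tower_norm KA tD Dr).
have zwm : L * `|z - w m| <= L * `|z - wl| + L * `|wl - w m|.
  by rewrite -mulrDr ler_wpM2l ?(ltW L0)// -(subrKA wl) ler_normD.
have near_q : `|r.1 - q n| <= `|h - q n| + 2 * A * u n + e1.
  rewrite leNgt; apply/negP => lt.
  have [i mi] : exists i, m = (n.+1 + i)%N.
    by exists (m - n.+1)%N; rewrite subnKC// leq_maxr.
  have le : `|h - q n| + 4 * A * (u n.+1 - u m) + e1 <= `|r.1 - q n|.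
    apply: le_trans (ltW lt); rewrite lerD2r lerD2l half_powS.
    have -> : 4 * A * (u n / 2 - u m) = 2 * A * u n - 4 * A * u m by field.
    by rewrite gerBl !mulr_ge0 ?(ltW A0) ?(ltW um).
  rewrite mi in Db Dr le.
  have [b' [Db' bb']] := tower_gap bD0 KA tD (ltW e10) Db Dr le.
  rewrite -mi in Db Dr le Db'.
  have := tower_sup_ub KA tD (w m) Db'.
  have := tower_eval_lip KA tD z (w m) Dr.
  have gE : k n / 4 * e1 ^+ 2 = g / 4 by rewrite /g mulrAC.
  have zd' : L * `|z - wl| < g / 8.
    by rewrite mulrC -ltr_pdivlMr.
  have yg : y <= g / 32 by rewrite ge_min lexx.
  have Ng := NP N (leqnn N).
  move: bb' hb rz Smz zwm wm small; rewrite gE /affine_eval; cbn [fst snd].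
  rewrite !topdual_evalE.
  move: Ng yg zd' g0; clear - R.
  move: (L * `|z - wl|) (L * `|z - w m|) (L * `|wl - w m|) (L * (6 * A * u m))
    (A ^+ 2 * u m ^+ 2) (E * u N) (S m z) (S m (w m)) (r.1 z) (r.1 (w m)) (h (w m)).
  move: g y r.2 b b' => v1 v2 v3 v4 v5 v6 v7 v8 v9 v10 v11 v12 v13 v14 v15 v16.
  lra.
(* Two shares of [e1] lead from [q n] through [f] to [h], one bounds [2 * A * u n], one is the
   margin, and one leads from [q n] back to [f]. *)
have rf : `|r.1 - f| <= 5 * e1.
  have := n0P n n0n; move: near_q fqn fh.
  have := ler_distD (q n) r.1 f; have := ler_distD f h (q n).
  rewrite [`|q n - f|]distrC [`|h - f|]distrC.
  move: (2 * A * u n) => v1; lra_atoms.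
have rzw : - y <= r.1 (z - wl).
  have := tower_sup_ub KA tD (w m) Dr.
  have : r.1 wl - r.1 (w m) <= L * `|wl - w m|.
    rewrite -topdualN -topdualD; apply: le_trans (ler_norm _) _.
    apply: le_trans (topdual_le _ _) _; rewrite ler_wpM2r//.
    exact: (tower_norm KA tD Dr).
  move: rz Smz wm small; rewrite /affine_eval !topdualE; clear - R.
  move: (L * `|wl - w m|) (L * (6 * A * u m))
    (A ^+ 2 * u m ^+ 2) (S m z) (S m (w m)) (r.1 z) (r.1 (w m)) (r.1 wl).
  move: y r.2 => v1 v2 v3 v4 v5 v6 v7 v8 v9 v10; lra.
have : r.1 (z - wl) - f (z - wl) <= 5 * e1 * `|z - wl|.
  have -> : r.1 (z - wl) - f (z - wl) = (r.1 - f) (z - wl) by [].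
  apply: le_trans (ler_norm _) _; apply: le_trans (topdual_le _ _) _.
  by rewrite ler_wpM2r.
have yz : y <= e1 * `|z - wl| by rewrite ge_min lexx orbT.
have -> : c * `|z - wl| = 8 * (e1 * `|z - wl|) by rewrite /e1; field.
have : 0 < e1 * `|z - wl| by rewrite mulr_gt0.
rewrite -mulrA; move: rzw yz.
by move: (e1 * `|z - wl|) (r.1 (z - wl)) (f (z - wl)); lra_atoms.
Qed.

(** The [D0]-component of an almost active element is compared with every competitor by exchanging
    the two. The error is that of [tower_tail_active], plus [2 * A ^+ 2] for penalties, plus twice
    [6 * A * L] for moving between [w M] and [wl]. *)
Lemma tower_limit_ancestor : exists2 p0, D0 p0 &
  `|f - p0.1| <= 3 * A /\
  affine_sup D0 wl <= affine_eval p0 wl + (7 * A ^+ 2 + 18 * A * L).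
Proof.
have [K0 A0] := KA.
have L0 : 0 <= L by rewrite addr_ge0// mulr_ge0// ltW.
have [c hc fc] := tower_limit_hull 0 A0.
have [M MP] := tower_tail_active hc.
have [b [Db cb]] := MP M (leqnn M).
have [p0 Dp0 [cp0 rep]] := tower_ancestor bD0 KA tD Db.
have um := half_pow_gt0 R M.
have [D0E _] : D 0%N = D0 /\ True by have [[]] := tD.
have Dp0' : D 0%N p0 by rewrite D0E.
have wM := ler_wpM2l L0 (wlim M).
have wM1 : L * (6 * A * u M) <= 6 * A * L.
  have -> : L * (6 * A * u M) = 6 * A * L * u M by ring.
  by rewrite ler_piMr ?half_pow_le1// !mulr_ge0// ltW.
have DB := tower_sup_ub KA tD.
exists p0 => //; split.
  apply: le_trans (ler_distD c _ _) _.
  have : 2 * A * (1 - u M) <= 2 * A by rewrite ler_piMr ?mulr_ge0 ?(ltW A0)// gerBl ltW.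
  have -> : 3 * A = A + 2 * A by ring.
  by move=> h; apply: lerD => //; exact: le_trans h.
have -> : affine_sup D0 wl = S 0 wl by rewrite D0E.
have [B bD] := tower_bounded KA tD 0.
apply: (affine_sup_lub bD) => s Ds.
have [b' [Db' bb']] : exists b', D M (c - p0.1 + s.1, b') /\
    b - p0.2 + s.2 - 2 * A ^+ 2 * (1 - u M) <= b' by apply: rep; rewrite -D0E.
have := DB _ _ (w M) Db'.
have := tower_eval_lip KA tD wl (w M) Ds.
have := tower_eval_lip KA tD (w M) wl Dp0'; rewrite [`|w M - wl|]distrC.
have : 0 <= 2 * A ^+ 2 * u M by rewrite !mulr_ge0 ?exprn_ge0 ?(ltW A0)// ltW.
move: bb' cb wM wM1; rewrite /affine_eval; cbn [fst snd]; rewrite !topdual_evalE.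
rewrite [u 0]/half_pow expr0 mulr1 mulrBr mulr1.
have -> : 18 * A * L = 3 * (6 * A * L) by ring.
have : 0 <= A ^+ 2 by rewrite exprn_ge0 ?(ltW A0).
move: (L * (6 * A * u M)) (6 * A * L) (L * `|wl - w M|) (2 * A ^+ 2 * u M) (A ^+ 2).
move: (S M (w M)) (c (w M)) (p0.1 (w M)) (p0.1 wl) (s.1 wl) (s.1 (w M)).
by move=> v1 v2 v3 v4 v5 v6 v7 v8 v9 v10 v11; lra_atoms.
Qed.

Lemma tower_limit_minimal z : Omega z ->
  affine_sup D0 wl <= affine_sup D0 z + (5 * A ^+ 2 + 6 * A * L).
Proof.
move=> Oz; have [K0 A0] := KA.
have L0 : 0 <= L by rewrite addr_ge0// mulr_ge0// ltW.
have <- : D 0%N = D0 by have [[]] := tD.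
have := tower_minimal tD 0 Oz; rewrite /half_pow expr0 expr1n mulr1.
have [B bD] := tower_bounded KA tD 0.
have := affine_sup_lip bD wl (w 0%N).
have := ler_wpM2l L0 (wlim 0); rewrite /half_pow expr0 mulr1.
have -> : L * (6 * A) = 6 * A * L by ring.
have : 0 <= A ^+ 2 by rewrite exprn_ge0 ?(ltW A0).
move: (6 * A * L) (L * `|wl - w 0%N|) (A ^+ 2).
by move: (S 0 wl) (S 0 z) (S 0 (w 0%N)) => v1 v2 v3 v4 v5 v6; lra_atoms.
Qed.

End TowerLimit.

Lemma geometric_limit (R : realType) (Z : completeNormedModType R) (w : nat -> Z)
    (C : R) : (forall n m, (n <= m)%N -> `|w m - w n| <= C * half_pow R n) ->
  exists2 l, w n @[n --> \oo] --> l & forall n, `|l - w n| <= C * half_pow R n.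
Proof.
move=> wC.
have cw : cvg (w @ \oo).
  apply: cauchy_cvg; apply/cauchy_exP => e e0.
  have [M HM] := half_pow_small C (divr_gt0 e0 (ltr0n R 2)).
  exists (w M); exists M => // m /= Mm; rewrite -ball_normE /= distrC.
  apply: le_lt_trans (wC _ _ Mm) _; apply: le_lt_trans (HM M (leqnn M)) _; lra.
exists (lim (w @ \oo)); first exact: cw.
move=> n; have h : `|w m - w n| @[m --> \oo] --> `|lim (w @ \oo) - w n|.
  by apply: cvg_norm; apply: cvgB => //; exact: cvg_cst.
rewrite -(cvg_lim (@Rhausdorff R) h); apply: limr_le.
  by apply/cvg_ex; exists (`|lim (w @ \oo) - w n|).
by exists n => // m /= nm; exact: wC.
Qed.

(* [f] is, up to [e], a subgradient at [z] of the convex function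
   [affine_sup D0], and [- f] is a Frechet normal to [Omega] at [z].  No smooth
   renorming is used: the perturbations of [affine_sup D0] are smoothed only at
   the minimizer, by penalizing slopes far from rational combinations of the
   slopes met along the way, in whose closed span the limit slope lies. *)
Theorem smooth_variational_principle (R : realType) (Z : completeNormedModType R)
    (Omega : set Z) (D0 : set (topdual Z * R)) (K B e : R) :
  reflexive_space Z -> closed Omega -> Omega !=set0 ->
  affine_bounded D0 K B -> affine_convex D0 ->
  (exists m, forall z, Omega z -> m <= affine_sup D0 z) -> 0 < e ->
  exists z f p0, [/\ Omega z, D0 p0 /\ `|f - p0.1| <= e,
    forall z', Omega z' -> affine_sup D0 z <= affine_sup D0 z' + e,
    affine_sup D0 z <= affine_eval p0 z + e &
    forall c, 0 < c -> exists2 d, 0 < d & forall z', Omega z' ->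
      `|z' - z| < d -> - (c * `|z' - z|) <= f (z' - z)].
Proof.
move=> rZ cO nO bD0 cD0 lb e0.
have K0 : 0 <= K by have [[p /bD0.2[pK _]] _] := bD0; apply: le_trans pK.
(* Since [A <= 1], the largest error [7 * A ^+ 2 + 18 * A * (K + 2 * A)] is at most
   [A * (43 + 18 * K)]; the denominator covers it and the others. *)
pose A := Num.min 1 (e / (61 + 18 * K)).
have den0 : 0 < 61 + 18 * K by lra.
have A0 : 0 < A by rewrite lt_min ltr01 divr_gt0.
have A1 : A <= 1 by rewrite ge_min lexx.
have Ae : A * (61 + 18 * K) <= e by rewrite -ler_pdivlMr// ge_min lexx orbT.
have A2 : A ^+ 2 <= A by rewrite expr2 ler_piMr// ltW.
have AK0 : 0 <= A * K by rewrite mulr_ge0// ltW.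
have [D [w [p [q [k tD]]]]] := tower_exists bD0 cD0 A0 nO lb.
have KA : 0 <= K /\ 0 < A by [].
have [wl wwl wlP] := geometric_limit (tower_dist bD0 KA tD).
have [U UU ooU] := ultra_oo_extension.
have pB n : `|(p n).1| <= K + 2 * A.
  by have [Dp _] := tower_active tD n; exact: (tower_norm KA tD Dp).
have [f _ pf] := dual_ultralimit UU pB.
have Owl : Omega wl.
  apply: (@closed_cvg _ _ _ _ w Omega cO _ wl wwl).
  by apply: nearW => n; exact: (tower_mem tD).
have [p0 Dp0 [fp0 act]] := tower_limit_ancestor rZ bD0 KA tD UU ooU pf wlP.
exists wl, f, p0; split=> //.
- split=> //; apply: le_trans fp0 _; move: Ae; rewrite mulrDr mulrCA; lra.
- move=> z' Oz'; apply: le_trans (tower_limit_minimal KA tD wlP Oz') _.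
  rewrite lerD2l; move: Ae; rewrite !mulrDr.
  have -> : 6 * A * (2 * A) = 12 * A ^+ 2 by ring.
  have -> : 6 * A * K = 6 * (A * K) by ring.
  have -> : A * (18 * K) = 18 * (A * K) by ring.
  by move: A2 AK0 A0; move: (A * K) (A ^+ 2); lra_atoms.
- apply: le_trans act _; rewrite lerD2l; move: Ae; rewrite !mulrDr.
  have -> : 18 * A * (2 * A) = 36 * A ^+ 2 by ring.
  have -> : 18 * A * K = 18 * (A * K) by ring.
  have -> : A * (18 * K) = 18 * (A * K) by ring.
  by move: A2 AK0 A0; move: (A * K) (A ^+ 2); lra_atoms.
- exact: (tower_limit_normal rZ bD0 KA tD UU ooU pf wlP).
Qed.

(** * Clarke's directional derivative *)

Section LimsupBounds.
Context (R : realType).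

Lemma limf_esup_le_real (T : choiceType) (X : filteredType T) (F : set_system X)
    (h : X -> R) (c : R) :
  (forall e, 0 < e -> F [set x | h x <= c + e]) ->
  (limf_esup (fun x => (h x)%:E) F <= c%:E)%E.
Proof.
move=> hF; apply/lee_addgt0Pr => e e0.
apply: le_trans (ereal_inf_lbound _) _; first by exists [set x | h x <= c + e]; [exact: hF|].
by apply: ge_ereal_sup => _ [x /= hx <-]; rewrite -EFinD lee_fin.
Qed.

Lemma limf_esup_near (T : choiceType) (X : filteredType T) (F : set_system X)
    (h : X -> R) (c e : R) :
  Filter F -> (limf_esup (fun x => (h x)%:E) F <= c%:E)%E -> 0 < e ->
  F [set x | h x <= c + e].
Proof.
move=> FF hc e0.
have : (limf_esup (fun x => (h x)%:E) F < (c + e)%:E)%E.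
  by apply: le_lt_trans hc _; rewrite lte_fin ltrDl.
move=> /ereal_inf_lt[_ [V FV <-] lt]; apply: filterS FV => x Vx /=.
rewrite -lee_fin; apply: le_trans (ltW lt); apply: ereal_sup_ubound.
by exists x.
Qed.

End LimsupBounds.

Section ClarkeDerivative.
Context (R : realType) (Z : normedModType R).
Implicit Types (psi : Z -> R) (z v : Z) (c : R).

(** An upper bound of Clarke's derivative in terms of real numbers only; [clarke_dderivP] relates it
    to the limsup. *)
Definition clarke_le psi z v c := forall e, 0 < e -> exists2 d, 0 < d &
  forall z' t, `|z' - z| < d -> 0 < t -> t < d ->
    psi (z' + t *: v) - psi z' <= (c + e) * t.

Lemma clarke_dderivP psi z v c :
  (clarke_dderiv psi z v <= c%:E)%E <-> clarke_le psi z v c.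
Proof.
split=> [le e e0|le].
  have [[A B] /= [zA B0] AB] := limf_esup_near _ le e0.
  move: zA => /nbhs_ballP[d1 /= d10 d1A].
  move: B0 => /nbhs_ballP[d2 /= d20 d2B].
  exists (Num.min d1 d2) => [|z' t]; first by rewrite lt_min d10.
  rewrite !lt_min => /andP[zd1 _] t0 /andP[_ td2].
  have /(_ (z', t)) := AB; rewrite /= ler_pdivrMr//; apply; split => /=.
    by apply: d1A; rewrite -ball_normE /= distrC.
  by apply: d2B => //=; rewrite /ball /= sub0r normrN gtr0_norm.
apply: limf_esup_le_real => e e0; have [d d0 H] := le e e0.
exists (ball z d, [set t | 0 < t /\ t < d]).
  split=> /=; first exact: nbhsx_ballx.
  exists d => //= t /=; rewrite /ball /= sub0r normrN => td t0.
  by split=> //; rewrite -(gtr0_norm t0).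
move=> [z' t] /= [+ [t0 td]]; rewrite -ball_normE /= distrC => zd.
by rewrite ler_pdivrMr//; exact: H.
Qed.

Lemma clarke_subdiffP psi z (f : topdual Z) :
  clarke_subdiff psi z f <-> forall v c, clarke_le psi z v c -> f v <= c.
Proof.
split=> [df v c /clarke_dderivP vc|le v].
  by rewrite -lee_fin; apply: le_trans vc; exact: df.
rewrite leNgt; apply/negP => lt.
have [c [dc cf]] : exists c, (clarke_dderiv psi z v <= c%:E)%E /\ c < f v.
  case: (clarke_dderiv psi z v) lt => [r|//|]; first by rewrite lte_fin; exists r.
  by move=> _; exists (f v - 1); split; [rewrite leNye|lra].
by have := le v c; rewrite -clarke_dderivP => /(_ dc); rewrite leNgt cf.
Qed.

Lemma clarke_le_upper psi z v c e : 0 < e -> clarke_le psi z v c ->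
  exists2 d, 0 < d & forall z', `|z' - z| < d -> clarke_le psi z' v (c + e).
Proof.
move=> e0 vc; have [d d0 H] := vc e e0; exists (d / 2); first by rewrite divr_gt0.
move=> z' z'z e' e'0; exists (d / 2); first by rewrite divr_gt0.
move=> z'' t z''z' t0 td.
have : psi (z'' + t *: v) - psi z'' <= (c + e) * t.
  apply: H => //; last by lra.
  by apply: le_lt_trans (ler_distD z' _ _) _; lra.
by move=> /le_trans; apply; rewrite ler_pM2r// lerDl ltW.
Qed.

Section Lipschitz.
Context (psi : Z -> R).
Hypothesis lip : forall x y, psi x <= psi y + `|x - y|.

Lemma clarke_le_norm z v : clarke_le psi z v `|v|.
Proof.
move=> e e0; exists 1 => // z' t _ t0 _.
have := lip (z' + t *: v) z'; rewrite addrAC subrr add0r normrZ gtr0_norm//.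
by rewrite -lerBlDl mulrC => /le_trans; apply; rewrite ler_pM2r// lerDl ltW.
Qed.

Lemma clarke_le_ge z v c : clarke_le psi z v c -> - `|v| <= c.
Proof.
move=> vc; apply/ler_addgt0Pr => e e0; have [d d0 H] := vc e e0.
have d20 : 0 < d / 2 by rewrite divr_gt0.
have := H z (d / 2); rewrite subrr normr0 d0 d20 => /(_ isT isT).
move=> /(_ ltac:(lra)) h; rewrite -(ler_pM2r d20) mulNr; apply: le_trans h.
have := lip z (z + (d / 2) *: v); rewrite opprD addrA subrr add0r normrN normrZ.
by rewrite (gtr0_norm d20) mulrC; lra.
Qed.

Lemma clarke_leD z v v' c c' : clarke_le psi z v c -> clarke_le psi z v' c' ->
  clarke_le psi z (v + v') (c + c').
Proof.
move=> vc vc' e e0; have e20 : 0 < e / 2 by rewrite divr_gt0.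
have [d d0 H] := vc _ e20; have [d' d'0 H'] := vc' _ e20.
have M0 : 0 < 1 + `|v'| by rewrite ltr_pwDl.
pose d1 := Num.min (d / 2 / (1 + `|v'|)) (Num.min (d / 2) d').
exists d1; first by rewrite !lt_min d'0 !divr_gt0.
move=> z' t; rewrite !lt_min => /and3P[z1 z2 z3] t0 /and3P[t1 t2 t3].
have h1 : psi (z' + t *: v') - psi z' <= (c' + e / 2) * t by exact: H'.
have h2 : psi (z' + t *: v' + t *: v) - psi (z' + t *: v') <= (c + e / 2) * t.
  apply: H => //; last by lra.
  rewrite addrAC; apply: le_lt_trans (ler_normD _ _) _; rewrite normrZ gtr0_norm//.
  have : t * `|v'| <= d / 2.
    move: t1; rewrite ltr_pdivlMr// => t1; apply: le_trans (ltW t1).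
    by rewrite ler_pM2l// lerDr.
  by lra.
rewrite scalerDr [t *: v + _]addrC addrA.
have -> : (c + c' + e) * t = (c' + e / 2) * t + (c + e / 2) * t by field.
by move: h1 h2; move: (_ * t) (_ * t) (psi _) (psi _) (psi _); lra_atoms.
Qed.

Lemma clarke_leZ z v c s : 0 < s -> clarke_le psi z v c -> clarke_le psi z (s *: v) (s * c).
Proof.
move=> s0 vc e e0; have [d d0 H] := vc (e / s) (divr_gt0 e0 s0).
exists (Num.min d (d / s)); first by rewrite lt_min d0 divr_gt0.
move=> z' t; rewrite !lt_min => /andP[zd _] t0 /andP[_ td].
rewrite scalerA; have -> : (s * c + e) * t = (c + e / s) * (t * s).
  by field; rewrite gt_eqF.
by apply: H; rewrite // ?mulr_gt0// -ltr_pdivlMr.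
Qed.

Definition clarke_dir z v : R := inf [set c | clarke_le psi z v c].

Let dir_inf z v : has_inf [set c | clarke_le psi z v c].
Proof.
split; first by exists `|v|; exact: clarke_le_norm.
by exists (- `|v|) => c; exact: clarke_le_ge.
Qed.

Lemma clarke_dir_le z v c : clarke_le psi z v c -> clarke_dir z v <= c.
Proof. by move=> vc; apply: ge_inf => //; case: (dir_inf z v). Qed.

Lemma clarke_le_dir z v : clarke_le psi z v (clarke_dir z v).
Proof.
move=> e e0; have e20 : 0 < e / 2 by rewrite divr_gt0.
have [c vc lt] := inf_adherent e20 (dir_inf z v).
have [d d0 H] := vc _ e20; exists d => // z' t zd t0 td.
apply: le_trans (H _ _ zd t0 td) _; rewrite ler_pM2r//.
by move: lt; rewrite -/(clarke_dir z v); lra.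
Qed.

Lemma clarke_dir_sublinear z : sublinear (clarke_dir z).
Proof.
have sc t a : 0 < t -> clarke_dir z (t *: a) <= t * clarke_dir z a.
  by move=> t0; apply: clarke_dir_le; apply: clarke_leZ => //; exact: clarke_le_dir.
split=> [x y|t x].
  by apply: clarke_dir_le; apply: clarke_leD; exact: clarke_le_dir.
rewrite le_eqVlt => /predU1P[<-|t0].
  rewrite scale0r mul0r; apply/eqP; rewrite eq_le; apply/andP; split.
    by apply: clarke_dir_le; have := clarke_le_norm z 0; rewrite normr0.
  by have := clarke_le_ge (clarke_le_dir z 0); rewrite normr0 oppr0.
apply/eqP; rewrite eq_le sc//= -ler_pdivlMl//.
by apply: le_trans (sc _ _ _); rewrite ?invr_gt0// scalerA mulVf ?gt_eqF// scale1r.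
Qed.

Lemma clarke_subdiff_dir z (f : topdual Z) :
  clarke_subdiff psi z f <-> forall v, f v <= clarke_dir z v.
Proof.
split=> [/clarke_subdiffP df v|df]; first by apply: df; exact: clarke_le_dir.
by apply/clarke_subdiffP => v c vc; apply: le_trans (df v) _; exact: clarke_dir_le.
Qed.

Lemma clarke_subdiff_norm z (f : topdual Z) : clarke_subdiff psi z f -> `|f| <= 1.
Proof.
move=> /clarke_subdiffP df; apply: topdual_lub => // v; rewrite mul1r.
by apply: df; exact: clarke_le_norm.
Qed.

Lemma clarke_subdiff_cvg (F : set_system nat) (z_ : nat -> Z) (f_ : nat -> topdual Z)
    (z : Z) (f : topdual Z) : ProperFilter F ->
  (forall d, 0 < d -> F [set n | `|z_ n - z| < d]) ->
  (forall n, clarke_subdiff psi (z_ n) (f_ n)) ->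
  (forall v, f_ n v @[n --> F] --> f v) -> clarke_subdiff psi z f.
Proof.
move=> PF zz df ff; apply/clarke_subdiffP => v c vc.
apply/ler_addgt0Pr => e e0; have e20 : 0 < e / 2 by rewrite divr_gt0.
have [d d0 H] := clarke_le_upper e20 vc.
have /cvgrPdist_le/(_ _ e20) fn := ff v.
have [n [/= zn le]] := filter_ex (filterI (zz d d0) fn).
have /clarke_subdiffP/(_ _ _ (H _ zn)) := df n.
by move: le; rewrite ler_norml; move: (f v) (f_ n v) => a b /andP[_]; lra.
Qed.

End Lipschitz.
End ClarkeDerivative.

Section DistanceFunction.
Context (R : realType) (Z : normedModType R) (Omega : set Z).
Implicit Types z v w : Z.
Hypothesis nO : Omega !=set0.

Let dist_inf z : has_inf [set `|z - w| | w in Omega].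
Proof.
split; first by have [w Ow] := nO; exists `|z - w|, w.
by exists 0 => _ [w _ <-].
Qed.

Lemma set_dist_le z w : Omega w -> set_dist Omega z <= `|z - w|.
Proof. by move=> Ow; apply: ge_inf; [case: (dist_inf z)|exists w]. Qed.

Lemma set_dist_ge0 z : 0 <= set_dist Omega z.
Proof. by apply: lb_le_inf; [case: (dist_inf z)|move=> _ [w _ <-]]. Qed.

Lemma set_dist_near z e : 0 < e ->
  exists2 w, Omega w & `|z - w| <= set_dist Omega z + e.
Proof.
move=> e0; have [_ [w Ow <-] lt] := inf_adherent e0 (dist_inf z).
by exists w => //; exact: ltW.
Qed.

Lemma set_dist_lip x y : set_dist Omega x <= set_dist Omega y + `|x - y|.
Proof.
apply/ler_addgt0Pr => e e0; have [w Ow le] := set_dist_near y e0.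
apply: le_trans (set_dist_le x Ow) _; have := ler_distD y x w; lra.
Qed.

Lemma set_dist0 w : Omega w -> set_dist Omega w = 0.
Proof.
move=> Ow; apply/eqP; rewrite eq_le set_dist_ge0 andbT.
by have := set_dist_le w Ow; rewrite subrr normr0.
Qed.

(* For the distance function the limsup defining Clarke's derivative may be
   restricted to base points of the set. *)
Lemma set_dist_clarke_le z v c : Omega z ->
  (forall e, 0 < e -> exists2 d, 0 < d & forall w t, Omega w -> `|w - z| < d ->
    0 < t -> t < d -> set_dist Omega (w + t *: v) <= (c + e) * t) ->
  clarke_le (set_dist Omega) z v c.
Proof.
move=> Oz H e e0; have e20 : 0 < e / 2 by rewrite divr_gt0.
have [d d0 Hd] := H _ e20; have M0 : 0 < 2 + e / 2 by lra.
have d10 : 0 < d / (2 + e / 2) by rewrite divr_gt0.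
have d1d : d / (2 + e / 2) <= d.
  by rewrite ler_pdivrMr// ler_peMr ?(ltW d0)//; lra.
exists (d / (2 + e / 2)) => // z' t zd t0 td.
(* An almost nearest point, with an excess of the order of the step, takes the place of [z']. It
   lies within [2 * |z' - z| + e / 2 * t] of [z], whence the denominator [2 + e / 2]. *)
have [w Ow le] := set_dist_near z' (mulr_gt0 e20 t0).
have dz' : set_dist Omega z' <= `|z' - z| by exact: set_dist_le.
have wd : `|w - z| < d.
  apply: le_lt_trans (ler_distD z' _ _) _; rewrite distrC.
  have h : `|z' - w| + `|z' - z| <= 2 * `|z' - z| + e / 2 * t.
    move: le dz'; move: (_ / _ * _); lra_atoms.
  apply: le_lt_trans h _.
  have -> : d = 2 * (d / (2 + e / 2)) + e / 2 * (d / (2 + e / 2)).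
    by rewrite -mulrDl mulrC divfK// gt_eqF.
  by rewrite ltr_leD ?ltr_pM2l// ltW// ltr_pM2l.
have := Hd w t Ow wd t0 (lt_le_trans td d1d).
have := set_dist_lip (z' + t *: v) (w + t *: v).
rewrite opprD addrACA subrr addr0.
have -> : (c + e) * t = (c + e / 2) * t + e / 2 * t by field.
by move: le; move: (_ * t) (_ * t) (set_dist _ _) (set_dist _ _) (set_dist _ _); lra_atoms.
Qed.

End DistanceFunction.

(** * Clarke subgradients and limiting normals *)

Section FrechetNormals.
Context (R : realType) (Z : normedModType R).
Implicit Types (z v : Z) (Omega : set Z).

Definition frechet_normal Omega z (g : topdual Z) :=
  forall c, 0 < c -> exists2 d, 0 < d & forall z', Omega z' ->
    `|z' - z| < d -> g (z' - z) <= c * `|z' - z|.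

Lemma frechet_prenormal Omega z (g : topdual Z) : Omega z -> frechet_normal Omega z g ->
  prenormal z Omega g.
Proof.
move=> Oz fg; split=> //; apply: limf_esup_le_real => e e0; rewrite add0r.
have [d d0 H] := fg e e0; rewrite /within /=.
apply/nbhs_ballP; exists d => //= z' zz' z'z Oz'.
rewrite ler_pdivrMr ?normr_gt0 ?subr_eq0//.
by apply: H => //; move: zz'; rewrite -ball_normE /= distrC.
Qed.

Lemma frechet_normalZ Omega z (g : topdual Z) (s : R) : 0 < s ->
  frechet_normal Omega z g -> frechet_normal Omega z (s *: g).
Proof.
move=> s0 fg c c0; have [d d0 H] := fg (c / s) (divr_gt0 c0 s0).
exists d => // z' Oz' z'z; rewrite topdual_scaleE -ler_pdivlMl//.
by rewrite mulrA [_ * c]mulrC; exact: H.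
Qed.

Lemma frechet_normal0 Omega z : frechet_normal Omega z 0.
Proof.
move=> c c0; exists 1 => // z' _ _; rewrite topdual_zeroE.
by rewrite mulr_ge0// ltW.
Qed.

End FrechetNormals.

(** * A mean value inequality for the distance function *)

Section MeanValue.
Context (R : realType) (Z : completeNormedModType R) (rZ : reflexive_space Z).
Context (Omega : set Z).
Hypothesis cO : closed Omega.

(* The minimized function is the infimal convolution of the norm and of
   [s v |-> - alpha s], [0 <= s <= t]; a slope [phi] with [phi v > - alpha] would
   be attained at [s = t], where the values exceed those at [w]. *)
Theorem frechet_mean_value (w v : Z) (alpha t e : R) : Omega w -> 0 < alpha ->
  0 < t -> 0 < e -> alpha * t < set_dist Omega (w + t *: v) ->
  exists z g, [/\ Omega z, frechet_normal Omega z g,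
    `|z - w| <= t * (`|v| + alpha + 1), `|g| <= 1 + e & alpha - e <= g v].
Proof.
move=> Ow alpha0 t0 e0 far.
have nO : Omega !=set0 by exists w.
pose mu := set_dist Omega (w + t *: v) - alpha * t.
have mu0 : 0 < mu by rewrite subr_gt0.
(* The infimal convolution in dual form: for a slope [p.1] of the unit ball, the infimum of
   [- s * (p.1 v + alpha)] over [s] in [[0, t]] is [- t * Num.max 0 (p.1 v + alpha)]. *)
pose D0 : set (topdual Z * R) := [set p : topdual Z * R | `|p.1| <= 1 /\
  p.2 <= - (t * Num.max 0 (p.1 v + alpha)) - p.1 w].
have bD : affine_bounded D0 1 `|w|.
  split.
    exists (0, - (t * alpha)); rewrite /D0 /= normr0; split => //.
    by rewrite add0r subr0 max_r// ltW.
  move=> [f b] /= [f1 fb]; split => //; apply: le_trans fb _.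
  have : 0 <= t * Num.max 0 (f v + alpha).
    by rewrite mulr_ge0 ?(ltW t0)// le_max lexx.
  have : - f w <= `|w|.
    rewrite -topdualN; apply: le_trans (ler_norm _) _.
    by apply: le_trans (topdual_le _ _) _; rewrite normrN ler_piMl.
  by move: (t * _); lra_atoms.
have cD : affine_convex D0.
  move=> [f b] [f' b'] s [/= f1 fb] [/= f1' fb'] s0 s1.
  have s1' : 0 <= 1 - s by rewrite subr_ge0.
  split; cbn [fst snd].
    apply: le_trans (ler_normD _ _) _; rewrite !normrZ !ger0_norm//.
    by move: (ler_wpM2l s0 f1) (ler_wpM2l s1' f1'); lra_atoms.
  rewrite !topdual_evalE.
  have maxc : Num.max 0 (s * f v + (1 - s) * f' v + alpha) <=
      s * Num.max 0 (f v + alpha) + (1 - s) * Num.max 0 (f' v + alpha).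
    rewrite ge_max; apply/andP; split.
      by rewrite addr_ge0// mulr_ge0// le_max lexx.
    have -> : s * f v + (1 - s) * f' v + alpha =
      s * (f v + alpha) + (1 - s) * (f' v + alpha) by ring.
    by apply: lerD; rewrite ler_wpM2l// le_max lexx orbT.
  have := ler_wpM2l (ltW t0) maxc.
  move: (ler_wpM2l s0 fb) (ler_wpM2l s1' fb').
  move: (Num.max _ _) (Num.max _ _) (Num.max _ _) (f w) (f' w) => m1 m2 m3 x x'.
  rewrite !mulrDr !mulrN [s * (t * _)]mulrCA [(1 - s) * (t * _)]mulrCA.
  by move: (t * m3) (t * _) (t * _) (s * x) ((1 - s) * x') (s * b) (_ * b'); lra_atoms.
have T0 : affine_sup D0 w <= 0.
  apply: (affine_sup_lub bD) => -[f b] [/= _ fb]; rewrite /affine_eval /=.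
  have : 0 <= t * Num.max 0 (f v + alpha).
    by rewrite mulr_ge0 ?(ltW t0)// le_max lexx.
  by move: fb; move: (t * _); lra_atoms.
have lbT z : `|z - w| - t * (`|v| + alpha) <= affine_sup D0 z.
  have [f f1 fE] := norming_functional (z - w).
  have Df : D0 (f, - (t * (`|v| + alpha)) - f w).
    split=> //; cbn [fst snd]; rewrite lerD2r lerN2 ler_pM2l// ge_max.
    rewrite addr_ge0 ?(ltW alpha0)//= lerD2r; apply: le_trans (ler_norm _) _.
    by apply: le_trans (topdual_le _ _) _; rewrite ler_piMl.
  have := affine_sup_ub bD z Df; rewrite /affine_eval; cbn [fst snd].
  by rewrite -fE topdualD topdualN; move: (t * _) (affine_sup _ _); lra_atoms.
pose e2 := e / 2; have e20 : 0 < e2 by rewrite divr_gt0.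
pose M := e2 + `|v| + 1; have M0 : 0 < M by rewrite ltr_wpDl ?addr_ge0 ?(ltW e20).
(* The weight with which [g] is mixed into [f0] below: since [(1 - la) * e2 - la * |v| = la], it
   keeps [fl v + alpha] nonnegative. *)
have [la [la0 la1 laM]] : exists la, [/\ 0 < la, la <= 1 & la * M = e2].
  exists (e2 / M); rewrite divr_gt0// ler_pdivrMr// divfK ?gt_eqF// mul1r.
  by rewrite /M -addrA lerDl addr_ge0.
(* The four bounds serve, in this order, the contradiction below, the location of [z], the norm of
   [f] and its value at [v]. *)
pose e' := Num.min (Num.min (la * mu / 4) t) (Num.min e (e2 / (1 + `|v|))).
have v0 : 0 < 1 + `|v| by rewrite ltr_pwDl.
have q1 : 0 < la * mu / 4 by rewrite divr_gt0// mulr_gt0.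
have q2 : 0 < e2 / (1 + `|v|) by rewrite divr_gt0.
have e'0 : 0 < e' by rewrite !lt_min q1 q2 t0 e0.
have [e'1 [e't [e'e e'v]]] : e' <= la * mu / 4 /\ e' <= t /\ e' <= e /\ e' <= e2 / (1 + `|v|).
  by split; [|split; [|split]]; rewrite /e' !ge_min lexx ?orbT.
have lb : exists m, forall z, Omega z -> m <= affine_sup D0 z.
  exists (- (t * (`|v| + alpha))) => z _; apply: le_trans (lbT z).
  by rewrite -subr_ge0 opprK subrK.
have [z [f [[f0 b0] [Oz [D0f ff0] zmin act fN]]]] :=
  smooth_variational_principle rZ cO nO bD cD lb e'0.
move: ff0 act; rewrite /affine_eval; cbn [fst snd] => ff0 act.
have Tz : affine_sup D0 z <= e'.
  by apply: le_trans (zmin w Ow) _; rewrite gerDr.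
(* Were [f0 v] larger, mixing in a functional norming [z - (w + t *: v)] would gain [la * mu], more
   than the error [e'] allows for an almost active slope. *)
have f0v : f0 v <= - alpha + e2.
  rewrite leNgt; apply/negP => lt.
  have [g g1 gE] := norming_functional (z - (w + t *: v)).
  have gv : - `|v| <= g v.
    rewrite lerNl -topdualN; apply: le_trans (ler_norm _) _.
    by apply: le_trans (topdual_le _ _) _; rewrite normrN ler_piMl.
  pose fl := (1 - la) *: f0 + la *: g.
  have la1' : 0 <= 1 - la by rewrite subr_ge0.
  have flv : 0 <= fl v + alpha.
    rewrite /fl !topdual_evalE.
    have h1 : (1 - la) * (- alpha + e2) <= (1 - la) * f0 v by rewrite ler_wpM2l// ltW.
    have h2 : la * (- `|v|) <= la * g v by rewrite ler_wpM2l// ltW.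
    have h3 : 0 <= la * alpha by rewrite mulr_ge0// ltW.
    move: laM h1 h2 h3 la0; rewrite /M !mulrDr !mulrDl !mulrN !mulNr !mul1r mulr1.
    by move: (la * e2) (la * `|v|) (la * alpha) (la * f0 v) (la * g v); lra_atoms.
  have Dl : D0 (fl, - (t * (fl v + alpha)) - fl w).
    split; cbn [fst snd].
      apply: le_trans (ler_normD _ _) _; rewrite !normrZ !ger0_norm ?(ltW la0)//.
      have := ler_wpM2l la1' D0f.1; have := ler_wpM2l (ltW la0) g1; cbn [fst snd].
      lra_atoms.
    by rewrite max_r.
  have := affine_sup_ub bD z Dl; rewrite /affine_eval; cbn [fst snd].
  have far' : mu + alpha * t <= g z - g w - t * g v.
    have -> : g z - g w - t * g v = g (z - (w + t *: v)).
      by rewrite topdualD topdualN topdualD topdualZ; ring.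
    by rewrite gE /mu subrK distrC; exact: set_dist_le.
  have maxf : t * (f0 v + alpha) <= t * Num.max 0 (f0 v + alpha).
    by rewrite ler_pM2l// le_max lexx orbT.
  have act' : affine_sup D0 z <= f0 z - f0 w - t * (f0 v + alpha) + e'.
    case: D0f => _; cbn [fst snd]; move: act maxf.
    by move: (t * _) (t * _) (affine_sup _ _); lra_atoms.
  have k1 : (1 - la) * (affine_sup D0 z - e') <=
      (1 - la) * (f0 z - f0 w - t * (f0 v + alpha)).
    by rewrite ler_wpM2l// lerBlDr.
  have k2 := ler_wpM2l (ltW la0) far'.
  have k3 : la * affine_sup D0 z <= la * e' by rewrite ler_pM2l.
  have k4 : la * e' <= e' by rewrite ler_piMl// ltW.
  have lamu : 0 < la * mu by rewrite mulr_gt0.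
  have -> : fl z + (- (t * (fl v + alpha)) - fl w) =
      (1 - la) * (f0 z - f0 w - t * (f0 v + alpha)) +
      la * (g z - g w - t * g v) - la * (alpha * t).
    by rewrite /fl !topdual_evalE; ring.
  move: k1 k2 k3 k4 lamu e'1; rewrite [(1 - la) * (_ - e')]mulrBl mul1r !mulrDr mulrN.
  move: (la * affine_sup D0 z) (la * e') (la * mu) (la * (alpha * t)) ((1 - la) * _).
  by move: (la * _) (affine_sup D0 z); lra_atoms.
exists z, (- f); split=> //.
- move=> c c0; have [d d0 H] := fN c c0; exists d => // z' Oz' z'z.
  by rewrite topdual_oppE lerNl; exact: H.
- have := lbT z; rewrite lerBlDr => /le_trans; apply.
  by rewrite !mulrDr mulr1 addrC lerD2l; exact: le_trans e't.
- rewrite normrN -(subrK f0 f); apply: le_trans (ler_normD _ _) _.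
  by rewrite addrC lerD ?(le_trans ff0)//; case: D0f.
- rewrite topdual_oppE.
  have h : f v - f0 v <= e' * `|v|.
    have -> : f v - f0 v = (f - f0) v by [].
    apply: le_trans (ler_norm _) _; apply: le_trans (topdual_le _ _) _.
    by rewrite ler_wpM2r.
  have h' : e' * `|v| <= e2.
    have : e' * (1 + `|v|) <= e2 by rewrite -ler_pdivlMr.
    by rewrite mulrDr mulr1; move: (e' * _) (ltW e'0); lra_atoms.
  have ee2 : e = e2 + e2 by rewrite /e2; field.
  rewrite ee2; by move: h h' f0v; move: (e' * _); lra_atoms.
Qed.

End MeanValue.

Section ClarkeLimiting.
Context (R : realType) (Z : completeNormedModType R) (rZ : reflexive_space Z).
Context (Omega : set Z).
Hypothesis cO : closed Omega.

Lemma frechet_limiting_normal (z_ : nat -> Z) (g_ : nat -> topdual Z) (z : Z)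
    (g : topdual Z) :
  z_ n @[n --> \oo] --> z -> (forall n, Omega (z_ n)) ->
  (forall n, frechet_normal Omega (z_ n) (g_ n)) ->
  (forall x, g_ n x @[n --> \oo] --> g x) -> limiting_normal z Omega g.
Proof.
move=> zz Oz fg gg; exists z_, g_; split=> //.
  by move=> n; exact: frechet_prenormal.
by apply/weak_star_cvgP.
Qed.

(** Failure of the bound supplies segments, shrinking to [z], along which the distance grows faster
    than [alpha]. The mean value theorem turns each into a Frechet normal of norm at most [2] that
    is at least [alpha / 2] at [v], and a weak limit keeps this. Multiples are included for the
    rescaling in [clarke_subdiff_approx]. *)
Lemma steep_limiting_normal (z v : Z) (alpha : R) : Omega z -> 0 < alpha ->
  ~ clarke_le (set_dist Omega) z v alpha ->
  exists2 g : topdual Z, alpha / 2 <= g v & forall s, 0 < s -> limiting_normal z Omega (s *: g).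
Proof.
move=> Oz alpha0 nle; have nO : Omega !=set0 by exists z.
have [e [e0 He]] : exists e, 0 < e /\ forall d, 0 < d -> exists w t,
    [/\ Omega w, `|w - z| < d, 0 < t, t < d &
        (alpha + e) * t < set_dist Omega (w + t *: v)].
  (* The segments may start in [Omega], as the mean value theorem requires. *)
  apply: contrapT => ne; apply: nle; apply: set_dist_clarke_le => // e e0.
  apply: contrapT => nd; apply: ne; exists e; split=> // d d0.
  apply: contrapT => nw; apply: nd; exists d => // w t Ow wz t0 td.
  by rewrite leNgt; apply/negP => lt; apply: nw; exists w, t.
pose B := `|v| + alpha + 2.
have B0 : 0 < B by rewrite ltr_wpDl// addr_ge0// ltW.
have /choice[zg zgP] (n : nat) : exists zg : Z * topdual Z,
    [/\ Omega zg.1, frechet_normal Omega zg.1 zg.2, `|zg.1 - z| <= B / n.+1%:R,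
        `|zg.2| <= 2 & alpha / 2 <= zg.2 v].
  have n0 : 0 < n.+1%:R^-1 :> R by rewrite invr_gt0.
  have [w [t [Ow wz t0 td far]]] := He _ n0.
  have far' : alpha * t < set_dist Omega (w + t *: v).
    by apply: le_lt_trans far; rewrite ler_pM2r// lerDl ltW.
  pose e2 := Num.min 1 (alpha / 2).
  have e20 : 0 < e2 by rewrite lt_min ltr01 divr_gt0.
  have [y [g [Oy gN yw g2 gv]]] := frechet_mean_value rZ cO Ow alpha0 t0 e20 far'.
  exists (y, g); split=> //=.
  - apply: le_trans (ler_distD w _ _) _.
    have : t * (`|v| + alpha + 1) <= n.+1%:R^-1 * (`|v| + alpha + 1).
      by rewrite ler_wpM2r ?ltW// ltr_wpDl// addr_ge0// ltW.
    have -> : B / n.+1%:R = n.+1%:R^-1 * (`|v| + alpha + 1) + n.+1%:R^-1.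
      by rewrite /B; ring.
    by move: yw wz; move: (_^-1) (t * _) (_^-1 * _); lra_atoms.
  - have : e2 <= 1 by rewrite ge_min lexx.
    by move: g2; lra_atoms.
  - have : e2 <= alpha / 2 by rewrite ge_min lexx orbT.
    by move: gv; lra_atoms.
have [h [g [hn gh]]] := @weakly_convergent_subsequence R Z (fun n => (zg n).2) 2 rZ
  (fun n => let: And5 _ _ _ b _ := zgP n in b).
exists g => [|s s0].
  rewrite -(cvg_lim (@Rhausdorff R) (gh v)); apply: limr_ge.
    by apply/cvg_ex; exists (g v).
  by apply: nearW => n; case: (zgP (h n)).
apply: (@frechet_limiting_normal (fun n => (zg (h n)).1) (fun n => s *: (zg (h n)).2)).
- apply/cvgrPdist_le => e' e'0; near=> n.
  rewrite distrC; have [_ _ le _ _] := zgP (h n); apply: le_trans le _.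
  have : n.+1%:R^-1 < e' / B.
    by near: n; exact: (near_infty_natSinv_lt (PosNum (divr_gt0 e'0 B0))).
  move=> nB; rewrite mulrC -ler_pdivlMr//; apply: le_trans (ltW nB).
  by rewrite lef_pV2 ?posrE// ler_nat ltnS.
- by move=> n; case: (zgP (h n)).
- by move=> n; apply: frechet_normalZ => //; case: (zgP (h n)).
- move=> x; rewrite topdual_scaleE.
  by apply: cvgM; [exact: cvg_cst|exact: gh].
Unshelve. all: by end_near. Qed.

Lemma limiting_normal0 z : Omega z -> limiting_normal z Omega 0.
Proof.
move=> Oz; apply: (@frechet_limiting_normal (fun=> z) (fun=> 0)) => //.
- exact: cvg_cst.
- by move=> _; exact: frechet_normal0.
- by move=> x; exact: cvg_cst.
Qed.

(** If [v] separated [l *: f] from the hull, then [f v > 0], so the derivative along [v] exceeds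
    [f v / 2] and there is a steep normal [g] with [g v > 0]; rescaled to the value [l * f v] at
    [v], it violates the separation. *)
Theorem clarke_subdiff_approx z (f : topdual Z) (l e : R) : Omega z ->
  clarke_subdiff (set_dist Omega) z f -> 0 <= l -> 0 < e ->
  exists2 c, convex_hull (limiting_normal z Omega) c & `|l *: f - c| <= e.
Proof.
move=> Oz df l0 e0; apply: contrapT => nc.
have N0 := sub_convex_hull (limiting_normal0 Oz).
have [||phi _ phiC] := @convex_separation R _ (convex_hull (limiting_normal z Omega))
    (l *: f) e (@convex_hull_convex _ _ _).
- by exists 0.
- move=> c hc; rewrite leNgt; apply/negP => lt; apply: nc; exists c => //.
  exact: ltW.
have [v _ vphi] := @rZ phi I.
have sep c : convex_hull (limiting_normal z Omega) c -> c v + e <= l * f v.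
  by move=> /phiC; rewrite -vphi.
clear vphi phiC.
have := sep 0 N0; rewrite topdual_zeroE add0r => elf.
have f0 : 0 < f v.
  rewrite ltNge; apply/negP => f0; have := mulr_ge0_le0 l0 f0.
  by move: elf e0; move: (l * _); lra_atoms.
have [||g gv gN] := @steep_limiting_normal z v (f v / 2) Oz.
- by rewrite divr_gt0.
- move=> le; have /clarke_subdiffP/(_ _ _ le) := df.
  by move: f0; lra_atoms.
have g0 : 0 < g v by apply: lt_le_trans gv; rewrite !divr_gt0.
have lf0 : 0 < l * f v by exact: lt_le_trans elf.
have := sep _ (sub_convex_hull (gN (l * f v / g v) (divr_gt0 lf0 g0))).
rewrite topdual_scaleE divfK ?gt_eqF//; move: e0; move: (l * _); lra_atoms.
Qed.

End ClarkeLimiting.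

(** * Metric regularity of a pair of closed sets *)

HB.saturate prod.

Lemma cauchy_image (R : numFieldType) (S T : pseudoMetricType R) (h : S -> T)
    (F : set_system S) : ProperFilter F ->
  (forall x e, ball x e `<=` h @^-1` ball (h x) e) -> cauchy F -> cauchy (h @ F).
Proof.
move=> FF hb /cauchy_ballP Fc; apply/cauchy_ballP => e e0.
have [[P Q] /= [FP FQ] PQ] := Fc e e0.
exists (h @` P, h @` Q).
  split; [apply: filterS FP|apply: filterS FQ] => x Px; by exists x.
by move=> [_ _] /= [[x Px <-] [y Qy <-]]; apply: hb; exact: (PQ (x, y)).
Qed.

(** Graphs lie in [X * Y] and pairs of their points in [(X * Y) * (X * Y)]; the variational
    principles need completeness there. *)
Lemma prod_cauchy_cvg (R : realType) (X Y : completeNormedModType R)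
    (F : set_system (X * Y)%type) : ProperFilter F -> cauchy F -> cvg F.
Proof.
move=> FF Fc.
have c1 : cvg (fst @ F) by apply: cauchy_cvg; apply: (@cauchy_image _ _ _ fst F) => // x e y [].
have c2 : cvg (snd @ F) by apply: cauchy_cvg; apply: (@cauchy_image _ _ _ snd F) => // x e y [].
apply: (cvgP (lim (fst @ F), lim (snd @ F))).
have -> : F = (fun z : X * Y => (z.1, z.2)) @ F.
  by apply/seteqP; split=> A; rewrite /fmap /=; apply: filterS => -[].
by apply: cvg_pair; [exact: c1|exact: c2].
Qed.

HB.instance Definition _ (R : realType) (X Y : completeNormedModType R) :=
  Uniform_isComplete.Build (X * Y)%type (@prod_cauchy_cvg R X Y).

(** [S x] collects the improvements of [x]. Choosing almost minimal values of [phi] forces the radii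
    of these nested sets to zero; the limit lies in all of them and admits no improvement other than
    itself. *)
Theorem ekeland (R : realType) (W : completeNormedModType R) (A : set W)
    (phi : W -> R) (C gamma : R) (w0 : W) :
  closed A -> (forall w, A w -> 0 <= phi w) ->
  (forall w w', phi w <= phi w' + C * `|w - w'|) -> A w0 -> 0 < gamma ->
  exists w, [/\ A w, gamma * `|w - w0| <= phi w0 - phi w &
    forall w', A w' -> phi w <= phi w' + gamma * `|w' - w|].
Proof.
move=> cA phi0 lip Aw0 g0.
pose S x := [set z | A z /\ gamma * `|z - x| <= phi x - phi z].
have Strans x y z : S x y -> S y z -> S x z.
  move=> [Ay yx] [Az zy]; split=> //.
  have := ler_wpM2l (ltW g0) (ler_distD y z x); rewrite mulrDr; lra.
have /choice[next nextP] (nx : nat * W) : exists y, A nx.2 -> S nx.2 y /\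
    forall z, S y z -> `|z - y| <= half_pow R nx.1.
  case: nx => n x /=; have [Ax|nAx] := pselect (A x); last by exists x => /nAx.
  have inf_S : has_inf [set phi z | z in S x].
    split; first by exists (phi x), x => //; rewrite /S /= !subrr normr0 mulr0.
    by exists 0 => _ [z [Az _] <-]; exact: phi0.
  have e0 : 0 < gamma * half_pow R n by rewrite mulr_gt0// half_pow_gt0.
  have [_ [y Sy <-] lt] := inf_adherent e0 inf_S.
  exists y => _; split=> // z Sz; rewrite -(ler_pM2l g0).
  have : inf [set phi z | z in S x] <= phi z.
    by apply: ge_inf; [case: inf_S|exists z => //; exact: Strans Sz].
  by case: Sz => _; move: lt; move: (gamma * _) (gamma * _) (inf _); lra_atoms.
pose w := fix w n := if n is m.+1 then next (m, w m) else w0.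
have Aw n : A (w n).
  by elim: n => //= n IH; have [[]] := nextP (n, w n) IH.
have wP n : S (w n) (w n.+1) /\ forall z, S (w n.+1) z -> `|z - w n.+1| <= half_pow R n.
  exact: (nextP (n, w n) (Aw n)).
have SA n : S (w n) (w n) by split; [exact: Aw|rewrite !subrr normr0 mulr0].
have Sw n m : (n <= m)%N -> S (w n) (w m).
  move=> /subnKC <-; elim: (m - n)%N => [|i IH]; first by rewrite addn0.
  by rewrite addnS; apply: Strans IH _; case: (wP (n + i)%N).
have [n m nm|l wl lw] := @geometric_limit R W (fun n => w n.+1) 1.
  by rewrite mul1r; apply: (wP n).2; apply: Sw.
have Al : A l.
  apply: (@closed_cvg _ _ _ _ (fun n => w n.+1) A cA _ l wl).
  by apply: nearW => n; exact: Aw.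
have Sl n : S (w n) l.
  split=> //; apply/ler_addgt0Pr => e e0.
  have [M HM] := half_pow_small (`|C| + gamma) e0.
  pose m := maxn n M; have um := half_pow_gt0 R m.
  have := lw m; rewrite mul1r => lwm.
  have [_ h] := Sw n m.+1 (leq_trans (leq_maxl n M) (leqnSn _)).
  have h1 := ler_wpM2l (ltW g0) (ler_distD (w m.+1) l (w n)).
  have h2 : phi l <= phi (w m.+1) + `|C| * `|l - w m.+1|.
    apply: le_trans (lip l (w m.+1)) _; rewrite lerD2l ler_wpM2r//.
    exact: ler_norm.
  have h3 : (`|C| + gamma) * `|l - w m.+1| <= e.
    apply: le_trans (HM m (leq_maxr _ _)); rewrite ler_wpM2l// addr_ge0//.
    exact: ltW.
  move: h h1 h2 h3; rewrite mulrDr mulrDl.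
  by move: (gamma * _) (gamma * _) (gamma * _) (`|C| * _) (phi _) (phi _) (phi _); lra_atoms.
exists l; split=> //; first by case: (Sl 0%N).
move=> w' Aw'; rewrite leNgt; apply/negP => lt.
have Slw' : S l w' by split=> //; rewrite lerBrDr addrC; exact: ltW.
have near n : `|w' - w n.+1| <= half_pow R n.
  by apply: (wP n).2; apply: Strans (Sl _) Slw'.
have w'l : w' = l.
  apply/eqP; rewrite -subr_eq0 -normr_le0; apply/ler_addgt0Pr => e e0.
  rewrite add0r; have [M HM] := half_pow_small 2 e0.
  apply: le_trans (ler_distD (w M.+1) _ _) _; rewrite [`|w M.+1 - l|]distrC.
  by move: (near M) (lw M) (HM M (leqnn M)); rewrite mul1r; lra_atoms.
by move: lt; rewrite w'l subrr normr0 mulr0 addr0 ltxx.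
Qed.

Section NormDerivative.
Context (R : realType) (X : normedModType R).

Lemma norm_lip (a b : X) : `|a| <= `|b| + `|a - b|.
Proof. by rewrite addrC -lerBlDr; exact: lerB_dist. Qed.

(** As [z - t *: x = (1 - t) *: z + t *: (z - x)], the norm decreases at the rate [|z|] up to
    [|z - x|]. *)
Lemma norm_clarke_leN (x : X) : clarke_le (fun z : X => `|z|) x (- x) (- `|x|).
Proof.
move=> e e0; exists (Num.min 1 (e / 2)); first by rewrite lt_min ltr01 divr_gt0.
move=> z t; rewrite !lt_min => /andP[_ ze] t0 /andP[t1 _].
have -> : z + t *: - x = (1 - t) *: z + t *: (z - x).
  by apply: eq_topdual => f; rewrite !topdualE; ring.
have := ler_normD ((1 - t) *: z) (t *: (z - x)).
rewrite !normrZ (gtr0_norm t0) (@ger0_norm _ (1 - t)); last by rewrite subr_ge0 ltW.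
have xz : `|x| <= `|z| + `|z - x| by rewrite distrC; exact: norm_lip.
have := ler_wpM2l (ltW t0) xz; have := ltr_pM2l t0 `|z - x| (e / 2).
rewrite ze mulrDr mulrBl mul1r [(- _ + _) * t]mulrDl mulNr [`|x| * t]mulrC => lt.
have -> : e * t = 2 * (t * (e / 2)) by field.
by move: lt; move: (t * (e / 2)) (t * `|x|) (t * `|z|) (t * `|z - x|); lra_atoms.
Qed.

End NormDerivative.

Section PairTopdual.
Context (R : realType) (X Y : normedModType R).
Implicit Types (f : topdual X) (g : topdual Y).

Lemma norm_inl (u : X) : `|(u, 0 : Y)| = `|u|.
Proof. by rewrite pair_norm /= normr0 max_l. Qed.

Lemma norm_inr (v : Y) : `|(0 : X, v)| = `|v|.
Proof. by rewrite pair_norm /= normr0 max_r. Qed.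

Lemma pair_topdual_fst f g : `|f| <= `|pair_topdual f g|.
Proof.
apply: topdual_lub => // u; rewrite -(norm_inl u).
apply: le_trans (le_trans (ler_norm _) (topdual_le _ _)).
by rewrite pair_topdualE /= linear0 addr0.
Qed.

Lemma pair_topdual_snd f g : `|g| <= `|pair_topdual f g|.
Proof.
apply: topdual_lub => // u; rewrite -(norm_inr u).
apply: le_trans (le_trans (ler_norm _) (topdual_le _ _)).
by rewrite pair_topdualE /= linear0 add0r.
Qed.

Lemma pair_topdualB f f' g g' :
  pair_topdual f g - pair_topdual f' g' = pair_topdual (f - f') (g - g').
Proof.
by apply: topdualP => z; rewrite !(topdual_evalE, pair_topdualE); ring.
Qed.

Lemma pair_topdualZ (s : R) f g :
  s *: pair_topdual f g = pair_topdual (s *: f) (s *: g).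
Proof.
by apply: topdualP => z; rewrite !(topdual_evalE, pair_topdualE); ring.
Qed.

End PairTopdual.

(** * Multipliers at a minimizer of the coincidence gap *)

Section CoincidenceNormals.
Context (R : realType) (X Y : completeNormedModType R).
Context (O1 O2 : set (X * Y)) (w : (X * Y) * (X * Y)) (gamma : R).
Hypotheses (Ow1 : O1 w.1) (Ow2 : O2 w.2) (g0 : 0 < gamma) (g1 : gamma <= 1).
Hypothesis wmin : forall w', O1 w'.1 -> O2 w'.2 ->
  `|w.1.1 - w.2.1| <= `|w'.1.1 - w'.2.1| + gamma * `|w' - w|.
Hypothesis wne : w.1.1 != w.2.1.

Let nO1 : O1 !=set0. Proof. by exists w.1. Qed.
Let nO2 : O2 !=set0. Proof. by exists w.2. Qed.
Local Notation lip1 := (set_dist_lip nO1).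
Local Notation lip2 := (set_dist_lip nO2).
Local Notation p1 := (clarke_dir (set_dist O1) w.1).
Local Notation p2 := (clarke_dir (set_dist O2) w.2).
Local Notation dnorm := (clarke_dir (fun u : X => `|u|) (w.1.1 - w.2.1)).
Local Notation q c := (dnorm (c.1.1 - c.2.1) + gamma * `|c|).

(** Exact penalization of membership in [O1] and [O2]: after a step along [c] the sets are reached
    by displacements [a1] and [a2], which enter the gap with factor [1] and the perturbation with
    factor [gamma <= 1]. Hence the [2]. *)
Lemma coincidence_penalty (c : (X * Y) * (X * Y)) :
  0 <= 2 * (p1 c.1 + p2 c.2) + q c.
Proof.
(* Nine shares: one from the derivative of the norm and four from each of [a1], [a2], whose two
   errors are doubled. *)
apply/ler_addgt0Pr => e e0; have e10 : 0 < e / 9 by rewrite divr_gt0.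
have [d1 d10 H1] := clarke_le_dir lip1 w.1 c.1 e10.
have [d2 d20 H2] := clarke_le_dir lip2 w.2 c.2 e10.
have [d3 d30 H3] := clarke_le_dir (@norm_lip R X) (w.1.1 - w.2.1) (c.1.1 - c.2.1) e10.
pose t := Num.min d1 (Num.min d2 d3) / 2.
have m0 : 0 < Num.min d1 (Num.min d2 d3) by rewrite !lt_min d10 d20.
have t0 : 0 < t by rewrite divr_gt0.
have [td1 [td2 td3]] : t < d1 /\ t < d2 /\ t < d3.
  have : t < Num.min d1 (Num.min d2 d3) by rewrite ltr_pdivrMr// ltr_pMr// ltr1n.
  by rewrite !lt_min => /andP[-> /andP[-> ->]].
have := H1 w.1 t; rewrite subrr normr0 (set_dist0 nO1 Ow1) subr0 => /(_ d10 t0 td1) {}H1.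
have := H2 w.2 t; rewrite subrr normr0 (set_dist0 nO2 Ow2) subr0 => /(_ d20 t0 td2) {}H2.
have := H3 (w.1.1 - w.2.1) t; rewrite subrr normr0 => /(_ d30 t0 td3) {}H3.
have et : 0 < t * (e / 9) by rewrite mulr_gt0.
have [u1 Ou1 le1] := set_dist_near nO1 (w.1 + t *: c.1) et.
have [u2 Ou2 le2] := set_dist_near nO2 (w.2 + t *: c.2) et.
pose a1 := u1 - (w.1 + t *: c.1); pose a2 := u2 - (w.2 + t *: c.2).
have n1 : `|a1| <= t * (p1 c.1 + e / 9 + e / 9).
  rewrite distrC; apply: le_trans le1 _; rewrite [_ * t]mulrC in H1.
  by rewrite mulrDr lerD2r.
have n2 : `|a2| <= t * (p2 c.2 + e / 9 + e / 9).
  rewrite distrC; apply: le_trans le2 _; rewrite [_ * t]mulrC in H2.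
  by rewrite mulrDr lerD2r.
have := @wmin (u1, u2) Ou1 Ou2; cbn [fst snd] => le.
have dist_u : `|u1.1 - u2.1| <=
    `|w.1.1 - w.2.1 + t *: (c.1.1 - c.2.1)| + (`|a1| + `|a2|).
  have -> : u1.1 - u2.1 = (w.1.1 - w.2.1 + t *: (c.1.1 - c.2.1)) + (a1.1 - a2.1).
    by apply: eq_topdual => f; rewrite /a1 /a2 /= !topdualE; ring.
  apply: le_trans (ler_normD _ _) _; rewrite lerD2l.
  by apply: le_trans (ler_normB _ _) _; apply: lerD; exact: pair_norm_fst.
have dist_w : `|(u1, u2) - w| <= t * `|c| + (`|a1| + `|a2|).
  have -> : (u1, u2) - w = t *: c + (a1, a2).
    rewrite [RHS]surjective_pairing [LHS]surjective_pairing.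
    by congr pair; rewrite /a1 /a2 /=; apply: eq_topdual => f; rewrite !topdualE; ring.
  apply: le_trans (ler_normD _ _) _; rewrite normrZ gtr0_norm// lerD2l.
  by rewrite pair_norm ge_max /= lerDl lerDr !normr_ge0.
have gd := ler_wpM2l (ltW g0) dist_w.
have ga : gamma * (`|a1| + `|a2|) <= `|a1| + `|a2| by rewrite ler_piMl// addr_ge0.
rewrite -(ler_pM2l t0) mulr0.
move: le dist_u gd H3 n1 n2 ga; rewrite !mulrDr.
rewrite [_ * t]mulrDl [dnorm _ * t]mulrC [gamma * (t * _)]mulrCA [e / 9 * t]mulrC.
have -> : t * e = 9 * (t * (e / 9)) by field.
rewrite [t * (2 * p1 _)]mulrCA [t * (2 * p2 _)]mulrCA.
move: et; move: (t * (e / 9)) (t * p1 c.1) (t * p2 c.2) (t * dnorm _) (t * (gamma * _)).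
by move: (gamma * `|a1|) (gamma * `|a2|) (gamma * _); lra_atoms.
Qed.

(** [sandwich] gives [phi] between [- q] and [2 * (p1 + p2)]. The upper bound makes its two parts
    doubled Clarke subgradients; the lower bound, tested on the diagonal of [X], on the
    [Y]-directions and on minus the gap, gives the norm estimates. *)
Theorem coincidence_normals : exists (f1 f2 : topdual X) (h1 h2 : topdual Y),
  [/\ exists2 G, clarke_subdiff (set_dist O1) w.1 G & pair_topdual f1 h1 = 2 *: G,
      exists2 G, clarke_subdiff (set_dist O2) w.2 G & pair_topdual f2 h2 = 2 *: G,
      `|f1 + f2| <= gamma, `|h1| <= gamma /\ `|h2| <= gamma & 1 - gamma <= `|f1| ].
Proof.
have sp1 := clarke_dir_sublinear lip1 w.1.
have sp2 := clarke_dir_sublinear lip2 w.2.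
have sn := clarke_dir_sublinear (@norm_lip R X) (w.1.1 - w.2.1).
pose p (c : (X * Y) * (X * Y)) := 2 * (p1 c.1 + p2 c.2).
have sp : sublinear p.
  split=> [c d|t c t0]; rewrite /p /=.
    rewrite -mulrDr ler_pM2l// addrACA; apply: lerD; [exact: sp1.1|exact: sp2.1].
  by rewrite sp1.2// sp2.2//; ring.
pose Q : set (((X * Y) * (X * Y)) * R) := [set r | q r.1 <= r.2].
have cQ : convex_cone Q.
  split=> [|r s|t r t0]; rewrite /Q /=.
  - by rewrite subrr normr0 mulr0 addr0 (sublinear0 sn).
  - move=> qr qs; apply: le_trans (lerD qr qs).
    rewrite addrACA -mulrDr; apply: lerD; last by rewrite ler_pM2l// ler_normD.
    by apply: le_trans (sn.1 _ _); rewrite opprD addrACA.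
  - move=> qr; rewrite -(ler_pM2l t0) in qr; apply: le_trans qr.
    by rewrite -scalerBr sn.2 ?(ltW t0)// normrZ gtr0_norm// mulrDr mulrCA.
have pQ r : Q r -> 0 <= p r.1 + r.2.
  move=> qr; apply: le_trans (coincidence_penalty r.1) _.
  by rewrite /p lerD2l.
have [phi [phiD phiZ phip phiQ]] := sandwich sp cQ pQ.
have phi0 : phi 0 = 0 by rewrite -(scale0r 0) phiZ mul0r.
have phil c : - q c <= phi c by apply: (phiQ (c, q c)); rewrite /Q /=.
have part (i : X * Y -> (X * Y) * (X * Y)) (P : X * Y -> R) :
    (forall a b, i (a + b) = i a + i b) -> (forall t a, i (t *: a) = t *: i a) ->
    (forall a, phi (i a) <= 2 * P a) -> (forall a, P a <= `|a|) ->
    exists f h, (forall a, phi (i a) = pair_topdual f h a) /\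
      forall a, pair_topdual f h a <= 2 * P a.
  move=> iD iZ iP P1.
  have phii a : phi (i a) <= 2 * `|a|.
    by apply: le_trans (iP a) _; rewrite ler_pM2l.
  have [||//|a|F FE _] := @topdual_extend R (X * Y)%type (phi \o i) 2.
  - by move=> a b; rewrite /= iD phiD.
  - by move=> t a; rewrite /= iZ phiZ.
  - rewrite /= ler_norml phii andbT lerNl.
    have <- : phi (i (- a)) = - phi (i a) by rewrite -scaleN1r iZ phiZ mulN1r.
    by rewrite -[`|a|]normrN.
  have [f [h [Ffh _ _]]] := pair_topdualP F; exists f, h; rewrite -Ffh.
  by split=> a; rewrite FE //; exact: iP.
have p1n a : p1 a <= `|a| by apply: (clarke_dir_le lip1); exact: (clarke_le_norm lip1).
have p2n a : p2 a <= `|a| by apply: (clarke_dir_le lip2); exact: (clarke_le_norm lip2).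
have [|||//|f1 [h1 [phi1 fp1]]] := part (fun a => (a, 0)) p1.
- by move=> a b; rewrite [RHS]surjective_pairing /= addr0.
- by move=> t a; rewrite [RHS]surjective_pairing /= scaler0.
- by move=> a; apply: le_trans (phip _) _; rewrite /p /= (sublinear0 sp2) addr0.
have [|||//|f2 [h2 [phi2 fp2]]] := part (fun a => (0, a)) p2.
- by move=> a b; rewrite [RHS]surjective_pairing /= addr0.
- by move=> t a; rewrite [RHS]surjective_pairing /= scaler0.
- by move=> a; apply: le_trans (phip _) _; rewrite /p /= (sublinear0 sp1) add0r.
have phiE a b : phi (a, b) = pair_topdual f1 h1 a + pair_topdual f2 h2 b.
  rewrite -phi1 -phi2 -phiD; congr phi.
  by rewrite [RHS]surjective_pairing /= addr0 add0r.
have half (F : topdual (X * Y)%type) (P : X * Y -> R) (psi : X * Y -> R) z :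
    (forall a, F a <= 2 * P a) -> 
    (forall G, clarke_subdiff psi z G <-> forall v, G v <= P v) ->
    exists2 G, clarke_subdiff psi z G & F = 2 *: G.
  move=> FP H; exists (2^-1 *: F); last by rewrite scalerA mulfV ?scale1r.
  by apply/H => v; rewrite topdual_scaleE ler_pdivrMl.
exists f1, f2, h1, h2; split.
- exact: (half _ p1 _ _ fp1 (clarke_subdiff_dir lip1 w.1)).
- exact: (half _ p2 _ _ fp2 (clarke_subdiff_dir lip2 w.2)).
- have low u : - (gamma * `|u|) <= (f1 + f2) u.
    have := phil ((u, 0), (u, 0)); rewrite phiE !pair_topdualE; cbn [fst snd].
    rewrite subrr (sublinear0 sn) add0r (pair_norm ((u, 0), (u, 0))); cbn [fst snd].
    by rewrite !norm_inl maxxx !linear0 !addr0.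
  rewrite -normrN; apply: topdual_lub => [|u]; first exact: ltW.
  by rewrite topdual_oppE lerNl.
- split; rewrite -normrN; apply: topdual_lub => [|u]; rewrite ?(ltW g0)//;
    rewrite topdual_oppE lerNl.
    have := phil ((0, u), (0, 0)); rewrite phiE !pair_topdualE; cbn [fst snd].
    rewrite subrr (sublinear0 sn) add0r (pair_norm (_, (0, 0))); cbn [fst snd].
    by rewrite !norm_inr normr0 max_l// !linear0 !addr0 add0r.
  have := phil ((0, 0), (0, u)); rewrite phiE !pair_topdualE; cbn [fst snd].
  rewrite subrr (sublinear0 sn) add0r (pair_norm ((0, 0), _)); cbn [fst snd].
  by rewrite !norm_inr normr0 max_r// !linear0 !add0r.
- set x := w.1.1 - w.2.1 in sn phil *.
  have x0 : 0 < `|x| by rewrite normr_gt0 subr_eq0.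
  rewrite -(ler_pM2r x0); apply: le_trans (topdual_le f1 x).
  rewrite -[leRHS]normrN -topdualN; apply: le_trans (ler_norm _).
  have := phil ((- x, 0), (0, 0)); rewrite phiE !pair_topdualE; cbn [fst snd].
  rewrite subr0 (pair_norm (_, (0, 0))); cbn [fst snd].
  rewrite !norm_inl normr0 max_l// !linear0 !addr0 normrN; apply: le_trans.
  have := clarke_dir_le (@norm_lip R X) (norm_clarke_leN x).
  by rewrite mulrBl mul1r; move: (gamma * _) (clarke_dir _ _ _); lra_atoms.
Qed.

End CoincidenceNormals.

(** * The Clarke normal cone as a closure *)

Section ClarkeNormalCone.
Context (R : realType) (Z : normedModType R) (Omega : set Z) (z : Z).

Definition clarke_cone : set (topdual Z) :=
  [set G | exists l H, [/\ 0 < l, clarke_subdiff (set_dist Omega) z H & G = l *: H]].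

Lemma clarke_normalE : clarke_normal z Omega = closure (clarke_cone : set (weak_star_dual Z)).
Proof.
have E : \bigcup_(l in [set l : R | 0 < l])
    [set l *: f | f in clarke_subdiff (set_dist Omega) z] = clarke_cone.
  apply/seteqP; split=> G; first by move=> [l l0 [H dH <-]]; exists l, H.
  by move=> [l [H [l0 dH ->]]]; exists l => //; exists H.
by rewrite /clarke_normal E.
Qed.

Lemma clarke_normal_limit (F : set_system nat) (G_ : nat -> topdual Z) (G : topdual Z) :
  ProperFilter F -> (forall k, clarke_cone (G_ k)) ->
  (forall v, G_ k v @[k --> F] --> G v) -> clarke_normal z Omega G.
Proof.
move=> PF CG GG; rewrite clarke_normalE => B GB.
have cv : (G_ : nat -> weak_star_dual Z) @ F --> (G : weak_star_dual Z).
  by apply/cvg_initial/cvg_ptws.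
have FB : F [set k | B (G_ k)] := cv B GB.
by have [k Bk] := filter_ex FB; exists (G_ k).
Qed.

Lemma sub_clarke_normal G : clarke_cone G -> clarke_normal z Omega G.
Proof.
move=> CG; apply: (@clarke_normal_limit \oo (fun=> G)) => // v.
exact: cvg_cst.
Qed.

(** The multiplier of a combination is the combination [m] of the multipliers; dividing by it leaves
    an average of subgradients. *)
Lemma clarke_cone_convex : convex_set clarke_cone.
Proof.
apply/convex_setP => G G' t [l [H [l0 dH ->]]] [l' [H' [l'0 dH' ->]]] t0 t1.
have t1' : 0 <= 1 - t by rewrite subr_ge0.
pose m := t * l + (1 - t) * l'.
have m0 : 0 < m.
  rewrite lt_neqAle addr_ge0 ?mulr_ge0 ?(ltW l0) ?(ltW l'0)// andbT eq_sym.
  apply/negP => /eqP m0; have h1 : 0 <= t * l by rewrite mulr_ge0// ltW.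
  have h2 : 0 <= (1 - t) * l' by rewrite mulr_ge0// ltW.
  have /eqP : t * l = 0 by move: h1 h2 m0; rewrite /m; lra.
  rewrite mulf_eq0 (gt_eqF l0) orbF => /eqP t00.
  by move: m0; rewrite /m t00 mul0r add0r subr0 mul1r => /eqP; rewrite gt_eqF.
exists m, (m^-1 *: (t *: (l *: H) + (1 - t) *: (l' *: H'))); split=> //; last first.
  by rewrite [RHS]scalerA mulfV ?gt_eqF// scale1r.
apply/clarke_subdiffP => v c vc.
have hv := (clarke_subdiffP _ _ _).1 dH v c vc.
have hv' := (clarke_subdiffP _ _ _).1 dH' v c vc.
rewrite !topdual_evalE ler_pdivrMl// /m [leRHS]mulrDl -!mulrA.
by apply: lerD; rewrite ler_wpM2l// ler_wpM2l// ltW.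
Qed.

(** Weak^* and norm closure of a convex cone coincide here. Approximation in norm matters because
    the splitting is controlled by norm bounds. *)
Lemma clarke_normal_approx (G : topdual Z) (e : R) : reflexive_space Z ->
  clarke_normal z Omega G -> 0 < e -> exists2 H, clarke_cone H & `|G - H| <= e.
Proof.
move=> rZ; rewrite clarke_normalE => NG e0; apply: contrapT => nH.
have near v d : 0 < d -> exists2 H, clarke_cone H & `|G v - H v| <= d.
  move=> d0; have cv : (fun H : topdual Z => H) @ nbhs (G : weak_star_dual Z)
      --> (G : weak_star_dual Z) by move=> B.
  move: cv => /cvg_initial/cvg_ptws/(_ v)/cvgrPdist_le/(_ d d0) nG.
  by have [H [CH Hv]] := NG _ nG; exists H.
have [H0 CH0 _] := near 0 1 ltr01.
have [||phi _ phiC] := @convex_separation R _ clarke_cone G e clarke_cone_convex.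
- by exists H0.
- move=> H CH; rewrite leNgt; apply/negP => lt; apply: nH; exists H => //.
  exact: ltW.
have [v _ vphi] := rZ phi I.
have e20 : 0 < e / 2 by rewrite divr_gt0.
have [H CH le] := near v (e / 2) e20.
have := phiC _ CH; rewrite -vphi /=; clear vphi phiC.
by move: le e0; rewrite ler_norml => /andP[_]; move: (G v) (H v); lra_atoms.
Qed.

End ClarkeNormalCone.

Lemma cvg0_le (R : realType) (a b : nat -> R) : (forall k, `|a k| <= b k) ->
  b k @[k --> \oo] --> (0 : R) -> a k @[k --> \oo] --> (0 : R).
Proof.
move=> ab /cvgrPdist_le b0; apply/cvgrPdist_le => e e0.
apply: filterS (b0 e e0) => k /=; rewrite !sub0r !normrN => le.
exact: le_trans (ab k) (le_trans (ler_norm _) le).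
Qed.

Lemma cvg_natSinv (R : realType) (C : R) :
  C * k.+1%:R^-1 @[k --> \oo] --> (0 : R).
Proof. by rewrite -[X in _ --> X](mulr0 C); apply: cvgM; [exact: cvg_cst|exact: cvg_harmonic]. Qed.

(** Approximants within [k.+1%:R^-1] share the weak and norm limits of the given functionals, so
    PSCNC applies to them; reflexivity of [X] reduces weak convergence to values at points. *)
Lemma pscnc_closed_hull (R : realType) (X Y : normedModType R) (O : set (X * Y))
    (x : X) (y : Y) (w : nat -> X * Y) (f : nat -> topdual X) (h : nat -> topdual Y) :
  reflexive_space X -> pscnc_set O x y -> w k @[k --> \oo] --> (x, y) ->
  (forall k, O (w k)) ->
  (forall k e, 0 < e -> exists2 c, convex_hull (limiting_normal (w k) O) c &
    `|pair_topdual (f k) (h k) - c| <= e) ->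
  (forall u, f k u @[k --> \oo] --> (0 : R)) -> `|h k| @[k --> \oo] --> (0 : R) ->
  `|f k| @[k --> \oo] --> (0 : R).
Proof.
move=> rX psc wxy Ow app f0 h0.
have /choice[c cP] k : exists c : topdual X * topdual Y,
    convex_hull (limiting_normal (w k) O) (pair_topdual c.1 c.2) /\
    (`|f k - c.1| <= k.+1%:R^-1 /\ `|h k - c.2| <= k.+1%:R^-1).
  have [|c hc le] := app k k.+1%:R^-1; first by rewrite invr_gt0.
  have [c1 [c2 [cE _ _]]] := pair_topdualP c; exists (c1, c2).
  split; first by rewrite -cE.
  move: le; rewrite cE pair_topdualB => le.
  by split; apply: le_trans le; [exact: pair_topdual_fst|exact: pair_topdual_snd].
have f'0 : `|(c k).1| @[k --> \oo] --> (0 : R).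
  apply: (psc (fun k => (w k).1) (fun k => (w k).2) (fun k => (c k).1) (fun k => (c k).2)).
  - have -> : (fun k => ((w k).1, (w k).2)) = w; last exact: wxy.
    by apply/funext => k; rewrite -surjective_pairing.
  - by move=> k; rewrite -surjective_pairing.
  - by move=> k; rewrite -surjective_pairing; case: (cP k).
  - apply/weak_cvgP => Phi; have [u _ <-] := rX Phi I.
    rewrite /= ?topdual_zeroE.
    have bound : (`|f k u| + `|u| * k.+1%:R^-1) @[k --> \oo] --> (0 : R).
      rewrite -(addr0 (0 : R)); apply: cvgD; last exact: cvg_natSinv.
      by rewrite -(normr0 R); apply: cvg_norm; exact: f0.
    apply: cvg0_le bound => k; have [_ [le _]] := cP k.
    have -> : (c k).1 u = f k u - (f k - (c k).1) u by rewrite !topdual_evalE; ring.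
    apply: le_trans (ler_normB _ _) _; rewrite lerD2l.
    by apply: le_trans (topdual_le _ _) _; rewrite mulrC ler_wpM2l.
  - have bound : (`|h k| + 1 * k.+1%:R^-1) @[k --> \oo] --> (0 : R).
      by rewrite -(addr0 (0 : R)); apply: cvgD; last exact: cvg_natSinv.
    apply: cvg0_le bound => k; have [_ [_ le]] := cP k; rewrite normr_id mul1r.
    have := ler_normB (h k) (h k - (c k).2); rewrite subKr => /le_trans; apply.
    by rewrite lerD2l.
have bound : (`|(c k).1| + 1 * k.+1%:R^-1) @[k --> \oo] --> (0 : R).
  by rewrite -(addr0 (0 : R)); apply: cvgD; last exact: cvg_natSinv.
apply: cvg0_le bound => k; have [_ [le _]] := cP k; rewrite normr_id mul1r.
have := ler_normD (c k).1 (f k - (c k).1); rewrite addrC subrK => /le_trans; apply.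
by rewrite lerD2l.
Qed.

(** * The qualification condition along sequences *)

Section Qualification.
Context (R : realType) (X Y : completeNormedModType R).
Context (O1 O2 : set (X * Y)) (x : X) (y1 y2 : Y).
Hypotheses (rX : reflexive_space X) (rY : reflexive_space Y).
Hypotheses (cO1 : closed O1) (cO2 : closed O2).
Hypothesis psc : pscnc_set O1 x y1 \/ pscnc_set O2 x y2.
Hypothesis qual : forall f : topdual X,
  clarke_normal (x, y1) O1 (pair_topdual f 0) ->
  clarke_normal (x, y2) O2 (pair_topdual (- f) 0) -> f = 0.

Let rXY : reflexive_space (X * Y)%type. Proof. exact: reflexive_prod. Qed.

(** An ultralimit [f] of [f1] gives the normals [(f, 0)] and [(- f, 0)], so it vanishes and both
    sequences tend weakly to zero; PSCNC makes one of them converge in norm, and the sum transfers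
    this to [f1]. The last two hypotheses leave open why limits are normal: [metric_regularity] has
    moving base points and constant multiplier, [clarke_cone_bound] a fixed base point and arbitrary
    multipliers. *)
Lemma qualified_null (w1 w2 : nat -> X * Y) (f1 f2 : nat -> topdual X)
    (h1 h2 : nat -> topdual Y) (l1 l2 : nat -> R) (G1 G2 : nat -> topdual (X * Y)%type)
    (C : R) :
  w1 k @[k --> \oo] --> (x, y1) -> w2 k @[k --> \oo] --> (x, y2) ->
  (forall k, [/\ O1 (w1 k), 0 <= l1 k, clarke_subdiff (set_dist O1) (w1 k) (G1 k) &
    pair_topdual (f1 k) (h1 k) = l1 k *: G1 k]) ->
  (forall k, [/\ O2 (w2 k), 0 <= l2 k, clarke_subdiff (set_dist O2) (w2 k) (G2 k) &
    pair_topdual (f2 k) (h2 k) = l2 k *: G2 k]) ->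
  `|h1 k| @[k --> \oo] --> (0 : R) -> `|h2 k| @[k --> \oo] --> (0 : R) ->
  `|f1 k + f2 k| @[k --> \oo] --> (0 : R) -> (forall k, `|f1 k| <= C) ->
  (forall U f, UltraFilter U -> \oo `<=` U ->
    (forall v, pair_topdual (f1 k) (h1 k) v @[k --> U] --> pair_topdual f 0 v) ->
    clarke_normal (x, y1) O1 (pair_topdual f 0)) ->
  (forall U f, UltraFilter U -> \oo `<=` U ->
    (forall v, pair_topdual (f2 k) (h2 k) v @[k --> U] --> pair_topdual f 0 v) ->
    clarke_normal (x, y2) O2 (pair_topdual f 0)) ->
  `|f1 k| @[k --> \oo] --> (0 : R).
Proof.
move=> w1x w2x P1 P2 h10 h20 f120 f1C lim1 lim2.
have ev0 (V : normedModType R) (g : nat -> topdual V) v :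
    `|g k| @[k --> \oo] --> (0 : R) -> g k v @[k --> \oo] --> (0 : R).
  move=> g0; have bound : `|g k| * `|v| @[k --> \oo] --> (0 : R).
    by rewrite -(mul0r `|v|); apply: cvgM => //; exact: cvg_cst.
  by apply: cvg0_le bound => k; exact: topdual_le.
have f1w u : f1 k u @[k --> \oo] --> (0 : R).
  apply: cvg_ultra => U UU ooU.
  have [f _ fU] := dual_ultralimit UU f1C.
  have toU (a : nat -> R) (l : R) : a k @[k --> \oo] --> l -> a k @[k --> U] --> l.
    by move=> al A lA; apply: ooU; exact: al.
  suff f0 : f = 0 by have := fU u; rewrite f0 topdual_zeroE.
  apply: qual.
    apply: (lim1 U f UU ooU) => v; rewrite pair_topdualE topdual_zeroE.
    by apply: cvgD; [exact: fU|apply: toU; exact: ev0].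
  apply: (lim2 U (- f) UU ooU) => v; rewrite pair_topdualE topdual_zeroE.
  apply: cvgD; last by apply: toU; exact: ev0.
  rewrite (_ : (fun k => f2 k v.1) = (fun k => (f1 k + f2 k) v.1 - f1 k v.1)).
    rewrite topdual_oppE -[- f _]add0r; apply: cvgB; last exact: fU.
    by apply: toU; exact: ev0.
  by apply/funext => k; rewrite topdual_addE addrC addKr.
have f2w u : f2 k u @[k --> \oo] --> (0 : R).
  rewrite (_ : (fun k => f2 k u) = (fun k => (f1 k + f2 k) u - f1 k u)).
    by rewrite -(subrr (0 : R)); apply: cvgB => //; exact: ev0.
  by apply/funext => k; rewrite topdual_addE addrC addKr.
case: psc => ps.
  apply: (pscnc_closed_hull rX ps w1x _ _ f1w h10) => [k|k e e0].
    by case: (P1 k).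
  by have [Ow l0 dG ->] := P1 k; exact: clarke_subdiff_approx.
have f20 : `|f2 k| @[k --> \oo] --> (0 : R).
  apply: (pscnc_closed_hull rX ps w2x _ _ f2w h20) => [k|k e e0].
    by case: (P2 k).
  by have [Ow l0 dG ->] := P2 k; exact: clarke_subdiff_approx.
have bound : (`|f1 k + f2 k| + `|f2 k|) @[k --> \oo] --> (0 : R).
  by rewrite -(addr0 (0 : R)); apply: cvgD.
apply: cvg0_le bound => k; rewrite normr_id.
by have := ler_normB (f1 k + f2 k) (f2 k); rewrite addrK.
Qed.

End Qualification.

Section MetricRegularity.
Context (R : realType) (X Y : completeNormedModType R).
Context (O1 O2 : set (X * Y)) (x : X) (y1 y2 : Y).
Hypotheses (rX : reflexive_space X) (rY : reflexive_space Y).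
Hypotheses (cO1 : closed O1) (cO2 : closed O2).
Hypotheses (O1x : O1 (x, y1)) (O2x : O2 (x, y2)).
Hypothesis psc : pscnc_set O1 x y1 \/ pscnc_set O2 x y2.
Hypothesis qual : forall f : topdual X,
  clarke_normal (x, y1) O1 (pair_topdual f 0) ->
  clarke_normal (x, y2) O2 (pair_topdual (- f) 0) -> f = 0.

Let nO1 : O1 !=set0. Proof. by exists (x, y1). Qed.
Let nO2 : O2 !=set0. Proof. by exists (x, y2). Qed.

Lemma not_vanishing (a : nat -> R) :
  (forall k, 1 - k.+1%:R^-1 <= a k) -> ~ (a k @[k --> \oo] --> (0 : R)).
Proof.
move=> ale /cvgrPdist_le/(_ 4^-1) [|M _ HM]; first by rewrite invr_gt0.
(* At index [0] the lower bound is only [0], so an index of at least [1] is taken. *)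
have := HM (maxn M 1) (leq_maxl _ _); rewrite /= sub0r normrN.
have k2 : (maxn M 1).+1%:R^-1 <= 2^-1 :> R.
  by rewrite lef_pV2 ?posrE// ler_nat ltnS leq_maxr.
move: (ale (maxn M 1)) k2 (ler_norm (a (maxn M 1))).
by move: (_.+1%:R^-1) (a _); lra_atoms.
Qed.

(* Ekeland's principle turns a failure of regularity into a sequence of
   non-coincident minimizers whose normals contradict the qualification. *)
Theorem metric_regularity : exists kappa r, [/\ 0 < kappa, 0 < r &
  forall w1 w2, O1 w1 -> O2 w2 -> `|w1 - (x, y1)| < r -> `|w2 - (x, y2)| < r ->
    exists u b1 b2, [/\ O1 (u, b1), O2 (u, b2),
      `|(u, b1) - w1| <= kappa * `|w1.1 - w2.1| &
      `|(u, b2) - w2| <= kappa * `|w1.1 - w2.1| ]].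
Proof.
apply: contrapT => nreg.
pose A : set ((X * Y) * (X * Y)) := [set w | O1 w.1 /\ O2 w.2].
have cA : closed A.
  apply: closedI.
    by apply: (@preimage_closed _ _ fst O1) => // w _; exact: cvg_fst.
  by apply: (@preimage_closed _ _ snd O2) => // w _; exact: cvg_snd.
pose z0 : (X * Y) * (X * Y) := ((x, y1), (x, y2)).
have wex (k : nat) : exists w : (X * Y) * (X * Y), [/\ O1 w.1, O2 w.2,
    `|w - z0| <= 3 * k.+1%:R^-1, w.1.1 != w.2.1 &
    forall w', O1 w'.1 -> O2 w'.2 ->
      `|w.1.1 - w.2.1| <= `|w'.1.1 - w'.2.1| + k.+1%:R^-1 * `|w' - w| ].
  pose g : R := k.+1%:R^-1; have g0 : 0 < g by rewrite invr_gt0.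
  have gk : k.+1%:R * g = 1 by rewrite mulfV// pnatr_eq0.
  have g1 : g <= 1 by rewrite invf_le1// ler1n.
  have gg0 : 0 < g * g by rewrite mulr_gt0.
  (* With radius [g * g] the initial gap is at most [2 * (g * g)], so the Ekeland point is within
     [2 * g] of the start and within [3 * g] of [z0]. *)
  apply: contrapT => nw; apply: nreg; exists k.+1%:R, (g * g); split=> //.
  move=> w1 w2 Ow1 Ow2 w1x w2x; apply: contrapT => nc; apply: nw.
  pose phi (w : (X * Y) * (X * Y)) := `|w.1.1 - w.2.1|.
  have philip u v : phi u <= phi v + 2 * `|u - v|.
    have := norm_lip (u.1.1 - u.2.1) (v.1.1 - v.2.1).
    have -> : u.1.1 - u.2.1 - (v.1.1 - v.2.1) = (u - v).1.1 - (u - v).2.1.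
      by apply: eq_topdual => f; rewrite /= !topdualE; ring.
    move=> /le_trans; apply; rewrite lerD2l; apply: le_trans (ler_normB _ _) _.
    have -> : 2 * `|u - v| = `|u - v| + `|u - v| by ring.
    apply: lerD; apply: le_trans (pair_norm_fst _) _.
      exact: pair_norm_fst.
    exact: pair_norm_snd.
  have [|w [[Aw1 Aw2] wd wm]] := @ekeland R _ A phi 2 g (w1, w2) cA _ philip (conj Ow1 Ow2) g0.
    by move=> u _; exact: normr_ge0.
  have rho : phi (w1, w2) <= 2 * (g * g).
    rewrite /phi /=; apply: le_trans (ler_distD x _ _) _.
    have := le_lt_trans (pair_norm_fst _) w1x; have := le_lt_trans (pair_norm_fst _) w2x.
    by rewrite /= [`|w2.1 - x|]distrC; move: (g * g); lra_atoms.
  have wd' : `|w - (w1, w2)| <= k.+1%:R * phi (w1, w2).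
    rewrite -(ler_pM2l g0) [leRHS]mulrA [g * k.+1%:R]mulrC gk mul1r.
    apply: le_trans wd _.
    by rewrite gerBl; exact: normr_ge0.
  exists w; split=> //.
  - have w0z : `|(w1, w2) - z0| <= g * g.
      by rewrite pair_norm ge_max /= !ltW.
    apply: le_trans (ler_distD (w1, w2) _ _) _.
    have h : k.+1%:R * phi (w1, w2) <= k.+1%:R * (2 * (g * g)) by rewrite ler_pM2l.
    have e1 : k.+1%:R * (2 * (g * g)) = 2 * g.
      by rewrite mulrCA [_ * (g * g)]mulrA gk mul1r.
    have gg : g * g <= g by rewrite ler_piMl// ltW.
    rewrite e1 in h; rewrite -/g; move: (le_trans wd' h) w0z gg.
    by move: (g * g); lra_atoms.
  (* A coincident Ekeland point would be the pair that regularity asks for. *)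
  - apply/negP => /eqP E; apply: nc; exists w.1.1, w.1.2, w.2.2.
    have wE1 : (w.1.1, w.1.2) = w.1 by rewrite -surjective_pairing.
    have wE2 : (w.1.1, w.2.2) = w.2 by rewrite E -surjective_pairing.
    rewrite wE1 wE2; split=> //.
      by apply: le_trans (pair_norm_fst (w - (w1, w2))) wd'.
    by apply: le_trans (pair_norm_snd (w - (w1, w2))) wd'.
  - by move=> w' Ow1' Ow2'; exact: (wm w' (conj Ow1' Ow2')).
have [w wP] := choice wex.
have inv0 (n : nat) : 0 < n.+1%:R^-1 :> R by rewrite invr_gt0.
have inv1 (n : nat) : n.+1%:R^-1 <= 1 :> R by rewrite invf_le1// ler1n.
have /choice[F FP] k : exists F : (topdual X * topdual X) * (topdual Y * topdual Y) *
      (topdual (X * Y)%type * topdual (X * Y)%type),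
    [/\ clarke_subdiff (set_dist O1) (w k).1 F.2.1 /\
        pair_topdual F.1.1.1 F.1.2.1 = 2 *: F.2.1,
      clarke_subdiff (set_dist O2) (w k).2 F.2.2 /\
        pair_topdual F.1.1.2 F.1.2.2 = 2 *: F.2.2,
      `|F.1.1.1 + F.1.1.2| <= k.+1%:R^-1,
      `|F.1.2.1| <= k.+1%:R^-1 /\ `|F.1.2.2| <= k.+1%:R^-1 &
      1 - k.+1%:R^-1 <= `|F.1.1.1| ].
  have [Ow1 Ow2 _ wne wm] := wP k.
  have [f1 [f2 [h1 [h2 [[G1 dG1 E1] [G2 dG2 E2] f12 h12 f1n]]]]] :=
    coincidence_normals Ow1 Ow2 (inv0 k) (inv1 k) wm wne.
  by exists ((f1, f2), (h1, h2), (G1, G2)).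
have wz : w k @[k --> \oo] --> z0.
  apply/cvgrPdist_le => e e0.
  have /cvgrPdist_le/(_ e e0) := @cvg_natSinv R 3.
  apply: filterS => k /=; rewrite sub0r normrN distrC => le.
  by have [_ _ d _ _] := wP k; apply: le_trans d (le_trans (ler_norm _) le).
have wz1 : (w k).1 @[k --> \oo] --> (x, y1).
  by apply: (cvg_comp _ _ wz); exact: cvg_fst.
have wz2 : (w k).2 @[k --> \oo] --> (x, y2).
  by apply: (cvg_comp _ _ wz); exact: cvg_snd.
have to0 (a : nat -> R) : (forall k, `|a k| <= k.+1%:R^-1) -> a k @[k --> \oo] --> (0 : R).
  by move=> ak; apply: cvg0_le ak _; exact: cvg_harmonic.
(* The multiplier being constant, it suffices that the subdifferential is closed under moving base
   points. *)
have lim (O : set (X * Y)) (z : X * Y) (v : nat -> X * Y) (U : set_system nat)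
    (G_ : nat -> topdual (X * Y)%type) (F_ : nat -> topdual (X * Y)%type) (H : topdual (X * Y)%type) :
    O !=set0 -> UltraFilter U -> \oo `<=` U -> v k @[k --> \oo] --> z ->
    (forall k, clarke_subdiff (set_dist O) (v k) (G_ k) /\ F_ k = 2 *: G_ k) ->
    (forall u, F_ k u @[k --> U] --> H u) -> clarke_normal z O H.
  move=> nO UU ooU vz GF FF; apply: sub_clarke_normal.
  exists 2, (2^-1 *: H); split=> //; last by rewrite scalerA mulfV ?scale1r.
  apply: (@clarke_subdiff_cvg R _ _ U v G_) => //.
  - move=> d d0; apply: ooU.
    have /cvgrPdist_lt/(_ d d0) := vz; apply: filterS => k /=.
    by rewrite distrC.
  - by move=> k; case: (GF k).
  - move=> u; rewrite (_ : (fun k => G_ k u) = (fun k => 2^-1 * F_ k u)).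
      by rewrite topdual_scaleE; apply: cvgM => //; exact: cvg_cst.
    apply/funext => k; have [_ ->] := GF k.
    by rewrite topdual_scaleE mulrA mulVf// mul1r.
apply: (@not_vanishing (fun k => `|(F k).1.1.1|)); first by move=> k; case: (FP k).
apply: (@qualified_null R X Y O1 O2 x y1 y2 rX rY cO1 cO2 psc qual
  (fun k => (w k).1) (fun k => (w k).2) _ (fun k => (F k).1.1.2)
  (fun k => (F k).1.2.1) (fun k => (F k).1.2.2) (fun=> 2) (fun=> 2)
  (fun k => (F k).2.1) (fun k => (F k).2.2) 2) => //.
- by move=> k; have [[dG ->] _ _ _ _] := FP k; have [? _ _ _ _] := wP k.
- by move=> k; have [_ [dG ->] _ _ _] := FP k; have [_ ? _ _ _] := wP k.
- by apply: to0 => k; rewrite normr_id; have [_ _ _ [? _] _] := FP k.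
- by apply: to0 => k; rewrite normr_id; have [_ _ _ [_ ?] _] := FP k.
- by apply: to0 => k; rewrite normr_id; have [_ _ ? _ _] := FP k.
- move=> k; have [[dG E] _ _ _ _] := FP k.
  apply: le_trans (pair_topdual_fst _ (F k).1.2.1) _; rewrite E normrZ gtr0_norm//.
  by rewrite ger_pMr//; exact: (clarke_subdiff_norm (set_dist_lip nO1) dG).
- move=> U f UU ooU; apply: (lim O1 _ _ U (fun k => (F k).2.1) _ _ nO1 UU ooU wz1).
  by move=> k; case: (FP k).
- move=> U f UU ooU; apply: (lim O2 _ _ U (fun k => (F k).2.2) _ _ nO2 UU ooU wz2).
  by move=> k; case: (FP k).
Qed.

End MetricRegularity.

(** * The sum rule *)

Section SumRule.
Context (R : realType) (X Y : completeNormedModType R).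
Context (F1 F2 : X -> set Y) (x : X) (y y1 y2 : Y).
Hypotheses (rX : reflexive_space X) (rY : reflexive_space Y).
Hypotheses (cF1 : closed (gph F1)) (cF2 : closed (gph F2)).
Hypothesis hy : sum_decomposition F1 F2 (x, y) (y1, y2).
Hypothesis hS : inner_semicontinuous (sum_decomposition F1 F2) (x, y) (y1, y2).
Hypothesis psc : pscnc F1 x y1 \/ pscnc F2 x y2.
Hypothesis qual : forall f : topdual X,
  clarke_normal (x, y1) (gph F1) (pair_topdual f 0) ->
  clarke_normal (x, y2) (gph F2) (pair_topdual (- f) 0) -> f = 0.

Local Notation O1 := (gph F1).
Local Notation O2 := (gph F2).
Local Notation O := (gph (sum_mapping F1 F2)).

Lemma sum_mapping_mem u b1 b2 : O1 (u, b1) -> O2 (u, b2) -> O (u, b1 + b2).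
Proof. by move=> ? ?; exists b1 => //; exists b2. Qed.

Let O1x : O1 (x, y1). Proof. by case: hy. Qed.
Let O2x : O2 (x, y2). Proof. by case: hy. Qed.
Let nO1 : O1 !=set0. Proof. by exists (x, y1). Qed.
Let nO2 : O2 !=set0. Proof. by exists (x, y2). Qed.
Let Ox : O (x, y).
Proof. by have [h1 h2 /= <-] := hy; exact: sum_mapping_mem. Qed.
Let nO : O !=set0. Proof. by exists (x, y). Qed.

Lemma increasing_ge_id (phi : nat -> nat) : increasing_seq phi -> forall j, (j <= phi j)%N.
Proof.
move=> iphi; elim=> // j IH; apply: leq_ltn_trans IH _.
by rewrite ltnNge; apply/negP => le; have := iphi j.+1 j; rewrite leEnat le ltnn.
Qed.

(** Inner semicontinuity controls only a subsequence of decompositions, so a single late index is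
    extracted. *)
Lemma decomposition_sequence (w : nat -> X * Y) :
  w k @[k --> \oo] --> (x, y) -> (forall k, O (w k)) -> forall (d : R) M, 0 < d ->
  exists k p q, [/\ (M <= k)%N, O1 ((w k).1, p), O2 ((w k).1, q) /\ p + q = (w k).2,
    `|((w k).1, p) - (x, y1)| < d & `|((w k).1, q) - (x, y2)| < d].
Proof.
move=> wxy Ow d M d0.
have [|v [vS [phi [iphi vphi]]]] := hS wxy.
  by move=> k; have [p Fp [q Fq E]] := Ow k; exists (p, q).
have /cvgrPdist_lt/(_ d d0) [N1 _ H1] := wxy.
have /cvgrPdist_lt/(_ d d0) [N2 _ H2] := vphi.
pose j := maxn M (maxn N1 N2).
have jphi := increasing_ge_id iphi j.
have := H1 (phi j); rewrite /= distrC => /(_ (leq_trans _ jphi)) h1.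
have {}h1 : `|w (phi j) - (x, y)| < d by apply: h1; rewrite /j !leq_max leqnn orbT.
have h2 : `|v (phi j) - (y1, y2)| < d.
  by rewrite distrC; apply: (H2 j); rewrite /= /j !leq_max leqnn !orbT.
have [S1 S2 S3] := vS (phi j).
exists (phi j), (v (phi j)).1, (v (phi j)).2; split=> //.
- by apply: leq_trans jphi; exact: leq_maxl.
- rewrite pair_norm gt_max /=; apply/andP; split.
    exact: le_lt_trans (pair_norm_fst (w (phi j) - (x, y))) h1.
  exact: le_lt_trans (pair_norm_fst (v (phi j) - (y1, y2))) h2.
- rewrite pair_norm gt_max /=; apply/andP; split.
    exact: le_lt_trans (pair_norm_fst (w (phi j) - (x, y))) h1.
  exact: le_lt_trans (pair_norm_snd (v (phi j) - (y1, y2))) h2.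
Qed.

(** The first coordinates of [w1] and [w2] differ by at most [s1 + s2]; regularity moves both points
    by [kappa * (s1 + s2)] to a common first coordinate, where second coordinates may be added. *)
Lemma sum_dist_le kappa (a1 a2 w1 w2 : X * Y) (s1 s2 : R) (u : X) b1 b2 :
  0 < kappa -> a1.1 = a2.1 -> `|a1 - w1| <= s1 -> `|a2 - w2| <= s2 ->
  O1 (u, b1) -> O2 (u, b2) ->
  `|(u, b1) - w1| <= kappa * `|w1.1 - w2.1| ->
  `|(u, b2) - w2| <= kappa * `|w1.1 - w2.1| ->
  set_dist O (a1.1, a1.2 + a2.2) <= (1 + 2 * kappa) * (s1 + s2).
Proof.
move=> k0 a12 aw1 aw2 Ou1 Ou2 d1 d2.
have rho : `|w1.1 - w2.1| <= s1 + s2.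
  have -> : w1.1 - w2.1 = (a2 - w2).1 - (a1 - w1).1.
    by rewrite /= a12; apply: eq_topdual => f; rewrite !topdualE; ring.
  apply: le_trans (ler_normB _ _) _; rewrite addrC.
  by apply: lerD; [apply: le_trans aw1|apply: le_trans aw2]; exact: pair_norm_fst.
have krho := ler_wpM2l (ltW k0) rho.
have s10 : 0 <= s1 by exact: le_trans aw1.
have s20 : 0 <= s2 by exact: le_trans aw2.
have ks : 0 <= kappa * (s1 + s2) by rewrite mulr_ge0 ?addr_ge0// ltW.
have e1 : `|a1 - (u, b1)| <= s1 + kappa * (s1 + s2).
  apply: le_trans (ler_distD w1 _ _) _; rewrite [`|w1 - _|]distrC.
  by apply: lerD => //; exact: le_trans krho.
have e2 : `|a2 - (u, b2)| <= s2 + kappa * (s1 + s2).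
  apply: le_trans (ler_distD w2 _ _) _; rewrite [`|w2 - _|]distrC.
  by apply: lerD => //; exact: le_trans krho.
apply: le_trans (set_dist_le nO _ (sum_mapping_mem Ou1 Ou2)) _.
have -> : (1 + 2 * kappa) * (s1 + s2) =
  (s1 + kappa * (s1 + s2)) + (s2 + kappa * (s1 + s2)) by ring.
rewrite pair_norm ge_max /=; apply/andP; split.
  apply: le_trans (pair_norm_fst (a1 - (u, b1))) _; apply: le_trans e1 _.
  by rewrite lerDl addr_ge0.
have -> : a1.2 + a2.2 - (b1 + b2) = (a1 - (u, b1)).2 + (a2 - (u, b2)).2.
  by rewrite /= opprD addrACA.
apply: le_trans (ler_normD _ _) _; apply: lerD.
  by apply: le_trans e1; exact: pair_norm_snd.
by apply: le_trans e2; exact: pair_norm_snd.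
Qed.

Theorem sum_clarke_le : exists2 C : R, 0 < C & forall u v1 v2 c1 c2,
  clarke_le (set_dist O1) (x, y1) (u, v1) c1 ->
  clarke_le (set_dist O2) (x, y2) (u, v2) c2 ->
  clarke_le (set_dist O) (x, y) (u, v1 + v2) (C * (c1 + c2)).
Proof.
have [kappa [r [k0 r0 reg]]] := metric_regularity rX rY cF1 cF2 O1x O2x psc qual.
pose C := 1 + 2 * kappa; have C0 : 0 < C by rewrite /C; lra.
exists C => // u v1 v2 c1 c2 le1 le2.
(* By contradiction, since inner semicontinuity speaks of sequences: offending base points and steps
   are chosen for every [k]. *)
apply: set_dist_clarke_le => // e e0; apply: contrapT => nd.
(* The error [e'] occurs twice in each of the two distance estimates, whose sum is multiplied by
   [C]. *)
pose e' := e / (4 * C); have e'0 : 0 < e' by rewrite divr_gt0// mulr_gt0.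
have e'C : 4 * (C * e') = e by rewrite /e'; field; rewrite gt_eqF.
have [d1 d10 H1] := le1 e' e'0; have [d2 d20 H2] := le2 e' e'0.
have wtex (k : nat) : exists wt : (X * Y) * R, [/\ O wt.1,
    `|wt.1 - (x, y)| <= k.+1%:R^-1, 0 < wt.2, wt.2 <= k.+1%:R^-1 &
    (C * (c1 + c2) + e) * wt.2 < set_dist O (wt.1 + wt.2 *: (u, v1 + v2))].
  apply: contrapT => nk; apply: nd; exists k.+1%:R^-1; first by rewrite invr_gt0.
  move=> w t Ow wd t0 td; rewrite leNgt; apply/negP => lt; apply: nk.
  by exists (w, t); split=> //; exact: ltW.
have [wt wtP] := choice wtex.
have wxy : (wt k).1 @[k --> \oo] --> (x, y).
  apply/cvgrPdist_le => e1 e10; near=> k; rewrite distrC.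
  have [_ le _ _ _] := wtP k; apply: le_trans le _; apply: ltW.
  by near: k; exact: (near_infty_natSinv_lt (PosNum e10)).
(* [t * L] dominates the way from the decomposed base points to [w1] and [w2], so [t < r / 2 / L]
   keeps these in the ball of regularity. *)
pose L := `|c1| + `|c2| + 2 * e' + `|(u, v1)| + `|(u, v2)| + 1.
have L0 : 0 < L by rewrite ltr_wpDl ?addr_ge0// mulr_ge0 ?(ltW e'0).
pose d := Num.min (Num.min d1 d2) (r / 2 / L).
have d0 : 0 < d by rewrite !lt_min d10 d20 !divr_gt0.
have [M _ HM] := near_infty_natSinv_lt (PosNum d0).
have r20 : 0 < r / 2 by rewrite divr_gt0.
have dd0 : 0 < Num.min (Num.min d1 d2) (r / 2) by rewrite !lt_min d10 d20 r20.
have [k [p [q [Mk Op [Oq pq] pd qd]]]] :=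
  decomposition_sequence wxy (fun k => let: And5 a _ _ _ _ := wtP k in a) M dd0.
have [_ _ t0 tk far] := wtP k.
set w := (wt k).1 in Op Oq pq pd qd far; set t := (wt k).2 in t0 tk far.
have td : t < d by apply: le_lt_trans tk _; exact: (HM k Mk).
move: td; rewrite !lt_min => /andP[/andP[td1 td2] tL].
move: pd qd; rewrite !lt_min => /andP[/andP[pd1 _] pr] /andP[/andP[_ qd2] qr].
have := H1 _ _ pd1 t0 td1; rewrite (set_dist0 nO1 Op) subr0 => {}H1.
have := H2 _ _ qd2 t0 td2; rewrite (set_dist0 nO2 Oq) subr0 => {}H2.
have et : 0 < t * e' by rewrite mulr_gt0.
have [w1 Ow1 n1] := set_dist_near nO1 ((w.1, p) + t *: (u, v1)) et.
have [w2 Ow2 n2] := set_dist_near nO2 ((w.1, q) + t *: (u, v2)) et.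
have s1 : `|(w.1, p) + t *: (u, v1) - w1| <= (c1 + 2 * e') * t.
  apply: le_trans n1 _; have -> : (c1 + 2 * e') * t = (c1 + e') * t + t * e' by ring.
  by rewrite lerD2r.
have s2 : `|(w.1, q) + t *: (u, v2) - w2| <= (c2 + 2 * e') * t.
  apply: le_trans n2 _; have -> : (c2 + 2 * e') * t = (c2 + e') * t + t * e' by ring.
  by rewrite lerD2r.
have tL' : t * L < r / 2 by rewrite -ltr_pdivlMr.
have close (c : R) (b z w' v : X * Y) : (c + 2 * e') * t + t * `|v| <= t * L ->
    `|b - z| < r / 2 -> `|b + t *: v - w'| <= (c + 2 * e') * t -> `|w' - z| < r.
  move=> cL bz le.
  have -> : w' - z = (b - z) + (t *: v - (b + t *: v - w')).
    by apply: eq_topdual => f; rewrite !topdualE; ring.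
  apply: le_lt_trans (ler_normD _ _) _.
  have : `|t *: v - (b + t *: v - w')| <= t * `|v| + (c + 2 * e') * t.
    apply: le_trans (ler_normB _ _) _; rewrite normrZ gtr0_norm//.
    by rewrite lerD2l.
  by move: cL bz tL'; move: (t * L) (t * _) (_ * t); lra_atoms.
have w1r : `|w1 - (x, y1)| < r.
  apply: close pr s1; rewrite [_ * t]mulrC -mulrDr ler_pM2l// /L.
  have := ler_norm c1; have := normr_ge0 c2; have := normr_ge0 (u, v2).
  lra_atoms.
have w2r : `|w2 - (x, y2)| < r.
  apply: close qr s2; rewrite [_ * t]mulrC -mulrDr ler_pM2l// /L.
  have := ler_norm c2; have := normr_ge0 c1; have := normr_ge0 (u, v1).
  lra_atoms.
have [u' [b1 [b2 [Ob1 Ob2 k1 k2]]]] := reg _ _ Ow1 Ow2 w1r w2r.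
have := @sum_dist_le kappa ((w.1, p) + t *: (u, v1)) ((w.1, q) + t *: (u, v2)) w1 w2
  _ _ u' b1 b2 k0 erefl s1 s2 Ob1 Ob2 k1 k2.
have -> : (((w.1, p) + t *: (u, v1)).1,
    ((w.1, p) + t *: (u, v1)).2 + ((w.1, q) + t *: (u, v2)).2) =
    w + t *: (u, v1 + v2).
  rewrite [RHS]surjective_pairing; congr pair => //=.
  by rewrite addrACA -scalerDr pq.
move=> /(lt_le_trans far); rewrite -/C.
have -> : C * ((c1 + 2 * e') * t + (c2 + 2 * e') * t) =
   (C * (c1 + c2) + 4 * (C * e')) * t by ring.
by rewrite e'C ltxx.
Unshelve. all: by end_near. Qed.

(** [sandwich] puts [G] between [C * p1] and the supremum over [v2] of
    [f u + h v1 + h v2 - C * p2 (u, v2)]. The choice [u = 0], [v2 = 0] identifies the second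
    component of [G] with [h], and [v1 = 0] bounds the remainder by [C * p2]. *)
Lemma sum_subdiff_split (C : R) (f : topdual X) (h : topdual Y) : 0 < C ->
  (forall u v1 v2 c1 c2,
    clarke_le (set_dist O1) (x, y1) (u, v1) c1 ->
    clarke_le (set_dist O2) (x, y2) (u, v2) c2 ->
    clarke_le (set_dist O) (x, y) (u, v1 + v2) (C * (c1 + c2))) ->
  clarke_subdiff (set_dist O) (x, y) (pair_topdual f h) ->
  exists f1 f2, [/\ f = f1 + f2,
    clarke_cone O1 (x, y1) (pair_topdual f1 h) &
    clarke_cone O2 (x, y2) (pair_topdual f2 h)].
Proof.
move=> C0 CH /clarke_subdiffP df.
pose p1 := clarke_dir (set_dist O1) (x, y1).
pose p2 := clarke_dir (set_dist O2) (x, y2).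
have sp1 : sublinear p1 := clarke_dir_sublinear (set_dist_lip nO1) (x, y1).
have sp2 : sublinear p2 := clarke_dir_sublinear (set_dist_lip nO2) (x, y2).
have dle u v1 v2 : f u + h v1 + h v2 <= C * (p1 (u, v1) + p2 (u, v2)).
  have := df _ _ (CH u v1 v2 _ _ (clarke_le_dir (set_dist_lip nO1) (x, y1) (u, v1))
    (clarke_le_dir (set_dist_lip nO2) (x, y2) (u, v2))).
  by rewrite pair_topdualE /= topdualD addrA.
have p1E : p1 = clarke_dir (set_dist O1) (x, y1) by [].
have p2E : p2 = clarke_dir (set_dist O2) (x, y2) by [].
clearbody p1 p2; pose p a := C * p1 a.
have sp : sublinear p.
  split=> [a b|t a t0]; first by rewrite -mulrDr ler_pM2l//; exact: sp1.1.
  by rewrite /p sp1.2// mulrCA.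
pose Q : set ((X * Y) * R) := [set r | exists v2,
  C * p2 (r.1.1, v2) - (f r.1.1 + h r.1.2 + h v2) <= r.2].
have cQ : convex_cone Q.
  split=> [|r s [v rv] [v' sv]|t r t0 [v rv]].
  - by exists 0; rewrite /= !linear0 !addr0 subr0 (sublinear0 sp2) mulr0.
  - exists (v + v'); cbn [fst snd]; apply: le_trans (lerD rv sv).
    have := ler_wpM2l (ltW C0) (sp2.1 (r.1.1, v) (s.1.1, v')).
    rewrite !topdualD mulrDr; move: (C * p2 _) (C * p2 _) (C * p2 _); lra_atoms.
  - exists (t *: v); cbn [fst snd]; rewrite !topdualZ.
    have := ler_wpM2l (ltW t0) rv; apply: le_trans.
    have -> : p2 (t *: r.1.1, t *: v) = t * p2 (r.1.1, v) by rewrite -sp2.2// ltW.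
    by rewrite -mulrDr -mulrDr mulrCA -mulrBr.
have pQ r : Q r -> 0 <= p r.1 + r.2.
  move=> [v rv]; have := dle r.1.1 r.1.2 v; rewrite mulrDr -surjective_pairing.
  by move: rv; rewrite /p; move: (C * _) (C * _) (_ + _ + _); lra_atoms.
have [phi [phiD phiZ phip phiQ]] := sandwich sp cQ pQ.
have phin a : phi a <= C * `|a|.
  apply: le_trans (phip a) _; rewrite ler_pM2l//.
  rewrite p1E; apply: (clarke_dir_le (set_dist_lip nO1)).
  exact: (clarke_le_norm (set_dist_lip nO1)).
have [a|G GE _] := topdual_extend phiD phiZ (ltW C0).
  rewrite ler_norml phin andbT lerNl.
  have <- : phi (- a) = - phi a by rewrite -scaleN1r phiZ mulN1r.
  by rewrite -[`|a|]normrN.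
have [f1 [h1 [Gfh _ _]]] := pair_topdualP G.
have lowG u v1 v2 : f u + h v1 + h v2 - (f1 u + h1 v1) <= C * p2 (u, v2).
  have := phiQ ((u, v1), C * p2 (u, v2) - (f u + h v1 + h v2)).
  rewrite -GE Gfh pair_topdualE; cbn [fst snd] => /(_ _) le.
  have {}le := le (ex_intro _ v2 (lexx _)).
  by move: le; move: (C * _) (_ + _ + _); lra_atoms.
have hh1 : h = h1.
  have le v : h v <= h1 v.
    have := lowG 0 v 0; rewrite !linear0 (sublinear0 sp2) mulr0; lra_atoms.
  apply: topdualP => v; apply/eqP; rewrite eq_le le /=.
  by have := le (- v); rewrite !topdualN lerN2.
have cone (O' : set (X * Y)) (z : X * Y) (F : topdual (X * Y)%type) : O' !=set0 ->
    (forall a, F a <= C * clarke_dir (set_dist O') z a) -> clarke_cone O' z F.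
  move=> nO' FC; exists C, (C^-1 *: F); split=> //; last first.
    by rewrite scalerA mulfV ?scale1r// gt_eqF.
  apply/(clarke_subdiff_dir (set_dist_lip nO')) => v.
  by rewrite topdual_scaleE ler_pdivrMl.
exists f1, (f - f1); split; first by rewrite addrC subrK.
  by apply: cone => // a; rewrite hh1 -Gfh GE -p1E; exact: phip.
apply: cone => // -[u v]; rewrite pair_topdualE topdual_addE topdual_oppE -p2E.
by have := lowG u 0 v; rewrite !linear0 !addr0 addrAC.
Qed.

(** The cones are invariant under scaling, so failure for every [M] yields pairs with [|f1| = 1]
    while [f1 + f2] and [h] tend to zero, against [qualified_null]. *)
Lemma clarke_cone_bound : exists2 M : R, 0 <= M & forall f1 f2 h,
  clarke_cone O1 (x, y1) (pair_topdual f1 h) ->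
  clarke_cone O2 (x, y2) (pair_topdual f2 h) ->
  `|f1| <= M * (`|f1 + f2| + `|h|).
Proof.
apply: contrapT => nM.
have ex (k : nat) : exists F : (topdual X * topdual X) * topdual Y,
    [/\ clarke_cone O1 (x, y1) (pair_topdual F.1.1 F.2),
        clarke_cone O2 (x, y2) (pair_topdual F.1.2 F.2),
        `|F.1.1| = 1, `|F.1.1 + F.1.2| <= k.+1%:R^-1 & `|F.2| <= k.+1%:R^-1 ].
  apply: contrapT => nk; apply: nM; exists k.+1%:R => // f1 f2 h C1 C2.
  rewrite leNgt; apply/negP => lt; apply: nk.
  have f0 : 0 < `|f1|.
    by apply: le_lt_trans lt; rewrite mulr_ge0// addr_ge0.
  pose s := `|f1|^-1; have s0 : 0 < s by rewrite invr_gt0.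
  have sle : s * (`|f1 + f2| + `|h|) <= k.+1%:R^-1.
    by rewrite ler_pdivrMl// mulrC ler_pdivlMl// ltW.
  have scale O' z F : clarke_cone O' z F -> clarke_cone O' z (s *: F).
    move=> [l [H [l0 dH ->]]]; exists (s * l), H; rewrite scalerA.
    by split=> //; rewrite mulr_gt0.
  exists ((s *: f1, s *: f2), s *: h); cbn [fst snd]; split.
  - by rewrite -pair_topdualZ; exact: scale.
  - by rewrite -pair_topdualZ; exact: scale.
  - by rewrite normrZ gtr0_norm// mulVf// gt_eqF.
  - rewrite -scalerDr normrZ gtr0_norm//; apply: le_trans sle.
    by rewrite ler_pM2l// lerDl.
  - rewrite normrZ gtr0_norm//; apply: le_trans sle.
    by rewrite ler_pM2l// lerDr.
have [F FP] := choice ex.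
have lhs O' (z : X * Y) (G : nat -> topdual (X * Y)%type) :
    (forall k, clarke_cone O' z (G k)) -> exists l H, forall k,
    [/\ 0 < (l k : R), clarke_subdiff (set_dist O') z (H k) & G k = l k *: H k].
  move=> CG; have ex2 k : exists lH : R * topdual (X * Y)%type, [/\ 0 < lH.1,
      clarke_subdiff (set_dist O') z lH.2 & G k = lH.1 *: lH.2].
    by have [l [H ?]] := CG k; exists (l, H).
  have [lH lHP] := choice ex2; exists (fun k => (lH k).1), (fun k => (lH k).2) => k.
  exact: lHP.
have [l1 [H1 P1]] := lhs _ _ (fun k => pair_topdual (F k).1.1 (F k).2)
  (fun k => let: And5 a _ _ _ _ := FP k in a).
have [l2 [H2 P2]] := lhs _ _ (fun k => pair_topdual (F k).1.2 (F k).2)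
  (fun k => let: And5 _ a _ _ _ := FP k in a).
have to0 (a : nat -> R) : (forall k, `|a k| <= k.+1%:R^-1) -> a k @[k --> \oo] --> (0 : R).
  by move=> ak; apply: cvg0_le ak _; exact: cvg_harmonic.
apply: (@not_vanishing R (fun k => `|(F k).1.1|)).
  by move=> k; have [_ _ -> _ _] := FP k; rewrite gerBl.
apply: (@qualified_null R X Y O1 O2 x y1 y2 rX rY cF1 cF2 psc qual
  (fun=> (x, y1)) (fun=> (x, y2)) _ (fun k => (F k).1.2)
  (fun k => (F k).2) (fun k => (F k).2) l1 l2 H1 H2 1).
- exact: cvg_cst.
- exact: cvg_cst.
- by move=> k; have [l0 dH E] := P1 k; split=> //; exact: ltW.
- by move=> k; have [l0 dH E] := P2 k; split=> //; exact: ltW.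
- by apply: to0 => k; rewrite normr_id; case: (FP k).
- by apply: to0 => k; rewrite normr_id; case: (FP k).
- by apply: to0 => k; rewrite normr_id; case: (FP k).
- by move=> k; have [_ _ -> _ _] := FP k.
- move=> U f UU ooU; apply: clarke_normal_limit => k.
  by case: (FP k).
- move=> U f UU ooU; apply: clarke_normal_limit => k.
  by case: (FP k).
Qed.

(** Norm approximants in the unclosed cone are split. Their first parts are bounded and have an
    ultralimit [f1]; the second parts then tend to [f - f1], because the sums tend to [f]. *)
Theorem clarke_normal_sum (f : topdual X) (h : topdual Y) :
  clarke_normal (x, y) O (pair_topdual f h) -> exists f1 f2,
  [/\ f = f1 + f2, clarke_normal (x, y1) O1 (pair_topdual f1 h) &
      clarke_normal (x, y2) O2 (pair_topdual f2 h)].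
Proof.
move=> Nfh.
have [C C0 CH] := sum_clarke_le; have [M M0 MH] := clarke_cone_bound.
have rXY : reflexive_space (X * Y)%type by exact: reflexive_prod.
have ex (k : nat) : exists F : (topdual X * topdual X) * topdual Y,
    [/\ clarke_cone O1 (x, y1) (pair_topdual F.1.1 F.2),
        clarke_cone O2 (x, y2) (pair_topdual F.1.2 F.2),
        `|f - (F.1.1 + F.1.2)| <= k.+1%:R^-1 & `|h - F.2| <= k.+1%:R^-1 ].
  have k0 : 0 < k.+1%:R^-1 :> R by rewrite invr_gt0.
  have [_ [l [G [l0 dG ->]]] le] := clarke_normal_approx rXY Nfh k0.
  have [g [b [GE _ _]]] := pair_topdualP G; rewrite GE in dG le.
  have [g1 [g2 [gE [l1 [H1 [l10 dH1 E1]]] [l2 [H2 [l20 dH2 E2]]]]]] :=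
    sum_subdiff_split C0 CH dG.
  exists ((l *: g1, l *: g2), l *: b); cbn [fst snd]; split.
  - by exists (l * l1), H1; rewrite -pair_topdualZ E1 scalerA mulr_gt0.
  - by exists (l * l2), H2; rewrite -pair_topdualZ E2 scalerA mulr_gt0.
  - rewrite -scalerDr -gE; apply: le_trans le.
    by rewrite pair_topdualZ pair_topdualB; exact: pair_topdual_fst.
  - apply: le_trans le.
    by rewrite pair_topdualZ pair_topdualB; exact: pair_topdual_snd.
have [F FP] := choice ex.
have inv1 (n : nat) : n.+1%:R^-1 <= 1 :> R by rewrite invf_le1// ler1n.
have bound k : `|(F k).1.1| <= M * ((`|f| + 1) + (`|h| + 1)).
  have [C1 C2 fF hF] := FP k; apply: le_trans (MH _ _ _ C1 C2) _.
  rewrite ler_wpM2l//; apply: lerD.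
    have := ler_normB f (f - ((F k).1.1 + (F k).1.2)); rewrite subKr => /le_trans; apply.
    by rewrite lerD2l; exact: le_trans (inv1 k).
  have := ler_normB h (h - (F k).2); rewrite subKr => /le_trans; apply.
  by rewrite lerD2l; exact: le_trans (inv1 k).
have [U UU ooU] := ultra_oo_extension.
have [f1 _ f1U] := dual_ultralimit UU bound.
have toU (V : normedModType R) (g : topdual V) (g_ : nat -> topdual V) u :
    (forall k, `|g - g_ k| <= k.+1%:R^-1) -> g_ k u @[k --> U] --> g u.
  move=> gg; suff H : g_ k u @[k --> \oo] --> g u by move=> A /H; exact: ooU.
  apply/cvgrPdist_le => e e0.
  have /cvgrPdist_le/(_ e e0) := @cvg_natSinv R `|u|.
  apply: filterS => k /=; rewrite sub0r normrN => le.
  have -> : g u - g_ k u = (g - g_ k) u by [].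
  apply: le_trans (topdual_le _ _) _; apply: le_trans (le_trans (ler_norm _) le).
  by rewrite mulrC ler_wpM2l.
have hU u : (F k).2 u @[k --> U] --> h u by apply: toU => k; case: (FP k).
exists f1, (f - f1); split; first by rewrite addrC subrK.
  apply: (@clarke_normal_limit R _ _ _ U (fun k => pair_topdual (F k).1.1 (F k).2)).
    by move=> k; case: (FP k).
  by move=> u; rewrite pair_topdualE; apply: cvgD; [exact: f1U|exact: hU].
apply: (@clarke_normal_limit R _ _ _ U (fun k => pair_topdual (F k).1.2 (F k).2)).
  by move=> k; case: (FP k).
move=> u; rewrite pair_topdualE; apply: cvgD; last exact: hU.
rewrite (_ : (fun k => (F k).1.2 u.1) =
    (fun k => ((F k).1.1 + (F k).1.2) u.1 - (F k).1.1 u.1)).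
  rewrite topdual_addE topdual_oppE; apply: cvgB; last exact: f1U.
  by apply: (@toU X f (fun k => (F k).1.1 + (F k).1.2)) => k; case: (FP k).
by apply/funext => k; rewrite topdual_addE addrC addKr.
Qed.

End SumRule.

Theorem theorem4p3 (R : realType) (X Y : completeNormedModType R)
    (hX : reflexive_space X) (hY : reflexive_space Y)
    (F1 F2 : X -> set Y)
    (cF1 : closed (gph F1)) (cF2 : closed (gph F2))
    (x : X) (y : Y) (hxy : gph (sum_mapping F1 F2) (x, y))
    (y1 y2 : Y) (hy : sum_decomposition F1 F2 (x, y) (y1, y2))
    (hS : inner_semicontinuous (sum_decomposition F1 F2) (x, y) (y1, y2))
    (hcompact : pscnc F1 x y1 \/ pscnc F2 x y2)
    (hqual : clarke_coderivative F1 x y1 0 `&`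
             (-%R @` clarke_coderivative F2 x y2 0) = [set 0]) :
  forall g : topdual Y,
    clarke_coderivative (sum_mapping F1 F2) x y g `<=`
    minkowski_sum (clarke_coderivative F1 x y1 g) (clarke_coderivative F2 x y2 g).
Proof.
have qual (f : topdual X) : clarke_normal (x, y1) (gph F1) (pair_topdual f 0) ->
    clarke_normal (x, y2) (gph F2) (pair_topdual (- f) 0) -> f = 0.
  move=> N1 N2; suff : [set 0] f by [].
  rewrite -hqual; split; first by rewrite /clarke_coderivative /= oppr0.
  by exists (- f); rewrite ?opprK// /clarke_coderivative /= oppr0.
move=> g f Nf.
have [f1 [f2 [-> N1 N2]]] := clarke_normal_sum hX hY cF1 cF2 hy hS hcompact qual Nf.
by exists f1 => //; exists f2.
Qed.
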